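(* Let $\bar k\ge 1$ be an integer, $f_1,\dots,f_m:\mathbb{R}^n\to\mathbb{R}^n$ vector fields, $\mathcal{T}\subset\mathbb{R}^n$ a target, $A=\{\pm e_1,\dots,\pm e_m\}$ where $e_1,\dots,e_m$ is the canonical basis of $\mathbb{R}^m$, and $l:\mathbb{R}^n\times A\to[0,+\infty[$ a Lagrangian. Assume that: (H1) $\mathcal{T}$ is closed with compact boundary; (H2) for every $a\in A$ the function $l(\cdot,a)$ is locally Lipschitz continuous on $\mathbb{R}^n$, and for every bounded nonempty (open) set $\Omega\subset\mathbb{R}^n$ the vector fields $f_1,\dots,f_m$ belong to $C^{\bar k-1,1}_b(\Omega)$, i.e. they are of class $C^{\bar k-1}$ with bounded derivatives up to order $\bar k-1$ and with $(\bar k-1)$-th derivative Lipschitz continuous on $\Omega$. Consider the control system $\dot y(s)=\sum_{i=1}^m f_i(y(s))\,\alpha^i(s)$, $\alpha(s)\in A$. Then the following conditions are equivalent (all notions being as defined in the context): (i) the control system is degree-$k$ $U$-sample stabilizable to $\mathcal{T}$ for some $k\ge1$ and some function $U$; (ii) the control system is degree-$k$ sample stabilizable to $\mathcal{T}$ in the single-rank sense for some $k\ge1$; (iii) the control system is sample stabilizable to $\mathcal{T}$, i.e. degree-$1$ sample stabilizable to $\mathcal{T}$ in the single-rank sense.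
   Context: Notation: $\mathbb{R}_{\ge0}=[0,+\infty[$, $\mathbb{R}_{>0}=]0,+\infty[$, $s\wedge t=\min\{s,t\}$, $\mathbf{d}(x)=\inf_{y\in\mathcal{T}}|x-y|$. A continuous $G:\overline{\Omega}\to\mathbb{R}$ ($\Omega\subset\mathbb{R}^n$ open) is positive definite if $G>0$ on $\Omega$ and $G=0$ on $\partial\Omega$; it is proper if $G^{-1}(K)$ is compact for every compact $K\subset\mathbb{R}_{\ge0}$. Admissible pairs. $(\alpha,y)$ is an admissible control-trajectory pair from $x\in\mathbb{R}^n\setminus\mathcal{T}$ if there is $S_y\le+\infty$ such that $\alpha:[0,S_y[\to A$ is Lebesgue measurable, and $y:[0,S_y[\to\mathbb{R}^n\setminus\mathcal{T}$ is a Carathéodory solution of $\dot y=\sum_i f_i(y)\alpha^i$ with $y(0)=x$, satisfying, if $S_y<+\infty$, $\lim_{s\to S_y^-}\mathbf{d}(y(s))=0$. If $S_y<+\infty$, one extends $\alpha,y$ to $\mathbb{R}_{\ge0}$ by $\alpha(s)=\bar a$ ($\bar a\in A$ arbitrary) and $y(s)=\lim_{\sigma\to S_y^-}y(\sigma)$ for $s\ge S_y$. Formal brackets. The Lie bracket is $[g_1,g_2]=Dg_2\cdot g_1-Dg_1\cdot g_2$. An iterated formal bracket $B=B(X_{c+1},\dots,X_{c+\ell})$ ($c\ge0$, $\ell\ge1$) is a bracketing of the sequence of letters $X_{c+1},\dots,X_{c+\ell}$ in this order, each used once; $\ell_B=\ell$ is its degree (a single letter $X_i$ has degree 1). If $\ell_B\ge2$,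 $B$ factorizes uniquely as $B=[B_1,B_2]$. The switch number is $\mathfrak{s}_B=1$ if $\ell_B=1$, and $\mathfrak{s}_B=2(\mathfrak{s}_{B_1}+\mathfrak{s}_{B_2})$ if $B=[B_1,B_2]$. For a string $\mathbf{g}=(g_1,\dots,g_q)$, $q\ge c+\ell$, of continuous vector fields, $B(\mathbf{g})$ is obtained by replacing each $X_j$ by $g_j$. $(B,\mathbf{g})$ is an admissible bracket pair (of degree $\ell_B$) if $\mathbf{g}$ is of class $C^B$: there are integers $k_1,\dots,k_q\ge0$ with $g_i$ of class $C^{k_i}$ such that from this information alone one deduces that $B(\mathbf{g})$ is a continuous vector field (i.e. each $g_j$ whose letter $X_j$ occurs in $B$ is of class $C^{d_j}$, where $d_j$ is the number of bracket pairs of $B$ enclosing $X_j$). Control labels. For $k\ge1$, $\mathcal{F}^{(k)}$ is the set of triples $(B,\mathbf{g},\mathrm{sgn})$ with $\mathrm{sgn}\in\{+,-\}$ and $(B,\mathbf{g})$ an admissible bracket pair of degree $\ell_B\le k$ such that every component of $\mathbf{g}$ belongs to $\{f_1,\dots,f_m\}$. Oriented controls. For $t>0$ and $(B,\mathbf{g},\pm)\in\mathcal{F}^{(k)}$, define $\alpha_{(B,\mathbf{g},\pm),t}:[0,t]\to A$ recursively: if $B=X_j$, $\alpha_{(B,\mathbf{g},+),t}\equiv e_i$, where $i$ is such that $g_j=f_i$; for every $B$, $\alpha_{(B,\mathbf{g},-),t}(s)=-\alpha_{(B,\mathbf{g},+),t}(t-s)$; if $B=[B_1,B_2]$, with $\mathfrak{s}_i=\mathfrak{s}_{B_i}$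 and $\mathfrak{s}=\mathfrak{s}_B$, $\alpha_{(B,\mathbf{g},+),t}$ is the concatenation, in this order, of $\alpha_{(B_1,\mathbf{g},+),\mathfrak{s}_1t/\mathfrak{s}}$, $\alpha_{(B_2,\mathbf{g},+),\mathfrak{s}_2t/\mathfrak{s}}$, $\alpha_{(B_1,\mathbf{g},-),\mathfrak{s}_1t/\mathfrak{s}}$, $\alpha_{(B_2,\mathbf{g},-),\mathfrak{s}_2t/\mathfrak{s}}$ (suitably translated in time to consecutive intervals). Feedback generators and multiflows. A degree-$k$ feedback generator is any map $\mathcal{V}:\mathbb{R}^n\setminus\mathcal{T}\to\mathcal{F}^{(k)}$, $\mathcal{V}(x)=(B_x,\mathbf{g}_x,\mathrm{sgn}_x)$; put $\ell(x)=\ell_{B_x}$. For $x\in\mathbb{R}^n\setminus\mathcal{T}$, $t>0$, let $\alpha_{x,t}(s)=\alpha_{\mathcal{V}(x),t}(s\wedge t)$, $s\ge0$. The $\mathcal{V}$-multiflow $y_{x,t}$ is the maximal (forward) solution of $\dot y=\sum_i f_i(y)\alpha^i_{x,t}(s)$, $y(0)=x$. Sampling processes. A partition of $\mathbb{R}_{\ge0}$ is $\pi=\{s_j\}_{j\ge0}$ with $s_0=0$, $s_j<s_{j+1}$, $s_j\to+\infty$. Given $\mathcal{V}$, $x\in\mathbb{R}^n\setminus\mathcal{T}$ and $\pi$, the $\mathcal{V}$-sampling trajectory $y_x^\pi$ and control $\alpha_x^\pi$ are defined recursively: $x_1=x$, and for $j\ge1$, $t_j=s_j-s_{j-1}$,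 $x_j=y_x^\pi(s_{j-1})$, let $\sigma_j$ be the supremum of the $\sigma\ge s_{j-1}$ such that $s\mapsto y_{x_j,t_j}(s-s_{j-1})$ is defined on $[s_{j-1},\sigma[$ with values in $\mathbb{R}^n\setminus\mathcal{T}$; set $y_x^\pi(s)=y_{x_j,t_j}(s-s_{j-1})$ and $\alpha_x^\pi(s)=\alpha_{x_j,t_j}(s-s_{j-1})$ for $s\in[s_{j-1},s_j\wedge\sigma_j[$; if $\sigma_j>s_j$ continue from $x_{j+1}=y_{x_j,t_j}(t_j)$, otherwise stop and set $\mathbf{j}=j$. Here $\mathbf{j}=\inf\{j:\sigma_j\le s_j\}$ ($\mathbf{j}=+\infty$, $\sigma_{\mathbf{j}}=+\infty$ if this set is empty), and $y_x^\pi,\alpha_x^\pi$ are defined on $[0,\sigma_{\mathbf{j}}[$. $(x,\pi,\alpha_x^\pi,y_x^\pi)$ is called a $\mathcal{V}$-sampling process; it is admissible if $(\alpha_x^\pi,y_x^\pi)$ is an admissible pair from $x$ (with $S_y=\sigma_{\mathbf{j}}$; in that case, if $\sigma_{\mathbf j}<+\infty$, it is extended to $\mathbb{R}_{\ge0}$ by setting $\alpha_x^\pi(s)=\bar a$ ($\bar a\in A$ arbitrary) and $y_x^\pi(s)=\lim_{\sigma\to\sigma_{\mathbf{j}}^-}y_x^\pi(\sigma)$ for $s\ge\sigma_{\mathbf{j}}$). For a multirank $\mathfrak{d}=(\delta_1,\dots,\delta_k)\in\mathbb{R}_{>0}^k$, it is called $\mathfrak{d}$-scaled if $\frac{k-1}{k}\,\delta_{\ell_j}\le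 s_j-s_{j-1}\le\delta_{\ell_j}$, $\ell_j=\ell(y_x^\pi(s_{j-1}))$, for all integers $j\ge1$ with $j\le\mathbf{j}$. Degree-$k$ $U$-sample stabilizability (multirank sense; used in (i)). Let $U:\overline{\mathbb{R}^n\setminus\mathcal{T}}\to\mathbb{R}_{\ge0}$ be continuous, proper, positive definite. The system is degree-$k$ $U$-sample stabilizable to $\mathcal{T}$ if there exist a degree-$k$ feedback generator $\mathcal{V}$, a multirank map $\mathfrak{d}:\mathbb{R}_{>0}^2\to\mathbb{R}_{>0}^k$, continuous, strictly increasing, unbounded functions $\Gamma,\varphi:\mathbb{R}_{\ge0}\to\mathbb{R}_{\ge0}$ with $\Gamma(0)=\varphi(0)=0$, and a function $\mathbf{T}:\mathbb{R}_{>0}^2\to\mathbb{R}_{>0}$ increasing in the first and decreasing in the second variable, such that for any $0<r<R$ every $\mathfrak{d}(R,r)$-scaled $\mathcal{V}$-sampling process $(x,\pi,\alpha_x^\pi,y_x^\pi)$ with $\mathbf{d}(x)\le R$ is admissible and satisfies: (a) $\mathbf{d}(y_x^\pi(s))\le\Gamma(R)$ for all $s\ge0$; (b) $\inf\{s\ge0: U(y_x^\pi(s))\le\varphi(r)\}\le\mathbf{T}(R,r)$; (c) if $U(y_x^\pi(\tau))\le\varphi(r)$ for some $\tau>0$, then $\mathbf{d}(y_x^\pi(s))\le r$ for all $s\ge\tau$. Degree-$k$ sample stabilizability in the single-rank sense (used in (ii), (iii)). Given $\delta>0$, a partition $\pi=\{s_j\}_j$ of $\mathbb{R}_{\ge0}$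 is a degree-$k$ partition of rank $\delta$ if $\frac{k-1}{2k}\cdot\frac{\delta}{\sqrt[k]{j}}\le s_j-s_{j-1}\le\delta$ for every integer $j\ge1$. The system is degree-$k$ sample stabilizable to $\mathcal{T}$ in the single-rank sense if there exist a degree-$k$ feedback generator $\mathcal{V}$, a map $\delta:\mathbb{R}_{>0}^2\to\mathbb{R}_{>0}$, a continuous, strictly increasing, unbounded function $\Gamma:\mathbb{R}_{\ge0}\to\mathbb{R}_{\ge0}$ with $\Gamma(0)=0$, and a function $\mathbf{S}:\mathbb{R}_{>0}^2\to\mathbb{R}_{>0}$ increasing in the first and decreasing in the second variable, such that for any $0<r<R$, any degree-$k$ partition $\pi$ of rank $\delta(R,r)$ and any $x\in\mathbb{R}^n\setminus\mathcal{T}$ with $\mathbf{d}(x)\le R$, any $\mathcal{V}$-sampling process $(x,\pi,\alpha_x^\pi,y_x^\pi)$ is admissible and satisfies: (a) $\mathbf{d}(y_x^\pi(s))\le\Gamma(R)$ for all $s\ge0$; (b) $\mathbf{d}(y_x^\pi(s))\le r$ for all $s\ge\mathbf{S}(R,r)$. *)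

(* Defs.v *)
From mathcomp Require Import all_boot all_order all_algebra.
From mathcomp Require Import all_classical all_reals all_analysis.
From mathcomp Require Import measurable_realfun.

Set Implicit Arguments.
Unset Strict Implicit.
Unset Printing Implicit Defensive.

Import Order.TTheory GRing.Theory Num.Theory.
Import numFieldNormedType.Exports.

Local Open Scope classical_set_scope.
Local Open Scope ring_scope.

(* The norm of the library on 'rV[R]_n is the max norm; it is used below only
   where the choice of an equivalent norm is immaterial (topology, Lipschitz
   continuity, boundedness, absolute continuity).  Distances are Euclidean. *)
Definition enorm (R : realType) (n : nat) (x : 'rV[R]_n) : R :=
  Num.sqrt (\sum_(i < n) x ord0 i ^+ 2).

(* Extended real-valued, so that the distance to the empty set is +oo. *)
Definition dist (R : realType) (n : nat) (T : set 'rV[R]_n) (x : 'rV[R]_n) :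
    \bar R :=
  ereal_inf [set (enorm (x - y))%:E | y in T].

Definition boundary (T : topologicalType) (A : set T) : set T :=
  closure A `\` A°.

Definition positive_definite (R : realType) (n : nat) (Omega : set 'rV[R]_n)
    (G : 'rV[R]_n -> R) : Prop :=
  (forall x, Omega x -> 0 < G x) /\ (forall x, boundary Omega x -> G x = 0).

Definition proper (R : realType) (n : nat) (Omega : set 'rV[R]_n)
    (G : 'rV[R]_n -> R) : Prop :=
  forall K : set R, K `<=` [set r | 0 <= r] -> compact K ->
    compact (closure Omega `&` G @^-1` K).

Section regularity.
Context {R : realType} {n : nat}.
Implicit Types (Omega : set 'rV[R]_n) (g : 'rV[R]_n -> 'rV[R]_n).

Definition partial (i : 'I_n) g : 'rV[R]_n -> 'rV[R]_n :=
  'D_(delta_mx ord0 i) g.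

Fixpoint of_class_C (k : nat) Omega g : Prop :=
  match k with
  | 0 => forall x, Omega x -> {for x, continuous g}
  | k'.+1 => (forall x, Omega x -> differentiable g x) /\
             (forall i, of_class_C k' Omega (partial i g))
  end.

Definition iter_partial (s : seq 'I_n) g : 'rV[R]_n -> 'rV[R]_n :=
  foldr partial g s.

(* C^{k,1}_b(Omega), for an open set Omega *)
Definition of_class_Ck1b (k : nat) Omega g : Prop :=
  [/\ of_class_C k Omega g,
      forall s : seq 'I_n, (size s <= k)%N ->
        [bounded iter_partial s g x | x in Omega] &
      forall s : seq 'I_n, size s = k ->
        [lipschitz iter_partial s g x | x in Omega]].

End regularity.

Definition locally_lipschitz (R : realType) (n : nat) (g : 'rV[R]_n -> R) :
    Prop :=
  forall x : 'rV[R]_n, exists2 N : set 'rV[R]_n, nbhs x N &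
    [lipschitz (g z : R^o) | z in N].

Section control_system.
Context {R : realType} {n m : nat}.
Variables (f : 'I_m -> 'rV[R]_n -> 'rV[R]_n) (T : set 'rV[R]_n).

Definition control_set : set 'rV[R]_m :=
  [set a | exists i, a = delta_mx ord0 i \/ a = - delta_mx ord0 i].

Definition dynamics (y : 'rV[R]_n) (a : 'rV[R]_m) : 'rV[R]_n :=
  \sum_(i < m) a ord0 i *: f i y.

Definition absolutely_continuous_on (a b : R) (y : R -> 'rV[R]_n) : Prop :=
  forall e : R, 0 < e -> exists2 d : R, 0 < d &
    forall (N : nat) (u v : 'I_N -> R),
      (forall i, a <= u i /\ u i <= v i /\ v i <= b) ->
      (forall i j, i != j -> v i <= u j \/ v j <= u i) ->
      \sum_i (v i - u i) < d ->
      \sum_i `|y (v i) - y (u i)| < e.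

(* Caratheodory solution on [0, S[ of y' = sum_i f_i(y) alpha^i, y(0) = x; the
   values of alpha and y outside [0, S[ are irrelevant. *)
Definition is_solution (alpha : R -> 'rV[R]_m) (x : 'rV[R]_n) (S : \bar R)
    (y : R -> 'rV[R]_n) : Prop :=
  [/\ (0 < S)%E, y 0 = x,
      forall b : R, 0 <= b -> (b%:E < S)%E -> absolutely_continuous_on 0 b y &
      {ae @lebesgue_measure R, forall s : R, 0 < s -> (s%:E < S)%E ->
        is_derive s (1 : R) y (dynamics (y s) (alpha s))}].

Definition is_maximal_solution (alpha : R -> 'rV[R]_m) (x : 'rV[R]_n)
    (S : \bar R) (y : R -> 'rV[R]_n) : Prop :=
  is_solution alpha x S y /\
  forall S' y', is_solution alpha x S' y' -> (S <= S')%E ->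
    (forall s : R, 0 <= s -> (s%:E < S)%E -> y' s = y s) -> S' = S.

(* Measurability with respect to the Lebesgue sigma-algebra (the completion of
   the Borel one), and not only Borel measurability. *)
Definition lebesgue_measurable_on (D : set R) (alpha : R -> 'rV[R]_m) : Prop :=
  forall i : 'I_m,
    measurable_fun (D : set (g_sigma_algebraType
                               (completed_algebra_gen (@lebesgue_measure R))))
      (fun s => alpha s ord0 i).

Definition admissible_pair (x : 'rV[R]_n) (S : \bar R)
    (alpha : R -> 'rV[R]_m) (y : R -> 'rV[R]_n) : Prop :=
  [/\ lebesgue_measurable_on [set s | 0 <= s /\ (s%:E < S)%E] alpha,
      forall s : R, 0 <= s -> (s%:E < S)%E -> control_set (alpha s),
      forall s : R, 0 <= s -> (s%:E < S)%E -> ~ T (y s),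
      is_solution alpha x S y &
      forall r : R, S = r%:E -> dist T (y s) @[s --> r^'-] --> 0%E].

Definition extend (S : \bar R) (y : R -> 'rV[R]_n) (s : R) : 'rV[R]_n :=
  if (s%:E < S)%E then y s else lim (y sigma @[sigma --> (fine S)^'-]).

End control_system.

(* Letter j stands for X_j, with j >= 1. *)
Inductive bracket : Type :=
| Letter of nat
| Bracket of bracket & bracket.

Fixpoint letters (B : bracket) : seq nat :=
  match B with
  | Letter j => [:: j]
  | Bracket B1 B2 => letters B1 ++ letters B2
  end.

Definition degree (B : bracket) : nat := size (letters B).

(* B is a bracketing of X_{c+1}, ..., X_{c+degree B}, in this order. *)
Definition iterated_bracket (c : nat) (B : bracket) : Prop :=
  letters B = iota c.+1 (degree B).

Fixpoint switch_number (B : bracket) : nat :=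
  match B with
  | Letter _ => 1
  | Bracket B1 B2 => 2 * (switch_number B1 + switch_number B2)
  end.

(* A string g = (g_1, ..., g_q) of elements of {f_1, ..., f_m} is represented by
   the sequence of the indices i_1, ..., i_q such that g_j = f_{i_j}. *)
Record label (m : nat) : Type := Label {
  label_bracket : bracket;
  label_string : seq 'I_m;
  label_sign : bool  (* true is +, false is - *)
}.

Section feedback.
Context {R : realType} {n m : nat}.
Variables (f : 'I_m -> 'rV[R]_n -> 'rV[R]_n) (T : set 'rV[R]_n).

(* Each g_j whose letter occurs in B is of class C^(d + d_j), with d_j the number
   of bracket pairs of B enclosing X_j. *)
Fixpoint of_class_CB (g : seq 'I_m) (d : nat) (B : bracket) : Prop :=
  match B with
  | Letter j =>
      if onth g j.-1 is Some i then of_class_C d setT (f i) else False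
  | Bracket B1 B2 => of_class_CB g d.+1 B1 /\ of_class_CB g d.+1 B2
  end.

Definition admissible_bracket_pair (B : bracket) (g : seq 'I_m) : Prop :=
  [/\ exists c, iterated_bracket c B /\ (c + degree B <= size g)%N,
      forall i, i \in g -> continuous (f i) &
      of_class_CB g 0 B].

Definition control_label (k : nat) (v : label m) : Prop :=
  (degree (label_bracket v) <= k)%N /\
  admissible_bracket_pair (label_bracket v) (label_string v).

Definition reverse_control (p : R -> R -> 'rV[R]_m) (t s : R) : 'rV[R]_m :=
  - p t (t - s).

(* At a switching time the value is the one of the later control. *)
Fixpoint positive_control (g : seq 'I_m) (B : bracket) (t s : R) : 'rV[R]_m :=
  match B with
  | Letter j => if onth g j.-1 is Some i then delta_mx ord0 i else 0
  | Bracket B1 B2 =>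
      let t1 := (switch_number B1)%:R * t / (switch_number B)%:R in
      let t2 := (switch_number B2)%:R * t / (switch_number B)%:R in
      if s < t1 then positive_control g B1 t1 s
      else if s < t1 + t2 then positive_control g B2 t2 (s - t1)
      else if s < t1 + t2 + t1 then
        reverse_control (positive_control g B1) t1 (s - (t1 + t2))
      else reverse_control (positive_control g B2) t2 (s - (t1 + t2 + t1))
  end.

Definition oriented_control (v : label m) : R -> R -> 'rV[R]_m :=
  let p := positive_control (label_string v) (label_bracket v) in
  if label_sign v then p else reverse_control p.

(* Feedback generators are total functions; their values on T are irrelevant. *)
Definition feedback_generator (k : nat) (V : 'rV[R]_n -> label m) : Prop :=
  forall x, ~ T x -> control_label k (V x).

Variable V : 'rV[R]_n -> label m.

Definition ell (x : 'rV[R]_n) : nat := degree (label_bracket (V x)).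

Definition multiflow_control (x : 'rV[R]_n) (t s : R) : 'rV[R]_m :=
  oriented_control (V x) t (Num.min s t).

Definition is_multiflow (x : 'rV[R]_n) (t : R) (S : \bar R)
    (z : R -> 'rV[R]_n) : Prop :=
  is_maximal_solution f (multiflow_control x t) x S z.

Definition is_partition (pi : nat -> R) : Prop :=
  [/\ pi 0%N = 0, forall j, pi j < pi j.+1 & pi j @[j --> \oo] --> +oo].

Definition exit_time (p : R) (S : \bar R) (z : R -> 'rV[R]_n) : \bar R :=
  ereal_sup [set sigma%:E | sigma in [set sigma : R | p <= sigma /\
    forall s : R, p <= s -> s < sigma -> ((s - p)%:E < S)%E /\ ~ T (z (s - p))]].

(* J represents the number of steps, in {1, 2, ...} or +oo (None). *)
Definition step_of (J : option nat) (j : nat) : Prop :=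
  (1 <= j)%N /\ if J is Some j0 then (j <= j0)%N else true.

(* (x, pi, alpha, y) is a V-sampling process with J steps, and alpha and y are
   defined on [0, sigma[; their values outside [0, sigma[ are irrelevant. *)
Definition sampling_process (x : 'rV[R]_n) (pi : nat -> R)
    (alpha : R -> 'rV[R]_m) (y : R -> 'rV[R]_n) (J : option nat)
    (sigma : \bar R) : Prop :=
  [/\ ~ T x, is_partition pi, y 0 = x,
      J <> Some 0%N /\ (J = None -> sigma = +oo%E) &
      forall j, step_of J j -> exists S z,
        let p := pi j.-1 in
        let t := pi j - p in
        let sigma_j := exit_time p S z in
        [/\ is_multiflow (y p) t S z,
            forall s : R, p <= s -> s < pi j -> (s%:E < sigma_j)%E ->
              y s = z (s - p) /\ alpha s = multiflow_control (y p) t (s - p) &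
            if J == Some j then (sigma_j <= (pi j)%:E)%E /\ sigma = sigma_j
            else ((pi j)%:E < sigma_j)%E /\ y (pi j) = z t]].

Definition scaled (k : nat) (d : k.-tuple R) (pi : nat -> R)
    (y : R -> 'rV[R]_n) (J : option nat) : Prop :=
  forall j, step_of J j ->
    let delta := nth 0 d (ell (y (pi j.-1))).-1 in
    (k%:R - 1) / k%:R * delta <= pi j - pi j.-1 /\ pi j - pi j.-1 <= delta.

Definition partition_of_rank (k : nat) (delta : R) (pi : nat -> R) : Prop :=
  is_partition pi /\
  forall j, (1 <= j)%N ->
    (k%:R - 1) / (2 * k%:R) * (delta / (j%:R `^ k%:R^-1)) <= pi j - pi j.-1 /\
    pi j - pi j.-1 <= delta.

End feedback.

Section stabilizability.
Context {R : realType} {n m : nat}.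
Variables (f : 'I_m -> 'rV[R]_n -> 'rV[R]_n) (T : set 'rV[R]_n).

Definition class_Kinfty (Gamma : R -> R) : Prop :=
  [/\ {within `[0, +oo[, continuous Gamma},
      forall s t : R, 0 <= s -> s < t -> Gamma s < Gamma t,
      Gamma 0 = 0 &
      forall M : R, exists2 s : R, 0 <= s & M < Gamma s].

Definition settling_bound (S : R -> R -> R) : Prop :=
  [/\ forall a b : R, 0 < a -> 0 < b -> 0 < S a b,
      forall a a' b : R, 0 < a -> a <= a' -> 0 < b -> S a b <= S a' b &
      forall a b b' : R, 0 < a -> 0 < b -> b <= b' -> S a b' <= S a b].

Definition admissible_U (U : 'rV[R]_n -> R) : Prop :=
  [/\ {within closure (~` T), continuous U},
      forall x : 'rV[R]_n, closure (~` T) x -> 0 <= U x,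
      proper (~` T) U &
      positive_definite (~` T) U].

(* The infimum of the empty set is +oo. *)
Definition hitting_time (u : R -> R) (c : R) : \bar R :=
  ereal_inf [set s%:E | s in [set s : R | 0 <= s /\ u s <= c]].

Definition U_sample_stabilizable (k : nat) (U : 'rV[R]_n -> R) : Prop :=
  exists (V : 'rV[R]_n -> label m) (d : R -> R -> k.-tuple R)
         (Gamma phi : R -> R) (TT : R -> R -> R),
    [/\ feedback_generator f T k V,
        forall a b : R, 0 < a -> 0 < b -> forall i, 0 < tnth (d a b) i,
        class_Kinfty Gamma /\ class_Kinfty phi,
        settling_bound TT &
        forall (rho r : R), 0 < r -> r < rho ->
        forall x pi alpha y J sigma,
          sampling_process f T V x pi alpha y J sigma ->
          scaled V (d rho r) pi y J ->
          (dist T x <= rho%:E)%E ->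
          let Y := extend sigma y in
          [/\ admissible_pair f T x sigma alpha y,
              forall s : R, 0 <= s -> (dist T (Y s) <= (Gamma rho)%:E)%E,
              (hitting_time (U \o Y) (phi r) <= (TT rho r)%:E)%E &
              forall tau : R, 0 < tau -> U (Y tau) <= phi r ->
                forall s : R, tau <= s -> (dist T (Y s) <= r%:E)%E]].

Definition sample_stabilizable (k : nat) : Prop :=
  exists (V : 'rV[R]_n -> label m) (delta : R -> R -> R)
         (Gamma : R -> R) (SS : R -> R -> R),
    [/\ feedback_generator f T k V,
        forall a b : R, 0 < a -> 0 < b -> 0 < delta a b,
        class_Kinfty Gamma,
        settling_bound SS &
        forall (rho r : R), 0 < r -> r < rho ->
        forall pi, partition_of_rank k (delta rho r) pi ->
        forall x, ~ T x -> (dist T x <= rho%:E)%E ->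
        forall alpha y J sigma,
          sampling_process f T V x pi alpha y J sigma ->
          let Y := extend sigma y in
          [/\ admissible_pair f T x sigma alpha y,
              forall s : R, 0 <= s -> (dist T (Y s) <= (Gamma rho)%:E)%E &
              forall s : R, SS rho r <= s -> (dist T (Y s) <= r%:E)%E]].

End stabilizability.

(* Main.v *)
(* Both (i) and (ii) provide open-loop controllability: every point with d <= rho
   (d being the distance to T) can be steered into {d <= r}, in a time bounded in
   terms of rho and r, along a curve staying in {d <= Gamma(rho)}. This already
   implies degree-1 stabilizability in both senses.

   On an annulus, take such curves y_i, reaching their goals at times tau_i, for
   finitely many starting points forming a fine net, and put
     W(x) = min over i and s in [0, tau_i] of
              theta + b e^{lambda theta} |x - y_i(s)|^2,   theta = tau_i - s.
   If (i, s) attains the minimum, hold the control that minimizes the scalar product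
   of x - y_i(s) with the velocity at x. The distance to the running point of y_i may
   grow exponentially because of the Lipschitz constant of the fields, but the weight
   e^{lambda theta} absorbs this, so W decreases at rate at least 1/2 for short times:
   no continuity of W or of the feedback is involved.

   Choose radii r_l, l in Z, with r_{l+1} = 2 Gamma(r_l) + 2 r_l, and thresholds c_l
   such that {d <= r_l} is contained in {W_l <= c_l}, itself contained in
   {2 d <= r_{l+1}}. These sublevel sets are nested. The global feedback uses the least
   l with W_l(x) <= c_l. If the sampling steps are small in terms of finitely many
   consecutive scales, then at sampling times the trajectories never leave one of the
   corresponding sublevel sets, and they reach the next smaller one in bounded time.
   With h(s) = 2 Gamma(s) + 2 s and H = h o h o h o h, one takes U = H o d, the overshoot
   bound H and phi = id. *)
Require Import Defs.
From mathcomp Require Import all_boot all_order all_algebra.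
From mathcomp Require Import all_classical all_reals all_analysis.
From mathcomp Require Import measurable_realfun.
From mathcomp Require Import zify ring lra.

Import Order.TTheory GRing.Theory Num.Theory.
Import numFieldNormedType.Exports.

Set Implicit Arguments.
Unset Strict Implicit.
Unset Printing Implicit Defensive.

Local Open Scope classical_set_scope.
Local Open Scope ring_scope.

(** * Euclidean geometry of row vectors *)

Section vectors.
Context {R : realType} {n : nat}.
Implicit Types p q u v x y : 'rV[R]_n.

(** Both hypotheses quantify over sampling processes, so nothing can be extracted from them before a
    process is shown to exist; hence the work on local existence and maximal extension. Oriented
    controls are constant near the start of their time interval, so Picard's theorem for autonomous
    equations suffices there. Caratheodory solutions satisfy the equation only almost everywhere;
    all estimates on them go through one inequality for the increments of a scalar product. The
    fields are bounded and Lipschitz on bounded sets only, and steering times may blow up as the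
    goal approaches [T]. This forces one function W per scale instead of a single one. The step
    bound is adapted to finitely many scales, so a trajectory is not followed below the lowest of
    them: there one only knows that a short step cannot carry it far. Locating a distance between
    two radii, waiting for the next sampling time and returning from a sublevel set to a distance
    each lose a scale; the iterates in [H] pay for these losses. *)

Definition dotp p u : R := \sum_(i < n) p ord0 i * u ord0 i.

Lemma dotpC p u : dotp p u = dotp u p.
Proof. by apply: eq_bigr => i _; rewrite mulrC. Qed.

Lemma dotpDr p u v : dotp p (u + v) = dotp p u + dotp p v.
Proof. by rewrite -big_split; apply: eq_bigr => i _; rewrite mxE mulrDr. Qed.

Lemma dotpZr p (c : R) u : dotp p (c *: u) = c * dotp p u.
Proof. by rewrite big_distrr; apply: eq_bigr => i _; rewrite mxE mulrCA. Qed.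

Lemma dotpNr p u : dotp p (- u) = - dotp p u.
Proof. by rewrite -scaleN1r dotpZr mulN1r. Qed.

Lemma dotpBr p u v : dotp p (u - v) = dotp p u - dotp p v.
Proof. by rewrite dotpDr dotpNr. Qed.

Lemma dotpDl p q u : dotp (p + q) u = dotp p u + dotp q u.
Proof. by rewrite !(dotpC _ u) dotpDr. Qed.

Lemma dotpNl p u : dotp (- p) u = - dotp p u.
Proof. by rewrite !(dotpC _ u) dotpNr. Qed.

Lemma coord_norm_le u i : `|u ord0 i| <= `|u|.
Proof.
by rewrite [leRHS]/Num.Def.normr/= mx_normrE (le_bigmax _ _ (ord0, i)).
Qed.

Lemma norm_le_coord u (c : R) : 0 <= c ->
  (forall i, `|u ord0 i| <= c) -> `|u| <= c.
Proof.
move=> c0 uc; rewrite [leLHS]/Num.Def.normr/= mx_normrE.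
by apply/bigmax_leP; split=> // -[i j] _ /=; rewrite (ord1 i).
Qed.

Lemma norm_dotp_le p u : `|dotp p u| <= n%:R * `|p| * `|u|.
Proof.
rewrite (le_trans (ler_norm_sum _ _ _))//.
rewrite (@le_trans _ _ (\sum_(i < n) `|p| * `|u|))//.
  by apply: ler_sum => i _; rewrite normrM ler_pM// coord_norm_le.
by rewrite sumr_const card_ord -mulrA mulr_natl.
Qed.

Lemma dotp_ge0 u : 0 <= dotp u u.
Proof. by apply: sumr_ge0 => i _; rewrite -expr2 sqr_ge0. Qed.

Lemma dotp_le u : dotp u u <= n%:R * `|u| ^+ 2.
Proof. by rewrite (le_trans (ler_norm _))// expr2 mulrA norm_dotp_le. Qed.

Lemma norm_sqr_le_dotp u : `|u| ^+ 2 <= dotp u u.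
Proof.
have ui i : `|u ord0 i| ^+ 2 <= dotp u u.
  rewrite /dotp (bigD1 i)//= real_normK ?num_real// expr2 lerDl.
  by apply: sumr_ge0 => j _; rewrite -expr2 sqr_ge0.
rewrite -[leRHS]sqr_sqrtr ?dotp_ge0// ler_sqr ?nnegrE ?sqrtr_ge0//.
apply: norm_le_coord; first exact: sqrtr_ge0.
by move=> i; rewrite -[leLHS]ger0_norm// -sqrtr_sqr ler_wsqrtr// ui.
Qed.

Lemma dotp_deltal (i : 'I_n) u : dotp (delta_mx ord0 i) u = u ord0 i.
Proof.
rewrite /dotp (bigD1 i)//= mxE !eqxx mul1r big1 ?addr0// => j ji.
by rewrite mxE (negbTE ji) andbF mul0r.
Qed.

Lemma enorm_dotp u : enorm u = Num.sqrt (dotp u u).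
Proof. by congr Num.sqrt; apply: eq_bigr => i _; rewrite expr2. Qed.

Lemma enormD u v : enorm (u + v) <= enorm u + enorm v.
Proof.
have CS : dotp u v <= enorm u * enorm v.
  rewrite !enorm_dotp -sqrtrM ?dotp_ge0// (le_trans (ler_norm _))//.
  rewrite -sqrtr_sqr ler_wsqrtr//.
  have [u0|u0] := eqVneq (dotp u u) 0.
    have := norm_sqr_le_dotp u; rewrite u0 => nu.
    have : `|u| ^+ 2 = 0 by apply/eqP; rewrite eq_le nu sqr_ge0.
    move=> /eqP; rewrite sqrf_eq0 normr_eq0 => /eqP ->.
    have -> : dotp 0 v = 0 by rewrite /dotp big1// => i _; rewrite mxE mul0r.
    by rewrite expr0n mulr_ge0 ?dotp_ge0.
  (* This vector is |u|^2 times the component of v orthogonal to u; its square is |u|^2 (|u|^2 |v|^2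
     - (u.v)^2). *)
  have := dotp_ge0 (dotp u u *: v - dotp u v *: u).
  rewrite dotpBr !dotpZr (dotpC _ v) (dotpC _ u) !dotpBr !dotpZr (dotpC v u).
  have u_gt0 : 0 < dotp u u by rewrite lt_def u0 dotp_ge0.
  move=> h; rewrite -subr_ge0 -(pmulr_rge0 _ u_gt0).
  by apply: le_trans h _; rewrite le_eqVlt; apply/orP; left; apply/eqP; ring.
have u0 : 0 <= enorm u + enorm v by rewrite addr_ge0// sqrtr_ge0.
rewrite -ler_sqr ?nnegrE ?sqrtr_ge0// [in leLHS]enorm_dotp sqr_sqrtr ?dotp_ge0//.
rewrite dotpDl !dotpDr (dotpC v u) sqrrD !enorm_dotp !sqr_sqrtr ?dotp_ge0//.
by rewrite -!enorm_dotp; lra.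
Qed.

Lemma enorm_le u : enorm u <= n%:R * `|u|.
Proof.
rewrite enorm_dotp -[leRHS]ger0_norm ?mulr_ge0// -sqrtr_sqr ler_wsqrtr//.
rewrite (le_trans (dotp_le u))// exprMn ler_wpM2r ?sqr_ge0//.
by rewrite -natrX ler_nat; case: n => // k; rewrite leq_pmulr.
Qed.

Lemma norm_le_enorm u : `|u| <= enorm u.
Proof.
rewrite enorm_dotp -[leLHS]ger0_norm// -sqrtr_sqr ler_wsqrtr//.
exact: norm_sqr_le_dotp.
Qed.

End vectors.

(** * Derivatives of curves as epsilon estimates *)

Section derivative.
Context {R : realType}.

(** Without the quotient, [h = 0] is included and the estimates on the two sides of [s] can be
    added, as is needed for a cell that contains [s]. *)
Lemma is_derive_epsP (W : normedModType R) (y : R -> W) (s : R) (D : W) :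
  is_derive s (1 : R) y D <->
  forall e : R, 0 < e -> exists2 d : R, 0 < d &
    forall h : R, `|h| < d -> `|y (s + h) - y s - h *: D| <= e * `|h|.
Proof.
split.
- move=> [dy Dy] e e0.
  have /cvgrPdist_le/(_ _ e0) : h^-1 *: (y (h + s) - y s) @[h --> 0^'] --> D.
    have := dy; rewrite /derivable => /cvg_ex[/= l yl].
    rewrite -Dy /derive; move: yl.
    under eq_fun do rewrite [_ *: 1]mulr1.
    by move=> yl; rewrite (cvg_lim _ yl).
  move=> /nbhs_ballP[/= d d0 dP]; exists d => // h hd.
  have [->|h0] := eqVneq h 0.
    by rewrite scale0r subr0 addr0 subrr !normr0 mulr0.
  have := dP h; rewrite /ball/= sub0r normrN => /(_ hd h0).
  rewrite -(ler_pM2r (x := `|h|)) ?normr_gt0// mulrC -normrZ scalerBr.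
  by rewrite scalerA divff// scale1r distrC (addrC h).
- move=> H.
  suff yl : h^-1 *: (y (h *: 1 + s) - y s) @[h --> 0^'] --> D.
    by split; [apply/cvg_ex; exists D|exact: cvg_lim].
  apply/cvgrPdist_le => e e0.
  have [d d0 dP] := H _ e0.
  apply/nbhs_ballP; exists d => //= h; rewrite /ball/= sub0r normrN => hd h0.
  have := dP h hd; rewrite -(ler_pM2r (x := `|h|^-1)) ?invr_gt0 ?normr_gt0//.
  rewrite mulfK ?normr_eq0// => /(le_trans _); apply.
  rewrite -[X in _ <= _ * X](normfV h) mulrC -normrZ !scalerBr.
  by rewrite scalerA mulVf// scale1r [h%:A]mulr1 (addrC h) distrC.
Qed.
End derivative.

(** * Absolutely continuous curves *)

Section increments.
Context {R : realType}.

(** Cousin's lemma as a chain of points: let t be the supremum of the points reachable from [u]. The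
    [eta] of t bridges the gap on its left, and it would allow a step beyond t if t were not [v]. *)
Lemma cousin (P : R -> R -> Prop) (u v : R) : u <= v ->
  (forall s, u <= s <= v -> exists2 eta : R, 0 < eta &
    forall s1 s2, s1 <= s <= s2 -> s1 < s2 -> s - eta < s1 -> s2 < s + eta ->
      P s1 s2) ->
  exists2 l : seq R, path (fun a b => `[< a < b /\ P a b >]) u l & last u l = v.
Proof.
move=> uv Ploc.
pose E := [set t | u <= t <= v /\
  exists2 l, path (fun a b => `[< a < b /\ P a b >]) u l & last u l = t].
have Eu : E u by split; [rewrite lexx uv|exists [::]].
have supE : has_sup E by split; [exists u|exists v => t [/andP[]]].
have uE : u <= sup E by apply: sup_upper_bound.
have Ev : sup E <= v by apply: ge_sup; [exists u|move=> t [/andP[]]].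
have [eta eta0 etaP] := Ploc (sup E) ltac:(by rewrite uE Ev).
have [t [/andP[ut tv] [l lP lt]] Et] := sup_adherent eta0 supE.
have tE : t <= sup E by apply: sup_upper_bound => //; split; [rewrite ut|exists l].
pose s2 := Num.min v (sup E + eta / 2).
have Es2 : sup E <= s2 by rewrite le_min Ev lerDl divr_ge0 ?ltW.
have s2v : s2 <= v by rewrite ge_min lexx.
have s2e : s2 < sup E + eta by rewrite /s2 gt_min; apply/orP; right; lra.
have [ts2|s2t] := ltP t s2; last first.
  have s2E : s2 = sup E by apply/le_anti; rewrite Es2 (le_trans s2t tE).
  have tv' : t = v.
    apply/le_anti; rewrite tv/=.
    have := s2t; rewrite /s2 ge_min => /orP[//|]; lra.
  by exists l => //; rewrite lt.
have Es : E s2.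
  split; first by rewrite s2v (le_trans uE Es2).
  exists (rcons l s2); last by rewrite last_rcons.
  rewrite rcons_path lP/= lt; apply/asboolP; split => //.
  by apply: etaP => //; rewrite tE Es2.
have s2E : s2 = sup E.
  by apply/le_anti; rewrite Es2 andbT; apply: sup_upper_bound.
have s2v' : s2 = v.
  by move: s2E; rewrite /s2; case: leP => // _ h; lra.
by case: Es => _ [l' ? ?]; exists l' => //; rewrite -s2v'.
Qed.

(** Half-open cells that merely touch are disjoint, so the total length is the measure of a disjoint
    union inside [O]. *)
Lemma sum_itv_le_measure (O : set R) (N : nat) (a b : 'I_N -> R) (d : R) :
  open O -> (@lebesgue_measure R O < d%:E)%E ->
  (forall i, a i <= b i) ->
  (forall i j, i != j -> b i <= a j \/ b j <= a i) ->
  (forall i, `[a i, b i[ `<=` O) ->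
  \sum_(i < N) (b i - a i) < d.
Proof.
move=> oO Od ab dis abO.
rewrite -lte_fin; apply: le_lt_trans Od.
rewrite -sumEFin.
have E i : ((b i - a i)%:E = @lebesgue_measure R `[a i, b i[%classic)%E.
  rewrite lebesgue_measure_itv/= lte_fin; case: ltP => //= ba.
  by rewrite (_ : a i = b i) ?subrr//; apply/le_anti; rewrite ab ba.
under eq_bigr do rewrite E.
rewrite -measure_semi_additive_ord//; first last.
- by apply: bigsetU_measurable => i _; exact: measurable_itv.
- apply/trivIsetP => i j _ _ ij; rewrite -subset0 => x [/=].
  rewrite !in_itv/= => /andP[x1 x2] /andP[x3 x4].
  by case: (dis i j ij) => h; lra.
apply: le_measure; rewrite ?inE.
- by apply: bigsetU_measurable => i _; exact: measurable_itv.
- exact: open_measurable.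
- by elim/big_ind : _ => // A B AO BO; rewrite subUset.
Qed.

(* The exceptional null set of times is covered by an open set of small measure;
   a Cousin chain splits [u, v] into cells on which either the derivative bound
   holds or the cell lies in that open set, where absolute continuity applies. *)
Lemma ac_dotp_increment n (y dy : R -> 'rV[R]_n) (p : 'rV[R]_n) (u v c : R) :
  u <= v -> absolutely_continuous_on u v y ->
  {ae @lebesgue_measure R, forall s, u < s -> s < v ->
     is_derive s (1 : R) y (dy s)} ->
  (forall s, u < s -> s < v -> c <= dotp p (dy s)) ->
  c * (v - u) <= dotp p (y v - y u).
Proof.
move=> uv acy aey cdy.
pose K := n%:R * `|p|.
have K0 : 0 <= K by rewrite mulr_ge0.
(* The losses: [e * (v - u)] on cells with a derivative estimate, [e] for the total length of the
   other cells, [K * e] for the variation of [y] on them. *)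
suff H e : 0 < e ->
    (c - e) * (v - u) - e - K * e <= dotp p (y v - y u).
  apply/ler_addgt0Pr => e e0.
  have w0 : 0 < v - u + 1 + K by lra.
  have := H (e / (v - u + 1 + K)) ltac:(by rewrite divr_gt0).
  set e' := e / _; have <- : e' * (v - u + 1 + K) = e by rewrite divfK// gt_eqF.
  lra.
move=> e0.
have [d d0 dP] := acy _ e0.
(* [d] comes from absolute continuity; the other bound keeps the total length of the cells inside
   [Q], multiplied by |c - e|, below [e]. *)
pose d' := Num.min d (e / (`|c - e| + 1)).
have d'0 : 0 < d'.
  by rewrite lt_min d0/= divr_gt0// ltr_wpDl.
case: aey => A [mA A0 NA].
pose A' := A `|` [set u] `|` [set v].
have mA' : measurable A'.
  by apply: measurableU; [apply: measurableU => //|]; exact: measurable_set1.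
have A'0 : @lebesgue_measure R A' = 0%E.
  apply/measure_negligible => //.
  apply: negligibleU; [apply: negligibleU|].
  - by apply/negligibleP.
  - by apply/negligibleP; [exact: measurable_set1|exact: lebesgue_measure_set1].
  - by apply/negligibleP; [exact: measurable_set1|exact: lebesgue_measure_set1].
have A'y : (@lebesgue_measure R A' < +oo)%E by rewrite A'0 ltry.
have [Q [oO A'Q Od]] := lebesgue_regularity_outer mA' A'y d'0.
have {}Od : (@lebesgue_measure R Q < d'%:E)%E.
  apply: le_lt_trans Od.
  have mO : measurable Q by exact: open_measurable.
  have := @measureDI _ _ _ (@lebesgue_measure R) _ _ mO mA'.
  rewrite (setIidr A'Q) [X in (_ + X)%E](_ : _ = 0%E); last exact: A'0.
  by rewrite adde0 => ->.
pose P s1 s2 := `[s1, s2[ `<=` Q \/ (c - e) * (s2 - s1) <= dotp p (y s2 - y s1).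
have Ploc s : u <= s <= v -> exists2 eta : R, 0 < eta &
    forall s1 s2, s1 <= s <= s2 -> s1 < s2 -> s - eta < s1 -> s2 < s + eta ->
      P s1 s2.
  move=> /andP[us sv].
  have [Os|nOs] := pselect (Q s).
    have /nbhs_ballP[eta /= eta0 etaP] := oO _ Os.
    exists eta => // s1 s2 /andP[s1s ss2] s12 h1 h2; left => x /=.
    rewrite in_itv/= => /andP[xs1 xs2]; apply: etaP; rewrite /ball/=.
    rewrite ltr_distlC; lra.
  have nA' : ~ A' s by move/A'Q.
  have us' : u < s.
    by rewrite lt_def us andbT; apply: contra_notN nA' => /eqP ->; left; right.
  have sv' : s < v.
    by rewrite lt_def sv andbT; apply: contra_notN nA' => /eqP <-; right.
  have /is_derive_epsP : is_derive s (1:R) y (dy s).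
    apply: contrapT => nds; apply: nA'; left; left; apply: NA => /= h.
    by apply: nds; apply: h.
  have e'0 : 0 < e / (K + 1) by rewrite divr_gt0// ltr_wpDl.
  move=> /(_ _ e'0)[eta eta0 etaP].
  have key h : `|h| < eta ->
      `|dotp p (y (s + h) - y s) - h * dotp p (dy s)| <= e * `|h|.
    move=> /etaP hh; rewrite -dotpZr -dotpBr (le_trans (norm_dotp_le _ _))//.
    rewrite -/K (@le_trans _ _ (K * (e / (K + 1) * `|h|)))//.
      by rewrite ler_wpM2l.
    rewrite mulrA ler_wpM2r// mulrCA ger_pMr// ler_pdivrMr ?ltr_wpDl// mul1r.
    by rewrite lerDl.
  exists eta => // s1 s2 /andP[s1s ss2] s12 h1 h2; right.
  have := key (s2 - s) ltac:(by rewrite ger0_norm; lra).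
  have := key (s1 - s) ltac:(by rewrite ler0_norm; lra).
  rewrite [s + _]addrC subrK [s + _]addrC subrK.
  rewrite [`|s1 - s|]ler0_norm ?subr_le0// [`|s2 - s|]ger0_norm ?subr_ge0//.
  rewrite !ler_distl !dotpBr => /andP[_ k1] /andP[k2 _].
  have cs := cdy _ us' sv'.
  have : c * (s2 - s) <= (s2 - s) * dotp p (dy s).
    by rewrite mulrC ler_wpM2l// subr_ge0.
  have : c * (s - s1) <= (s - s1) * dotp p (dy s).
    by rewrite mulrC ler_wpM2l// subr_ge0.
  lra.
have [l lP lv] := cousin uv Ploc.
pose N := size l.
pose t (i : nat) := nth v (u :: l) i.
have tP (i : 'I_N) : t i < t i.+1 /\ P (t i) (t i.+1).
  by have /(pathP v)/(_ i (ltn_ord i))/asboolP := lP.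
have t0 : t 0%N = u by [].
have tN : t N = v by rewrite -[RHS]lv; exact: (nth_last v (u :: l)).
pose b i := `[< `[t i, t i.+1[ `<=` Q >].
(* Cells not contained in [Q] are collapsed to a point, so that sums over all [i] count only those
   inside [Q]. *)
pose w (i : 'I_N) := if b i then t i.+1 else t i.
have tmono i j : (i <= j)%N -> (j <= N)%N -> t i <= t j.
  elim: j => [|j IH]; first by rewrite leqn0 => /eqP ->.
  rewrite leq_eqVlt => /orP[/eqP->//|ij jN].
  apply: (le_trans (IH ij (ltnW jN))).
  by have [/ltW] := tP (Ordinal jN).
have wt (i : 'I_N) : t i <= w i <= t i.+1.
  have [/ltW h _] := tP i.
  by rewrite /w; case: ifP => _; rewrite lexx h.
have wdis (i j : 'I_N) : i != j -> w i <= t j \/ w j <= t i.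
  rewrite neq_ltn => /orP[|] ij; [left|right].
    by have /andP[_ h] := wt i; apply: (le_trans h); apply: tmono => //; exact: ltnW.
  by have /andP[_ h] := wt j; apply: (le_trans h); apply: tmono => //; exact: ltnW.
have sumd' : \sum_(i < N) (w i - t i) < d'.
  apply: (sum_itv_le_measure oO Od) => // [i|i x]; first by have /andP[] := wt i.
  rewrite /= /w; case: ifP => [/asboolP bi|_]; first exact: bi.
  by rewrite in_itv/= => /andP[h1 h2]; have := le_lt_trans h1 h2; rewrite ltxx.
have sumd : \sum_(i < N) (w i - t i) < d.
  by apply: (lt_le_trans sumd'); rewrite ge_min lexx.
have sume : (`|c - e|) * \sum_(i < N) (w i - t i) <= e.
  have ce : 0 < `|c - e| + 1 by rewrite ltr_wpDl.
  have h : \sum_(i < N) (w i - t i) <= e / (`|c - e| + 1).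
    by apply/ltW/(lt_le_trans sumd'); rewrite ge_min lexx orbT.
  apply: (@le_trans _ _ (`|c - e| * (e / (`|c - e| + 1)))); first by rewrite ler_wpM2l.
  by rewrite mulrCA ger_pMr// ler_pdivrMr// mul1r lerDl.
have sumy : \sum_(i < N) `|y (w i) - y (t i)| < e.
  apply: (dP N (fun i => t i) w) => // i.
  have /andP[h1 h2] := wt i.
  split; first by rewrite -t0; apply: tmono => //; exact: ltnW.
  split=> //; apply: (le_trans h2); rewrite -tN; exact: tmono.
have step (i : 'I_N) :
    (c - e) * (t i.+1 - t i) - `|c - e| * (w i - t i) - K * `|y (w i) - y (t i)|
    <= dotp p (y (t i.+1) - y (t i)).
  have [tl [Pi|Pi]] := tP i; last first.
    apply: le_trans Pi; have /andP[h _] := wt i.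
    have : 0 <= K * `|y (w i) - y (t i)| by rewrite mulr_ge0.
    have : 0 <= `|c - e| * (w i - t i) by rewrite mulr_ge0// subr_ge0.
    lra.
  have -> : w i = t i.+1 by rewrite /w; case: ifP => // /negP[]; exact/asboolP.
  have := norm_dotp_le p (y (t i.+1) - y (t i)); rewrite -/K ler_norml => /andP[h _].
  have : (c - e) * (t i.+1 - t i) <= `|c - e| * (t i.+1 - t i).
    by rewrite ler_wpM2r ?ler_norm// subr_ge0 ltW.
  lra.
have h : \sum_(i < N) ((c - e) * (t i.+1 - t i) - `|c - e| * (w i - t i)
      - K * `|y (w i) - y (t i)|) <= \sum_(i < N) dotp p (y (t i.+1) - y (t i)).
  by apply: ler_sum => i _; exact: step.
rewrite !sumrB -!mulr_sumr in h.
have tel : \sum_(i < N) (t i.+1 - t i) = v - u.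
  by rewrite -t0 -tN -(telescope_sumr (fun i => t i) (leq0n N)) big_mkord.
have tely : \sum_(i < N) dotp p (y (t i.+1) - y (t i)) = dotp p (y v - y u).
  under eq_bigr do rewrite dotpBr.
  rewrite -(big_mkord xpredT (fun i => dotp p (y (t i.+1)) - dotp p (y (t i)))).
  by rewrite (telescope_sumr (fun i => dotp p (y (t i)))) // t0 tN dotpBr.
rewrite tel tely in h.
have : K * \sum_(i < N) `|y (w i) - y (t i)| <= K * e by rewrite ler_wpM2l// ltW.
lra.
Qed.

End increments.

(** The supremum of the points up to which [P] holds throughout inherits [P] from its left and, if
    smaller than [b], could be passed. It is suited to bounds that propagate only as long as they
    hold. *)
Lemma real_induction (R : realType) (P : R -> Prop) (a b : R) :
  P a ->
  (forall s, a <= s -> s < b -> (forall r, a <= r <= s -> P r) ->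
    exists2 eta : R, 0 < eta & forall r, s < r -> r < s + eta -> r <= b -> P r) ->
  (forall s, a < s -> s <= b -> (forall r, a <= r -> r < s -> P r) -> P s) ->
  forall s, a <= s <= b -> P s.
Proof.
move=> Pa Pr Pl s0 /andP[as0 s0b].
pose E := [set s | a <= s <= b /\ forall r, a <= r <= s -> P r].
have Ea : E a.
  split; first by rewrite lexx (le_trans as0).
  by move=> r /andP[h1 h2]; rewrite (_ : r = a)//; apply/le_anti; rewrite h1 h2.
have supE : has_sup E by split; [exists a|exists b => t [/andP[]]].
have aE : a <= sup E by apply: sup_upper_bound.
have Eb : sup E <= b by apply: ge_sup; [exists a|move=> t [/andP[]]].
have Plt r : a <= r -> r < sup E -> P r.
  move=> ar rE; have e0 : 0 < sup E - r by rewrite subr_gt0.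
  have [t [_ tP] rt] := sup_adherent e0 supE.
  by apply: tP; rewrite ar ltW//; move: rt; rewrite opprB addrC subrK.
have PE : P (sup E).
  have [<-//|aE'] := eqVneq a (sup E).
  by apply: Pl => //; rewrite lt_def eq_sym aE' aE.
have Ple r : a <= r <= sup E -> P r.
  by move=> /andP[ar]; rewrite le_eqVlt => /orP[/eqP->//|]; exact: Plt.
have [Eb'|bE] := ltP (sup E) b; last first.
  by apply: Ple; rewrite as0 (le_trans s0b).
have [eta eta0 etaP] := Pr _ aE Eb' Ple.
pose t := Num.min b (sup E + eta / 2).
have Et : sup E < t by rewrite lt_min Eb' ltrDl divr_gt0.
have : E t.
  split; first by rewrite ge_min lexx andbT (le_trans aE)// ltW.
  move=> r /andP[ar rt]; have [rE|Er] := leP r (sup E).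
    by apply: Ple; rewrite ar rE.
  move: rt; rewrite le_min => /andP[rb rE].
  apply: etaP => //; lra.
by move=> /(sup_upper_bound supE)/(lt_le_trans Et); rewrite ltxx.
Qed.

(** * A priori estimates for Caratheodory solutions *)

Section dynamics.
Context {R : realType} {n m : nat}.
Variable f : 'I_m -> 'rV[R]_n -> 'rV[R]_n.
Implicit Types (x y z p : 'rV[R]_n) (a : 'rV[R]_m).

Definition lipschitz_bounded (B L M : R) : Prop :=
  (forall i x y, `|x| <= B -> `|y| <= B -> `|f i x - f i y| <= L * `|x - y|) /\
  (forall i x, `|x| <= B -> `|f i x| <= M).

Lemma dynamics_bound (B L M : R) a x : lipschitz_bounded B L M -> `|x| <= B ->
  `|dynamics f x a| <= (\sum_i `|a ord0 i|) * M.
Proof.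
move=> [_ fM] xB; rewrite (le_trans (ler_norm_sum _ _ _))// mulr_suml.
by apply: ler_sum => i _; rewrite normrZ ler_wpM2l// fM.
Qed.

Lemma dynamics_lip (B L M : R) a x y : lipschitz_bounded B L M ->
  `|x| <= B -> `|y| <= B ->
  `|dynamics f x a - dynamics f y a| <= (\sum_i `|a ord0 i|) * L * `|x - y|.
Proof.
move=> [fL _] xB yB; rewrite /dynamics -sumrB.
rewrite (le_trans (ler_norm_sum _ _ _))// -mulrA mulr_suml.
by apply: ler_sum => i _; rewrite -scalerBr normrZ ler_wpM2l// fL.
Qed.

Lemma control_set_sum a : control_set a -> \sum_i `|a ord0 i| = 1.
Proof.
have E i : \sum_j `|(delta_mx ord0 i : 'rV[R]_m) ord0 j| = 1.
  rewrite (bigD1 i)//= mxE !eqxx normr1 big1 ?addr0// => j ji.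
  by rewrite mxE (negbTE ji) andbF normr0.
move=> [i [->|->]]; first exact: E.
by rewrite -[RHS](E i); apply: eq_bigr => j _; rewrite mxE normrN.
Qed.

Lemma control_dynamics_bound (B L M : R) a x : lipschitz_bounded B L M ->
  control_set a -> `|x| <= B -> `|dynamics f x a| <= M.
Proof.
by move=> H /control_set_sum ca /(dynamics_bound a H); rewrite ca mul1r.
Qed.

Lemma control_dynamics_lip (B L M : R) a x y : lipschitz_bounded B L M ->
  control_set a -> `|x| <= B -> `|y| <= B ->
  `|dynamics f x a - dynamics f y a| <= L * `|x - y|.
Proof.
by move=> H /control_set_sum ca xB /(dynamics_lip a H xB); rewrite ca mul1r.
Qed.

Lemma absolutely_continuous_sub (a b a' b' : R) (y : R -> 'rV[R]_n) :
  a <= a' -> b' <= b ->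
  absolutely_continuous_on a b y -> absolutely_continuous_on a' b' y.
Proof.
move=> aa bb acy e /acy[d d0 dP]; exists d => // N u v uv.
apply: dP => i; have [h1 [h2 h3]] := uv i.
by rewrite (le_trans aa)// (le_trans h3).
Qed.

Lemma lip_absolutely_continuous (M a b : R) (y : R -> 'rV[R]_n) :
  (forall s t, a <= s -> s <= t -> t <= b -> `|y t - y s| <= M * (t - s)) ->
  absolutely_continuous_on a b y.
Proof.
move=> yM e e0.
have M0 : 0 < `|M| + 1 by rewrite ltr_wpDl.
exists (e / (`|M| + 1)); first by rewrite divr_gt0.
move=> N u v uv _ /= h.
apply: (@le_lt_trans _ _ ((`|M| + 1) * \sum_i (v i - u i))).
  rewrite mulr_sumr; apply: ler_sum => i _; have [h1 [h2 h3]] := uv i.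
  rewrite (le_trans (yM _ _ h1 h2 h3))// ler_wpM2r ?subr_ge0//.
  by rewrite (le_trans (ler_norm M))// lerDl.
by rewrite mulrC -ltr_pdivlMr.
Qed.

Section solution.
Variables (alpha : R -> 'rV[R]_m) (x : 'rV[R]_n) (S : \bar R) (y : R -> 'rV[R]_n).
Hypothesis soly : is_solution f alpha x S y.

Lemma solution_dotp_increment p (u v c : R) :
  0 <= u -> u <= v -> (v%:E < S)%E ->
  (forall s, u < s -> s < v -> c <= dotp p (dynamics f (y s) (alpha s))) ->
  c * (v - u) <= dotp p (y v - y u).
Proof.
move=> u0 uv vS cp; case: soly => S0 y0 acy aey.
apply: (ac_dotp_increment uv _ _ cp).
  by apply: absolutely_continuous_sub (acy v _ vS) => //; exact: le_trans uv.
apply: (@filterS _ _ (ae_filter_ringOfSetsType (@lebesgue_measure R)) _ _ _ aey).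
move=> s h us sv; apply: h; first exact: le_lt_trans us.
by apply: lt_trans vS; rewrite lte_fin.
Qed.

Lemma ereal_between (u : R) : (u%:E < S)%E -> exists2 b : R, u < b & (b%:E < S)%E.
Proof.
case: S => [s| |]//; last by exists (u + 1); rewrite ?ltrDl// ltry.
by rewrite lte_fin => us; exists ((u + s) / 2); rewrite ?lte_fin; lra.
Qed.

Lemma solution_continuous (s e : R) : 0 <= s -> (s%:E < S)%E -> 0 < e ->
  exists2 d : R, 0 < d & forall r, 0 <= r -> `|r - s| < d ->
    (r%:E < S)%E /\ `|y r - y s| < e.
Proof.
move=> s0 sS e0; have [b sb bS] := ereal_between sS.
have [_ _ acy _] := soly.
have [d d0 dP] := acy b (le_trans s0 (ltW sb)) bS e e0.
exists (Num.min d (b - s)); first by rewrite lt_min d0 subr_gt0.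
move=> r r0; rewrite lt_min => /andP[rd rb].
have rb' : r < b by move: rb; rewrite ltr_norml; lra.
split; first by apply: lt_trans bS; rewrite lte_fin.
have := dP 1%N (fun=> Num.min r s) (fun=> Num.max r s).
rewrite !big_ord1; case: (leP r s) => rs h.
  rewrite distrC; apply: h; first by move=> _; rewrite r0 rs (ltW sb).
    by move=> i j; rewrite (ord1 i) (ord1 j).
  by rewrite -(ger0_norm (x := s - r)) ?subr_ge0// distrC.
apply: h; first by move=> _; rewrite s0 !ltW.
  by move=> i j; rewrite (ord1 i) (ord1 j).
by rewrite -(gtr0_norm (x := r - s)) ?subr_gt0.
Qed.

Hypothesis ctl : forall s : R, 0 <= s -> (s%:E < S)%E -> control_set (alpha s).

Lemma solution_lip (B L M u v : R) : lipschitz_bounded B L M ->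
  0 <= u -> u <= v -> (v%:E < S)%E ->
  (forall s, u <= s <= v -> `|y s| <= B) ->
  `|y v - y u| <= M * (v - u).
Proof.
move=> LM u0 uv vS yB.
have cs s : u < s -> s < v -> control_set (alpha s) /\ `|y s| <= B.
  move=> us sv; split; last by apply: yB; rewrite !ltW.
  by apply: ctl; [lra|apply: lt_trans vS; rewrite lte_fin].
have bnd s i : u < s -> s < v -> `|dynamics f (y s) (alpha s) ord0 i| <= M.
  move=> us sv; have [c1 c2] := cs s us sv.
  by apply: le_trans (coord_norm_le _ _) _; exact: control_dynamics_bound LM c1 c2.
have M0 : 0 <= M * (v - u).
  move: uv; rewrite le_eqVlt => /orP[/eqP->|uv]; first by rewrite subrr mulr0.
  rewrite mulr_ge0//; last by rewrite subr_ge0 ltW.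
  have [c1 c2] := cs ((u + v) / 2) ltac:(lra) ltac:(lra).
  by rewrite (le_trans _ (control_dynamics_bound LM c1 c2)).
apply: norm_le_coord => // i; rewrite -!(dotp_deltal i) ler_norml; apply/andP; split.
  rewrite -mulNr; apply: solution_dotp_increment => // s us sv.
  by rewrite dotp_deltal; have := bnd s i us sv; rewrite ler_norml => /andP[].
rewrite -lerN2 -mulNr -dotpNl; apply: solution_dotp_increment => // s us sv.
by rewrite dotpNl dotp_deltal lerN2; have := bnd s i us sv; rewrite ler_norml => /andP[].
Qed.

(** Velocities are tested only at the initial point [y u]. The state moves by at most [M * (v - u)],
    which changes them by at most [L * M * (v - u)]; hence the quadratic loss. *)
Lemma solution_direction (B L M u v c : R) p : lipschitz_bounded B L M ->
  0 <= L -> 0 <= M -> 0 <= u -> u <= v -> (v%:E < S)%E ->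
  (forall s, u <= s <= v -> `|y s| <= B) ->
  (forall s, u < s -> s < v -> c <= dotp p (dynamics f (y u) (alpha s))) ->
  c * (v - u) - n%:R * `|p| * (L * M) * (v - u) ^+ 2 <= dotp p (y v - y u).
Proof.
move=> LM L0 M0 u0 uv vS yB cp.
have -> : c * (v - u) - n%:R * `|p| * (L * M) * (v - u) ^+ 2 =
  (c - n%:R * `|p| * (L * (M * (v - u)))) * (v - u) by ring.
apply: solution_dotp_increment => // s us sv.
have sS : (s%:E < S)%E by apply: lt_trans vS; rewrite lte_fin.
have cs : control_set (alpha s) by apply: ctl => //; lra.
have ysu : `|y s - y u| <= M * (v - u).
  apply: (@le_trans _ _ (M * (s - u))).
    apply: solution_lip LM _ _ _ _ => //; first exact: ltW.
    by move=> r /andP[h1 h2]; apply: yB; rewrite h1 (le_trans h2)// ltW.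
  by rewrite ler_wpM2l// lerD2r ltW.
have -> : dynamics f (y s) (alpha s) = dynamics f (y u) (alpha s) +
    (dynamics f (y s) (alpha s) - dynamics f (y u) (alpha s)).
  by rewrite addrC subrK.
rewrite dotpDr lerD ?cp//.
have := norm_dotp_le p (dynamics f (y s) (alpha s) - dynamics f (y u) (alpha s)).
rewrite ler_norml => /andP[+ _]; apply: le_trans; rewrite lerN2 ler_wpM2l ?mulr_ge0//.
apply: le_trans (control_dynamics_lip LM cs _ _) _.
- by apply: yB; rewrite !ltW.
- by apply: yB; rewrite lexx.
- by rewrite ler_wpM2l.
Qed.

(** Bootstrap: while the displacement is at most [M * s < 1], the curve stays in the ball of radius
    [B + 1], where [M] bounds the velocity and thereby the displacement. *)
Lemma solution_apriori (B L M t : R) : lipschitz_bounded (B + 1) L M ->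
  `|x| <= B -> 0 <= t -> (t%:E < S)%E -> M * t < 1 ->
  forall s, 0 <= s <= t -> `|y s| <= B + 1 /\ `|y s - x| <= M * s.
Proof.
move=> LM xB t0 tS Mt; have [S0 y0 _ _] := soly.
have M0 : 0 <= M.
  have c0 : control_set (alpha 0) by apply: ctl.
  by rewrite (le_trans _ (control_dynamics_bound LM c0 (x := x) _))// (le_trans xB)// lerDl.
have yB s : 0 <= s -> s <= t -> `|y s - x| <= M * s -> `|y s| < B + 1.
  move=> s0 st ys; rewrite -(subrK x (y s)) addrC.
  apply: le_lt_trans (ler_normD _ _) _; apply: ler_ltD => //.
  by apply: le_lt_trans ys (le_lt_trans _ Mt); rewrite ler_wpM2l.
suff H s : 0 <= s <= t -> `|y s - x| <= M * s.
  by move=> s /[dup] s0t /H ys; split => //; case/andP: s0t => ? ?; exact/ltW/yB.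
move: s; apply: real_induction.
- by rewrite y0 subrr normr0 mulr0.
- move=> s s0 st Ps.
  have sS : (s%:E < S)%E by apply: lt_trans tS; rewrite lte_fin.
  have Pss : `|y s - x| <= M * s by apply: Ps; rewrite s0 lexx.
  have yBs := yB s s0 (ltW st) Pss.
  have [d d0 dP] := solution_continuous s0 sS (e := B + 1 - `|y s|) ltac:(by rewrite subr_gt0).
  exists d => // r sr rd rt.
  have : `|y r - y s| <= M * (r - s).
    apply: solution_lip LM _ _ _ _ => //; first exact: ltW.
      by apply: le_lt_trans tS; rewrite lee_fin.
    move=> q /andP[sq qr]; have [|_ h] := dP q (le_trans s0 sq).
      by rewrite ger0_norm ?subr_ge0//; lra.
    rewrite -(subrK (y s) (y q)) (le_trans (ler_normD _ _))//.
    by move: h; rewrite -lerBrDr => /ltW.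
  move=> h; rewrite -(subrK (y s) (y r)) -addrA (le_trans (ler_normD _ _))//.
  lra.
- move=> s s0 st Ps.
  have sS : (s%:E < S)%E by apply: le_lt_trans tS; rewrite lee_fin.
  apply/ler_addgt0Pr => e e0.
  have [d d0 dP] := solution_continuous (ltW s0) sS e0.
  pose r := Num.max 0 (s - d / 2).
  have r0 : 0 <= r by rewrite le_max lexx.
  have rs : r < s by rewrite gt_max s0/=; lra.
  have [|_ h] := dP r r0.
    have : s - d / 2 <= r by rewrite le_max lexx orbT.
    by rewrite ltr0_norm; lra.
  rewrite -(subrK (y r) (y s)) -addrA (le_trans (ler_normD _ _))//.
  rewrite [leLHS]addrC lerD//; last by rewrite distrC ltW.
  by apply: le_trans (Ps r r0 rs) _; rewrite ler_wpM2l// ltW.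
Qed.

End solution.
End dynamics.

(** * Lipschitz bounds for the vector fields *)

Section mean_value.
Context {R : realType}.

(** Real induction with the slope [C + e'], whose excess absorbs the error in the epsilon form of
    the derivative. *)
Lemma mean_value_bound (W : normedModType R) (y : R -> W) (dy : R -> W)
    (a b C : R) : a <= b ->
  (forall s, a <= s <= b -> is_derive s (1 : R) y (dy s)) ->
  (forall s, a <= s <= b -> `|dy s| <= C) ->
  `|y b - y a| <= C * (b - a).
Proof.
move=> ab dyP dyC; apply/ler_addgt0Pr => e e0.
have w0 : 0 < b - a + 1 by lra.
pose e' := e / (b - a + 1).
have e'0 : 0 < e' by rewrite divr_gt0.
suff H : forall s, a <= s <= b -> `|y s - y a| <= (C + e') * (s - a).
  apply: (le_trans (H b _)); first by rewrite ab lexx.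
  by have : e' * (b - a + 1) = e; [rewrite divfK// gt_eqF|lra].
have loc s : a <= s <= b -> exists2 d : R, 0 < d &
    forall r, `|r - s| < d -> `|y r - y s| <= (C + e') * `|r - s|.
  move=> sab; have /is_derive_epsP/(_ _ e'0)[d d0 dP] := dyP _ sab.
  exists d => // r /dP; rewrite [s + _]addrC subrK => h.
  rewrite -(subrK ((r - s) *: dy s) (y r - y s)) (le_trans (ler_normD _ _))//.
  rewrite mulrDl [leRHS]addrC; apply: lerD => //.
  by rewrite normrZ mulrC ler_wpM2r// dyC.
apply: real_induction.
- by rewrite !subrr normr0 mulr0.
- move=> s s0 sb /(_ s); rewrite s0 lexx => /(_ isT) Ps.
  have [|d d0 dP] := loc s; first by rewrite s0 ltW.
  exists d => // r sr rd rb; rewrite -(subrK (y s) (y r)) -addrA.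
  rewrite (le_trans (ler_normD _ _))//.
  have := dP r; rewrite gtr0_norm ?subr_gt0// => h.
  have := h ltac:(lra); lra.
- move=> s s0 sb Ps.
  have [|d d0 dP] := loc s; first by rewrite sb ltW.
  pose r := Num.max a (s - d / 2).
  have ar : a <= r by rewrite le_max lexx.
  have rs : r < s by rewrite gt_max s0/=; lra.
  have rd : s - d / 2 <= r by rewrite le_max lexx orbT.
  have := Ps r ar rs.
  have := dP r; rewrite ltr0_norm ?subr_lt0// => h.
  have {h} := h ltac:(lra); rewrite [X in X <= _ -> _]distrC => h1 h2.
  rewrite -(subrK (y r) (y s)) -addrA (le_trans (ler_normD _ _))//; lra.
Qed.

Lemma is_derive_line (V W : normedModType R) (g : V -> W) (x v : V) (s : R) :
  derivable g (x + s *: v) v ->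
  is_derive s (1 : R) (fun t : R => g (x + t *: v)) ('D_v g (x + s *: v)).
Proof.
have E : (fun h : R => h^-1 *: (((fun t : R => g (x + t *: v)) \o shift s) (h *: (1:R))
      - g (x + s *: v))) =
    (fun h : R => h^-1 *: ((g \o shift (x + s *: v)) (h *: v) - g (x + s *: v))).
  apply/funext => h /=; congr (_ *: (g _ - _)).
  by rewrite [h *: 1]mulr1 scalerDl addrCA.
by move=> dg; split; rewrite /derivable /derive E.
Qed.

End mean_value.

Section regularity.
Context {R : realType} {n m : nat}.
Variable f : 'I_m -> 'rV[R]_n -> 'rV[R]_n.

(** For [k = 0] the Lipschitz bound is part of the class; otherwise it follows from the bounded
    first partial derivatives along segments, which stay in the ball by convexity. *)
Lemma of_class_Ck1b_lipschitz k (g : 'rV[R]_n -> 'rV[R]_n) (r : R) :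
  0 < r -> of_class_Ck1b k (ball (0 : 'rV[R]_n) r) g ->
  exists L M : R, [/\ 0 <= L, 0 <= M,
    forall x y, `|x| < r -> `|y| < r -> `|g x - g y| <= L * `|x - y| &
    forall x, `|x| < r -> `|g x| <= M].
Proof.
move=> r0 [Cg bg lg].
have ballP (x : 'rV[R]_n) : `|x| < r -> ball (0 : 'rV[R]_n) r x.
  by move=> xr; rewrite -ball_normE /ball_/= sub0r normrN.
have [M M0 gM] := pinfty_ex_gt0 (bg [::] (leq0n _)).
case: k Cg bg lg => [|k] Cg bg lg.
  have [L L0 gL] := pinfty_ex_gt0 (lg [::] erefl).
  exists L, M; split => [| |x y xr yr|x xr]; [exact: ltW|exact: ltW| |].
    exact: (gL (x, y) (conj (ballP _ xr) (ballP _ yr))).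
  by apply: gM; exact: ballP.
case: Cg => dg _.
have pb i : exists C : R, 0 <= C /\ forall x, `|x| < r -> `|partial i g x| <= C.
  have [C C0 gC] := pinfty_ex_gt0 (bg [:: i] (ltn0Sn _)).
  by exists C; split; [exact: ltW|move=> x xr; apply: gC; exact: ballP].
have [C CP] := choice pb.
exists (\sum_i C i), M; split => [| |x y xr yr|x xr].
- by apply: sumr_ge0 => i _; have [] := CP i.
- exact: ltW.
- pose v := x - y.
  have seg t : 0 <= t <= 1 -> `|y + t *: v| < r.
    move=> /andP[t0 t1]; rewrite /v scalerBr addrCA.
    have -> : t *: x + (y - t *: y) = t *: x + (1 - t) *: y.
      by rewrite scalerBl scale1r.
    rewrite (le_lt_trans (ler_normD _ _))// !normrZ !ger0_norm ?subr_ge0//.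
    have [->|tn0] := eqVneq t 0; first by rewrite mul0r add0r subr0 mul1r.
    have tp : 0 < t by rewrite lt_def tn0.
    have h1 : t * `|x| < t * r by rewrite ltr_pM2l.
    have h2 : (1 - t) * `|y| <= (1 - t) * r by rewrite ler_wpM2l ?subr_ge0// ltW.
    lra.
  have dgs t : 0 <= t <= 1 -> differentiable g (y + t *: v).
    by move=> /seg/ballP; exact: dg.
  have := @mean_value_bound R _ (fun t : R => g (y + t *: v))
    (fun t => 'D_v g (y + t *: v)) 0 1 ((\sum_i C i) * `|v|) ler01.
  rewrite scale1r scale0r addr0 subr0 mulr1.
  rewrite (_ : y + v = x); last by rewrite /v addrC subrK.
  apply.
  + move=> s s01; apply: is_derive_line; apply: diff_derivable; exact: dgs.
  + move=> s s01; rewrite (deriveE _ (dgs s s01)).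
    have := dgs s s01; have := seg _ s01; set z := y + s *: v => zr dgz.
    have -> : 'd g z v = \sum_i v ord0 i *: 'd g z (delta_mx ord0 i).
      rewrite {1}(row_sum_delta v) linear_sum; apply: eq_bigr => i _.
      by rewrite linearZ.
    rewrite mulr_suml (le_trans (ler_norm_sum _ _ _))//; apply: ler_sum => i _.
    rewrite normrZ mulrC; apply: ler_pM => //; last exact: coord_norm_le.
    by have := (CP i).2 _ zr; rewrite /partial deriveE.
- exact: (gM x (ballP _ xr)).
Qed.

Lemma regular_lipschitz_bounded k :
  (forall Omega : set 'rV[R]_n, open Omega -> bounded_set Omega ->
     Omega !=set0 -> forall i, of_class_Ck1b k Omega (f i)) ->
  forall B : R, exists L M, [/\ 0 <= L, 0 <= M & lipschitz_bounded f B L M].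
Proof.
move=> reg B; pose r := `|B| + 1.
have r0 : 0 < r by rewrite ltr_wpDl.
have Br : B < r by rewrite (le_lt_trans (ler_norm B))// ltrDl.
have fi i : exists LM : R * R, [/\ 0 <= LM.1, 0 <= LM.2,
    forall x y, `|x| < r -> `|y| < r -> `|f i x - f i y| <= LM.1 * `|x - y| &
    forall x, `|x| < r -> `|f i x| <= LM.2].
  have [|L [M H]] := @of_class_Ck1b_lipschitz k (f i) r r0; last by exists (L, M).
  apply: reg; first exact: ball_open.
    exists r; split; first exact: num_real.
    move=> K rK x; rewrite -ball_normE /ball_/= sub0r normrN => xr.
    exact: ltW (lt_trans xr rK).
  by exists 0; exact: ballxx.
have [LM LMP] := choice fi.
exists (\sum_i (LM i).1), (\sum_i (LM i).2); split.
- by apply: sumr_ge0 => i _; have [] := LMP i.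
- by apply: sumr_ge0 => i _; have [] := LMP i.
- split=> [i x y xB yB|i x xB]; have [h1 h2 h3 h4] := LMP i.
    apply: (le_trans (h3 _ _ (le_lt_trans xB Br) (le_lt_trans yB Br))).
    rewrite ler_wpM2r// (bigD1 i)//= lerDl sumr_ge0// => j _.
    by have [] := LMP j.
  apply: (le_trans (h4 _ (le_lt_trans xB Br))).
  by rewrite (bigD1 i)//= lerDl sumr_ge0// => j _; have [] := LMP j.
Qed.

Lemma lipschitz_bounded_continuous :
  (forall B : R, exists L M, [/\ 0 <= L, 0 <= M & lipschitz_bounded f B L M]) ->
  forall i, continuous (f i).
Proof.
move=> H i x; have [L [M [L0 M0 [fL _]]]] := H (`|x| + 1).
apply/(@cvgrPdist_le _ _ _ _ (nbhs_filter x)) => e e0.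
have d0 : 0 < Num.min 1 (e / (L + 1)) by rewrite lt_min ltr01 divr_gt0// ltr_wpDl.
apply/nbhs_ballP; exists (Num.min 1 (e / (L + 1))) => //= y.
rewrite -ball_normE /ball_/=.
rewrite lt_min => /andP[h1 h2].
apply: (le_trans (fL _ _ _ _ _)); first by rewrite lerDl.
  rewrite -(subrK x y) (le_trans (ler_normD _ _))// addrC lerD2l distrC.
  exact: ltW.
apply: (@le_trans _ _ (L * (e / (L + 1)))); first by rewrite ler_wpM2l// ltW.
by rewrite mulrCA ger_pMr// ler_pdivrMr ?ltr_wpDl// mul1r lerDl.
Qed.

End regularity.

(** * Distance to the target *)

Section distance.
Context {R : realType} {n : nat}.
Variable T : set 'rV[R]_n.
Implicit Types x y w : 'rV[R]_n.

(** For empty [T] the distance is [+oo] and [fine] returns the default 0; hence the hypothesis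
    [T0]. *)
Definition rdist x : R := fine (dist T x).

Hypothesis T0 : T !=set0.

Lemma enorm_ge0 x : 0 <= enorm x. Proof. exact: sqrtr_ge0. Qed.

Lemma distE x : dist T x = (rdist x)%:E.
Proof.
rewrite /rdist fineK// fin_numE; apply/andP; split.
- rewrite gt_eqF// (lt_le_trans (ltNyr 0))// le_ereal_inf_tmp//.
  by move=> _ [y _ <-]; rewrite lee_fin enorm_ge0.
- have [y Ty] := T0; rewrite lt_eqF//.
  by apply: (@le_lt_trans _ _ (enorm (x - y))%:E); [apply: ereal_inf_lbound; exists y|exact: ltry].
Qed.

Lemma rdist_le_enorm x w : T w -> rdist x <= enorm (x - w).
Proof. by move=> Tw; rewrite -lee_fin -distE; apply: ereal_inf_lbound; exists w. Qed.

Lemma le_rdist x (c : R) : (forall w, T w -> c <= enorm (x - w)) -> c <= rdist x.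
Proof.
move=> H; rewrite -lee_fin -distE; apply: le_ereal_inf_tmp => _ [w Tw <-].
by rewrite lee_fin H.
Qed.

Lemma rdist_ge0 x : 0 <= rdist x.
Proof. by apply: le_rdist => w _; exact: enorm_ge0. Qed.

Lemma rdist_near x (e : R) : 0 < e -> exists2 w, T w & enorm (x - w) < rdist x + e.
Proof.
move=> e0; apply: contrapT => H.
suff : rdist x + e <= rdist x by rewrite gerDl leNgt e0.
apply: le_rdist => w Tw; rewrite leNgt; apply/negP => h; apply: H; by exists w.
Qed.

Lemma rdist_lip x y : rdist x <= rdist y + n%:R * `|x - y|.
Proof.
rewrite -lerBlDr; apply: le_rdist => w Tw; rewrite lerBlDr.
apply: (le_trans (rdist_le_enorm x Tw)).
rewrite (_ : x - w = (y - w) + (x - y)); last by rewrite [RHS]addrC addrA subrK.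
by rewrite (le_trans (enormD _ _))// lerD2l enorm_le.
Qed.

Lemma rdist_in x : T x -> rdist x = 0.
Proof.
move=> Tx; apply/le_anti; rewrite rdist_ge0 andbT.
apply: (le_trans (rdist_le_enorm x Tx)).
by rewrite subrr (le_trans (enorm_le _))// normr0 mulr0.
Qed.

Lemma open_normP (A : set 'rV[R]_n) x : open A -> A x ->
  exists2 d : R, 0 < d & forall y, `|y - x| < d -> A y.
Proof.
move=> oA Ax; have /nbhs_ballP[d /= d0 dP] := oA _ Ax.
exists d => // y yx; apply: dP; by rewrite -ball_normE /ball_/= distrC.
Qed.

Lemma rdist_gt0 x : closed T -> ~ T x -> 0 < rdist x.
Proof.
move=> cT nTx; have oT := closed_openC cT.
have [d d0 dP] := open_normP oT nTx.
apply: (lt_le_trans d0); apply: le_rdist => w Tw.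
rewrite leNgt; apply/negP => h; apply: (dP w) => //.
by rewrite distrC (le_lt_trans (norm_le_enorm _))//.
Qed.

(** Compactness is known for the boundary of [T] only, so a point of [T] is traded for the first
    boundary point met on the segment from [x] to it. *)
Lemma boundary_crossing x w : closed T -> ~ T x -> T w ->
  exists2 b, boundary T b & `|x - b| <= `|x - w|.
Proof.
move=> cT nTx Tw; apply: contrapT => H.
have oT := closed_openC cT.
pose z t := x + t *: (w - x).
suff : ~ T (z 1) by apply; rewrite /z scale1r addrC subrK.
have zl s t : `|z s - z t| = `|s - t| * `|w - x|.
  by rewrite /z opprD addrACA subrr add0r -scalerBl normrZ.
have cont s e : 0 < e -> exists2 d : R, 0 < d & forall r, `|r - s| < d -> `|z r - z s| < e.
  move=> e0; have D0 : 0 < `|w - x| + 1 by rewrite ltr_wpDl.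
  exists (e / (`|w - x| + 1)); first by rewrite divr_gt0.
  move=> r; rewrite zl ltr_pdivlMr// => h; apply: le_lt_trans h.
  by rewrite ler_wpM2l// lerDl.
have : forall s, 0 <= s <= (1 : R) -> ~ T (z s).
  apply: real_induction.
  - by rewrite /z scale0r addr0.
  - move=> s s0 s1 /(_ s); rewrite s0 lexx => /(_ isT) nTs.
    have [e e0 eP] := open_normP oT nTs.
    have [d d0 dP] := cont s e e0.
    exists d => // r sr rd _; apply/eP/dP; rewrite gtr0_norm ?subr_gt0//; lra.
  - move=> s s0 s1 Ps Ts; apply: H; exists (z s); last first.
      have -> : x = z 0 by rewrite /z scale0r addr0.
      rewrite zl (_ : z 0 = x) ?[`|x - w|]distrC; last by rewrite /z scale0r addr0.
      by rewrite sub0r normrN ler_piMl// ger0_norm// ltW.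
    split; first exact: subset_closure.
    move=> /(@open_normP _ _ (@open_interior _ T))[e e0 eP].
    have [d d0 dP] := cont s e e0.
    pose r := Num.max 0 (s - d / 2).
    have r0 : 0 <= r by rewrite le_max lexx.
    have rs : r < s by rewrite gt_max s0/=; lra.
    have rd : s - d / 2 <= r by rewrite le_max lexx orbT.
    apply: (Ps r r0 rs); apply: interior_subset; apply/eP/dP.
    by rewrite ltr0_norm ?subr_lt0//; lra.
by apply; rewrite ler01 lexx.
Qed.

(** Stated off [T], which may itself be unbounded. *)
Lemma rdist_bounded : closed T -> compact (boundary T) ->
  forall rho : R, exists2 B : R, 0 <= B & forall x, ~ T x -> rdist x <= rho -> `|x| <= B.
Proof.
move=> cT /compact_bounded bT rho.
have [M M0 MP] := pinfty_ex_gt0 bT.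
exists (M + `|rho| + 1); first by rewrite !addr_ge0// ltW.
move=> x nTx xrho; have [w Tw xw] := rdist_near x ltr01.
have [b bb xb] := boundary_crossing cT nTx Tw.
rewrite -(subrK b x) (le_trans (ler_normD _ _))//.
have h1 : `|b| <= M := MP b bb.
have h2 := norm_le_enorm (x - w); have h3 := ler_norm rho.
lra.
Qed.

End distance.

(** * Existence of solutions and of sampling processes *)

Section picard.
Context {R : realType} {n : nat}.

Lemma half_pow_small (C e : R) : 0 < e -> exists N, forall k, (N <= k)%N -> C / 2 ^+ k < e.
Proof.
move=> e0; exists (Num.bound (`|C| / e)) => k Nk.
rewrite ltr_pdivrMr ?exprn_gt0//.
apply: (le_lt_trans (ler_norm C)); rewrite mulrC -ltr_pdivrMr//.
apply: (lt_le_trans (archi_boundP _)); first by rewrite divr_ge0// ltW.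
rewrite (@le_trans _ _ k%:R) ?ler_nat// -natrX ler_nat.
exact: ltnW (ltn_expl k (ltnSn 1)).
Qed.

Lemma cauchy_rate_limit (u : nat -> 'rV[R]_n) (c : nat -> R) :
  (forall k p, `|u (k + p)%N - u k| <= c k) ->
  (forall e : R, 0 < e -> exists N, forall k, (N <= k)%N -> c k < e) ->
  exists l, forall k, `|l - u k| <= c k.
Proof.
move=> uc c0.
have : cauchy (u @ \oo).
  apply: cauchy_exP => e e0; have [N NP] := c0 _ e0.
  exists (u N), N => // k /= Nk.
  rewrite -ball_normE /ball_/= distrC -(subnKC Nk).
  exact: le_lt_trans (uc _ _) (NP _ (leqnn _)).
move=> /cauchy_cvg/cvg_ex[/= l ul]; exists l => k.
apply/ler_addgt0Pr => e e0.
have /cvgrPdist_lt/(_ _ e0)[N _ NP] := ul.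
have := NP (k + N)%N; rewrite /= leq_addl => /(_ isT) h.
rewrite -(subrK (u (k + N)%N) l) -addrA (le_trans (ler_normD _ _))//.
by rewrite [leRHS]addrC lerD ?uc// ltW.
Qed.

(** Working on the interval from -1 to 2 makes the derivative two-sided at both ends of [0, 1]. *)
Lemma antiderivative (g : R -> 'rV[R]_n) : continuous g ->
  exists G : R -> 'rV[R]_n, forall s : R, -1 < s < 2 -> is_derive s (1 : R) G (g s).
Proof.
move=> cg.
have cgi i : continuous (fun s => g s ord0 i).
  move=> s; apply: (@continuous_comp _ _ _ g (fun M : 'rV[R]_n => M ord0 i)); first exact: cg.
  exact: coord_continuous.
pose G s : 'rV[R]_n :=
  \row_i (\int[lebesgue_measure]_(t in `[-1, s]) g t ord0 i)%R.
exists G => s /andP[s1 s2].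
have Gi i : derivable (fun s => G s ord0 i) s 1 /\ derive1 (fun s => G s ord0 i) s = g s ord0 i.
  rewrite (_ : (fun s => G s ord0 i) =
    fun s => (\int[lebesgue_measure]_(t in `[-1, s]) g t ord0 i)%R); last first.
    by apply/funext => r; rewrite mxE.
  apply: (@continuous_FTC1_closed R (fun t => g t ord0 i) (-1) s 2) => //; last exact: cgi.
  apply: continuous_compact_integrable; first exact: segment_compact.
  by apply: continuous_subspaceT; exact: cgi.
have dG : derivable G s 1.
  by apply/derivable_mxP => i j; rewrite (ord1 i); exact: (Gi j).1.
split => //; rewrite derive_mx//; apply/rowP => i; rewrite mxE.
by rewrite -(Gi i).2 derive1E.
Qed.

(** Truncation extends data from an interval to the line without increasing Lipschitz constants. *)
Definition clip (a b s : R) : R := Num.max a (Num.min b s).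

Lemma clip_lip (a b s t : R) : `|clip a b s - clip a b t| <= `|s - t|.
Proof.
have mx (c u v : R) : `|Num.max c u - Num.max c v| <= `|u - v|.
  have := ler_norm (u - v); have := ler_norm (v - u); rewrite distrC ler_norml.
  by case: (leP c u) => h1; case: (leP c v) => h2 h3 h4; apply/andP; split; lra.
have mn (c u v : R) : `|Num.min c u - Num.min c v| <= `|u - v|.
  have := ler_norm (u - v); have := ler_norm (v - u); rewrite distrC ler_norml.
  by case: (leP c u) => h1; case: (leP c v) => h2 h3 h4; apply/andP; split; lra.
exact: le_trans (mx _ _ _) (mn _ _ _).
Qed.

Lemma clip_itv (a b s : R) : a <= b -> a <= clip a b s <= b.
Proof. by move=> ab; rewrite /clip le_max lexx/= ge_max ab ge_min lexx. Qed.

Lemma clip_id (a b s : R) : a <= s <= b -> clip a b s = s.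
Proof. by move=> /andP[h1 h2]; rewrite /clip (min_idPr h2) (max_idPr h1). Qed.

Lemma continuous_epsP (V W : normedModType R) (g : V -> W) :
  (forall s e, 0 < e -> exists2 d : R, 0 < d & forall t, `|t - s| < d -> `|g t - g s| < e) ->
  continuous g.
Proof.
move=> H s; apply/(@cvgrPdist_lt _ _ _ _ (nbhs_filter s)) => e e0.
have [d d0 dP] := H s e e0.
apply/nbhs_ballP; exists d => //= t; rewrite -ball_normE /ball_/= => st.
by rewrite distrC; apply: dP; rewrite distrC.
Qed.

Lemma is_derive_continuous_at (W : normedModType R) (y : R -> W) (s : R) (D : W) :
  is_derive s (1 : R) y D ->
  forall e, 0 < e -> exists2 d : R, 0 < d & forall t, `|t - s| < d -> `|y t - y s| < e.
Proof.
move=> [dy _] e e0.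
have : {for s, continuous y} by apply/differentiable_continuous/derivable1_diffP.
move=> /(@cvgrPdist_lt _ _ _ _ (nbhs_filter s))/(_ _ e0)/nbhs_ballP[d /= d0 dP].
exists d => // t ts; rewrite distrC; apply: dP.
by rewrite -ball_normE /ball_/= distrC.
Qed.

Lemma is_derive_scalel (W : normedModType R) (w : W) (s : R) :
  is_derive s (1 : R) (fun t : R => t *: w) w.
Proof.
apply/is_derive_epsP => e e0; exists 1 => // h _.
by rewrite scalerDl [s *: w + _]addrC addrK subrr normr0 mulr_ge0// ltW.
Qed.

Lemma picard_global (F : 'rV[R]_n -> 'rV[R]_n) (x : 'rV[R]_n) (L M : R) :
  (forall y z, `|F y - F z| <= L * `|y - z|) -> (forall y, `|F y| <= M) ->
  exists2 eps : R, 0 < eps & exists2 y : R -> 'rV[R]_n, y 0 = x &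
    (forall s, 0 < s < eps -> is_derive s (1 : R) y (F (y s))) /\
    (forall s t, 0 <= s -> s <= t -> t <= eps -> `|y t - y s| <= M * (t - s)).
Proof.
move=> FL FM.
have M0 : 0 <= M by rewrite (le_trans _ (FM 0)).
pose L' := `|L| + 1.
have L'0 : 0 < L' by rewrite ltr_wpDl.
have {}FL y z : `|F y - F z| <= L' * `|y - z|.
  by rewrite (le_trans (FL _ _))// ler_wpM2r// (le_trans (ler_norm L))// lerDl.
(* The invariant of the iterates: differentiable slightly beyond [0, 1], with speed at most [M]. *)
pose good (y : R -> 'rV[R]_n) := y 0 = x /\ exists2 y0 : R -> 'rV[R]_n,
  forall s : R, -1 < s < 2 -> is_derive s (1 : R) y (y0 s) & forall s, `|y0 s| <= M.
have goodcont y : good y -> continuous (fun s => F (y (clip 0 1 s))).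
  move=> [_ [y0 dy _]]; apply: continuous_epsP => s e e0.
  have e'0 : 0 < e / L' by rewrite divr_gt0.
  have /andP[c1 c2] := clip_itv s (@ler01 R).
  have := dy (clip 0 1 s) ltac:(lra).
  move=> /is_derive_continuous_at/(_ _ e'0)[d d0 dP].
  exists d => // t ts; apply: (le_lt_trans (FL _ _)).
  rewrite mulrC -ltr_pdivlMr//; apply: dP; exact: le_lt_trans (clip_lip _ _ _ _) ts.
have next y : exists y', good y -> good y' /\
    forall s : R, -1 < s < 2 -> is_derive s (1 : R) y' (F (y (clip 0 1 s))).
  have [/goodcont cy|] := pselect (good y); last by exists y.
  have [G dG] := antiderivative cy.
  exists (fun s => G s + (x - G 0)) => _.
  have dG' (s : R) : -1 < s < 2 ->
      is_derive s (1 : R) (fun s => G s + (x - G 0)) (F (y (clip 0 1 s))).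
    move=> /dG dGs; rewrite -[F _]addr0.
    exact: (@is_deriveD _ _ _ G (cst (x - G 0))).
  split => //; split; first by rewrite addrC subrK.
  by exists (fun s => F (y (clip 0 1 s))).
have [nx nxP] := choice next.
pose y_ k := iter k nx (cst x).
have goody k : good (y_ k).
  elim: k => [|k IH]; last by have [] := nxP _ IH.
  split=> //; exists (cst 0) => s; last by rewrite normr0.
  by move=> _; exact: is_derive_cst.
have dy k (s : R) : 0 <= s <= 1 -> is_derive s (1 : R) (y_ k.+1) (F (y_ k s)).
  move=> s01; have [_ /(_ s)] := nxP _ (goody k); rewrite clip_id//; apply.
  lra.
have ylip k (s t : R) : 0 <= s -> s <= t -> t <= 1 -> `|y_ k t - y_ k s| <= M * (t - s).
  move=> s0 st t1; have [_ [y0 dy0 y0M]] := goody k.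
  apply: (@mean_value_bound _ _ _ y0) => // r /andP[sr rt]; apply: dy0; lra.
have y0x k : y_ k 0 = x by have [] := goody k.
(* Then [L' * eps] is at most 1 / 2, and each iteration halves the bound on the difference of
   consecutive iterates. *)
pose eps := Num.min 1 (1 / (2 * L')).
have eps0 : 0 < eps by rewrite lt_min ltr01 divr_gt0// mulr_gt0.
have eps1 : eps <= 1 by rewrite ge_min lexx.
have epsL : L' * eps <= 2^-1.
  have : eps <= 1 / (2 * L') by rewrite ge_min lexx orbT.
  rewrite -(ler_pM2l L'0) => /le_trans; apply.
  by rewrite div1r invfM mulrCA divff ?gt_eqF// mulr1.
have step k (s : R) : 0 <= s <= eps -> `|y_ k.+1 s - y_ k s| <= M / 2 ^+ k.
  elim: k s => [|k IH] s /andP[s0 se].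
    rewrite expr0 divr1 [y_ 0%N s]/= -(y0x 1%N).
    apply: (le_trans (ylip 1%N 0 s _ _ _)) => //; first exact: le_trans eps1.
    by rewrite subr0 ler_piMr// (le_trans se).
  have -> : y_ k.+2 s - y_ k.+1 s = (y_ k.+2 s - y_ k.+1 s) - (y_ k.+2 0 - y_ k.+1 0).
    by rewrite !y0x subrr subr0.
  apply: (le_trans (@mean_value_bound _ _ (fun s => y_ k.+2 s - y_ k.+1 s)
     (fun s => F (y_ k.+1 s) - F (y_ k s)) 0 s (L' * (M / 2 ^+ k)) s0 _ _)).
  - move=> r /andP[r0 rs].
    have d1 := dy k.+1 r ltac:(lra). have d2 := dy k r ltac:(lra).
    exact: is_deriveB.
  - move=> r /andP[r0 rs]; apply: (le_trans (FL _ _)).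
    by rewrite ler_pM2l// IH// r0 (le_trans rs).
  - rewrite subr0 mulrAC.
    have Mk : 0 <= M / 2 ^+ k by rewrite divr_ge0// exprn_ge0.
    have h : L' * s <= 2^-1 by rewrite (le_trans _ epsL)// ler_wpM2l// ltW.
    apply: (@le_trans _ _ (2^-1 * (M / 2 ^+ k))); first by rewrite ler_wpM2r.
    by rewrite exprS invfM mulrCA.
(* The geometric tail: the sum of [M / 2 ^+ j] over j >= k. *)
pose c k := 2 * M / 2 ^+ k.
have cS k : c k = M / 2 ^+ k + c k.+1.
  by rewrite /c exprS invfM; field; rewrite expf_neq0// pnatr_eq0.
have c_ge0 k : 0 <= c k by rewrite /c divr_ge0 ?exprn_ge0// mulr_ge0.
have cauchyy (s : R) : 0 <= s <= eps -> forall k p, `|y_ (k + p)%N s - y_ k s| <= c k.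
  move=> sP k p; elim: p k => [|p IH] k; first by rewrite addn0 subrr normr0.
  rewrite addnS -addSn -(subrK (y_ k.+1 s) (y_ _ s)) -addrA.
  rewrite (le_trans (ler_normD _ _))// cS [leRHS]addrC.
  by apply: lerD; [exact: IH|exact: step].
have c0 (e : R) : 0 < e -> exists N, forall k, (N <= k)%N -> c k < e.
  exact: half_pow_small.
have lim_ (s : R) : exists l : 'rV[R]_n, 0 <= s <= eps -> forall k, `|l - y_ k s| <= c k.
  have [/cauchyy H|] := pselect (0 <= s <= eps); last by exists 0.
  by have [l lP] := cauchy_rate_limit H c0; exists l.
have [y yP] := choice lim_.
have approx (a b : R) : (exists C, forall k, a <= b + C * c k) -> a <= b.
  move=> [C H]; apply/ler_addgt0Pr => e e0.
  have C0 : 0 < `|C| + 1 by rewrite ltr_wpDl.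
  have [N /(_ _ (leqnn N)) NP] := c0 (e / (`|C| + 1)) ltac:(by rewrite divr_gt0).
  apply: (le_trans (H N)); rewrite lerD2l.
  rewrite (le_trans (y := (`|C| + 1) * c N))//.
    by rewrite ler_wpM2r// (le_trans (ler_norm C))// lerDl.
  by rewrite mulrC -ler_pdivlMr// ltW.
have ylipl (s t : R) : 0 <= s -> s <= t -> t <= eps -> `|y t - y s| <= M * (t - s).
  move=> s0 st te; apply: approx; exists 2 => k.
  have h1 := yP s ltac:(clear -s0 st te; lra) k.
  have h2 := yP t ltac:(clear -s0 st te; lra) k.
  have h3 := ylip k s t s0 st (le_trans te eps1).
  rewrite (_ : y t - y s = (y_ k t - y_ k s) + (y t - y_ k t) - (y s - y_ k s)); last first.
    by apply/rowP => i; rewrite !mxE; ring.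
  rewrite (le_trans (ler_normB _ _))//.
  by have := ler_normD (y_ k t - y_ k s) (y t - y_ k t); lra.
exists eps => //; exists y.
  apply/eqP; rewrite -subr_eq0 -normr_eq0 eq_le normr_ge0 andbT.
  apply: approx; exists 1 => k; rewrite mul1r add0r -(y0x k).
  by apply: yP; rewrite lexx ltW.
split=> // s /andP[s0 se].
(* A second-order estimate on increments holds for the iterates up to a multiple of [c k], so it
   survives the limit; the derivative is read off from it. *)
have key (a b : R) : 0 <= a -> a <= b -> b <= eps -> a <= s <= b ->
    `|y b - y a - (b - a) *: F (y s)| <= L' * M * (b - a) ^+ 2.
  move=> a0 ab be /andP[as_ sb].
  apply: approx; exists (L' * (b - a) + 2) => k.
  have h1 := yP a ltac:(clear -a0 ab be; lra) k.+1.
  have h2 := yP b ltac:(clear -a0 ab be; lra) k.+1.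
  have h3 := yP s ltac:(clear -s0 se; lra) k.
  have ck : c k.+1 <= c k by rewrite [leRHS]cS lerDr divr_ge0// exprn_ge0.
  have := @mean_value_bound _ _ (fun t => y_ k.+1 t - t *: F (y s))
     (fun t => F (y_ k t) - F (y s)) a b (L' * (M * (b - a) + c k)) ab.
  move=> /(_ _ _)/=; rewrite (_ : y_ k.+1 b - b *: F (y s) - (y_ k.+1 a - a *: F (y s)) =
    y_ k.+1 b - y_ k.+1 a - (b - a) *: F (y s)); last first.
    by apply/rowP => i; rewrite !mxE; ring.
  move=> mv.
  rewrite (_ : y b - y a - (b - a) *: F (y s) =
    (y_ k.+1 b - y_ k.+1 a - (b - a) *: F (y s)) + (y b - y_ k.+1 b) - (y a - y_ k.+1 a)); last first.
    by apply/rowP => i; rewrite !mxE; ring.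
  rewrite (le_trans (ler_normB _ _))//.
  have := ler_normD (y_ k.+1 b - y_ k.+1 a - (b - a) *: F (y s)) (y b - y_ k.+1 b).
  have {}mv : `|y_ k.+1 b - y_ k.+1 a - (b - a) *: F (y s)| <= L' * (M * (b - a) + c k) * (b - a).
    apply: mv => r /andP[ar rb].
      have d1 := dy k r ltac:(clear -a0 ar rb be eps1; lra).
      exact: (is_deriveB _ (is_derive_scalel (F (y s)) r)).
    rewrite (le_trans (FL _ _))// ler_pM2l//.
    rewrite -(subrK (y_ k s) (y_ k r)) -addrA (le_trans (ler_normD _ _))//.
    rewrite lerD//; last by rewrite distrC.
    have [rs|sr] := leP r s.
      rewrite distrC (le_trans (ylip k r s _ rs _))//.
      - exact: le_trans ar.
      - by clear -se eps1; lra.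
      - by rewrite ler_wpM2l//; clear -ar sb; lra.
    rewrite (le_trans (ylip k s r _ (ltW sr) _))//; first exact: ltW.
      by clear -rb be eps1; lra.
    by rewrite ler_wpM2l//; clear -as_ rb; lra.
  by rewrite expr2; clear -h1 h2 ck mv; lra.
apply/is_derive_epsP => e e0.
have LM0 : 0 < L' * M + 1 by rewrite ltr_wpDl// mulr_ge0// ltW.
exists (Num.min (Num.min s (eps - s)) (e / (L' * M + 1))).
  by rewrite !lt_min s0 subr_gt0 se divr_gt0.
move=> h; rewrite !lt_min => /andP[/andP[h1 h2] h3].
have h4 : L' * M * `|h| <= e.
  rewrite ltr_pdivlMr// in h3; have := normr_ge0 h; lra.
suff : `|y (s + h) - y s - h *: F (y s)| <= L' * M * `|h| ^+ 2.
  move=> /le_trans; apply; rewrite expr2 mulrA; exact: ler_wpM2r.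
have [h0|h0] := leP 0 h.
  rewrite ger0_norm// in h1 h2 *.
  have := key s (s + h) (ltW s0) ltac:(by rewrite lerDl) ltac:(clear -h2; lra)
    ltac:(by rewrite lexx lerDl).
  by rewrite (_ : s + h - s = h)//; ring.
rewrite ltr0_norm// in h1 h2 *.
have := key (s + h) s ltac:(clear -h1; lra) ltac:(clear -h0; lra) (ltW se)
  ltac:(clear -h0; lra).
rewrite (_ : s - (s + h) = - h); last by ring.
rewrite -[X in X <= _ -> _]normrN.
rewrite (_ : - (y s - y (s + h) - - h *: F (y s)) = y (s + h) - y s - h *: F (y s))//.
by apply/rowP => i; rewrite !mxE; ring.
Qed.

(** The field is composed with the coordinatewise truncation to the unit cube around [x], which is
    1-Lipschitz for the max norm. Before time [1 / (M + 1)] the solution stays in the cube, where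
    the truncation is the identity. *)
Lemma picard_local (F : 'rV[R]_n -> 'rV[R]_n) (x : 'rV[R]_n) (L M : R) :
  (forall y z, `|y - x| <= 1 -> `|z - x| <= 1 -> `|F y - F z| <= L * `|y - z|) ->
  (forall y, `|y - x| <= 1 -> `|F y| <= M) ->
  exists2 eps : R, 0 < eps & exists2 y : R -> 'rV[R]_n, y 0 = x &
    (forall s, 0 < s < eps -> is_derive s (1 : R) y (F (y s))) /\
    (forall s t, 0 <= s -> s <= t -> t <= eps -> `|y t - y s| <= M * (t - s)).
Proof.
move=> FL FM.
pose cl (y : 'rV[R]_n) : 'rV[R]_n := x + \row_i clip (-1) 1 ((y - x) ord0 i).
have cl1 y : `|cl y - x| <= 1.
  rewrite addrC addKr; apply: norm_le_coord => // i; rewrite mxE ler_norml.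
  by apply: clip_itv; lra.
have cllip y z : `|cl y - cl z| <= `|y - z|.
  apply: norm_le_coord => // i; rewrite !mxE.
  rewrite (_ : forall a b c : R, a + b - (a + c) = b - c); last by move=> a b c; ring.
  apply: (le_trans (clip_lip _ _ _ _)).
  rewrite (_ : y ord0 i - x ord0 i - (z ord0 i - x ord0 i) = (y - z) ord0 i); last first.
    by rewrite !mxE; ring.
  exact: coord_norm_le.
have clid y : `|y - x| <= 1 -> cl y = y.
  move=> yx; apply/rowP => i; rewrite mxE [X in _ + X]mxE clip_id; first by rewrite !mxE; ring.
  by have := le_trans (coord_norm_le (y - x) i) yx; rewrite ler_norml.
have M0 : 0 <= M by rewrite (le_trans _ (FM x _))// subrr normr0.
have [||e e0 [y y0 [dy ylip]]] := @picard_global (F \o cl) x `|L| M.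
- move=> y z /=; apply: (le_trans (FL _ _ (cl1 _) (cl1 _))).
  apply: (@le_trans _ _ (`|L| * `|cl y - cl z|)); first by rewrite ler_wpM2r// ler_norm.
  by rewrite ler_wpM2l.
- by move=> y /=; exact: FM.
have M10 : 0 < M + 1 by rewrite ltr_wpDl.
exists (Num.min e (1 / (M + 1))); first by rewrite lt_min e0 divr_gt0.
exists y => //; split => [s /andP[s0]|s t s0 st].
  rewrite lt_min => /andP[se]; rewrite ltr_pdivlMr// => sM.
  have := dy s; rewrite s0 se => /(_ isT)/=; rewrite clid// -y0.
  apply: (le_trans (ylip 0 s (lexx _) (ltW s0) (ltW se))); lra.
by rewrite le_min => /andP[te _]; exact: ylip.
Qed.

End picard.

(** * Local, extended and maximal solutions *)

Section gluing.
Context {R : realType} {n m : nat}.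
Variable f : 'I_m -> 'rV[R]_n -> 'rV[R]_n.
Implicit Types (x : 'rV[R]_n) (alpha : R -> 'rV[R]_m) (y z : R -> 'rV[R]_n).

Lemma is_derive_local (W : normedModType R) (g h : R -> W) (s d : R) (D : W) :
  0 < d -> (forall r, `|r - s| < d -> h r = g r) ->
  is_derive s (1 : R) g D -> is_derive s (1 : R) h D.
Proof.
move=> d0 hg /is_derive_epsP H; apply/is_derive_epsP => e e0.
have [d' d'0 d'P] := H e e0.
exists (Num.min d d'); first by rewrite lt_min d0.
move=> r; rewrite lt_min => /andP[rd rd'].
rewrite !hg ?subrr ?normr0//; first exact: d'P.
by rewrite addrC addKr.
Qed.

Lemma is_derive_translate (W : normedModType R) (g : R -> W) (p s : R) (D : W) :
  is_derive (s - p) (1 : R) g D -> is_derive s (1 : R) (fun r => g (r - p)) D.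
Proof.
move=> /is_derive_epsP H; apply/is_derive_epsP => e e0.
have [d d0 dP] := H e e0; exists d => // h /dP.
by rewrite (addrAC s (- p) h).
Qed.

Lemma absolutely_continuous_congr (a b : R) y z :
  (forall s, a <= s <= b -> z s = y s) ->
  absolutely_continuous_on a b y -> absolutely_continuous_on a b z.
Proof.
move=> zy acy e /acy[d d0 dP]; exists d => // N u v uv dis sd.
have -> : \sum_i `|z (v i) - z (u i)| = \sum_i `|y (v i) - y (u i)|.
  apply: eq_bigr => i _; have [h1 [h2 h3]] := uv i.
  by rewrite !zy// ?h1 ?h3 ?(le_trans h2)// (le_trans h1).
exact: dP.
Qed.

Lemma ae_subset (P Q : R -> Prop) :
  (forall s, P s -> Q s) ->
  {ae @lebesgue_measure R, forall s, P s} -> {ae @lebesgue_measure R, forall s, Q s}.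
Proof.
by move=> PQ; apply: (@filterS _ _ (ae_filter_ringOfSetsType (@lebesgue_measure R))).
Qed.

Lemma ae_all (P : R -> Prop) : (forall s, P s) -> {ae @lebesgue_measure R, forall s, P s}.
Proof.
move=> H; apply: (@filterE _ _ (ae_filter_ringOfSetsType (@lebesgue_measure R))) => s.
exact: H.
Qed.

Lemma ae_bigcap (P : nat -> R -> Prop) :
  (forall k, {ae @lebesgue_measure R, forall s, P k s}) ->
  {ae @lebesgue_measure R, forall s, forall k, P k s}.
Proof.
move=> H.
have : (@lebesgue_measure R).-negligible (\bigcup_k ~` [set s | P k s]).
  by apply: negligible_bigcup => k; exact: H.
move=> [N [mN N0 NP]]; exists N; split => //; apply: subset_trans NP.
move=> s /= nP; apply: contrapT => nc; apply: nP => k.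
by apply: contrapT => nPk; apply: nc; exists k.
Qed.

Lemma ae_countable (P : R -> Prop) (c : nat -> R) :
  (forall s, (forall k, s != c k) -> P s) -> {ae @lebesgue_measure R, forall s, P s}.
Proof.
move=> H; have : {ae @lebesgue_measure R, forall s, forall k, s != c k}.
  apply: ae_bigcap => k; exists [set c k].
  split; [exact: measurable_set1|exact: lebesgue_measure_set1|].
  by move=> s /= /negP/negPn/eqP.
exact: ae_subset.
Qed.

Hypothesis loc_lip : forall B : R, exists L M,
  [/\ 0 <= L, 0 <= M & lipschitz_bounded f B L M].

Lemma local_constant_solution x (a : 'rV[R]_m) :
  exists M eps : R, 0 < eps /\ exists2 y, y 0 = x &
    (forall s, 0 < s < eps -> is_derive s (1 : R) y (dynamics f (y s) a)) /\
    (forall s t, 0 <= s -> s <= t -> t <= eps -> `|y t - y s| <= M * (t - s)).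
Proof.
have [L [M [L0 M0 LM]]] := loc_lip (`|x| + 1).
have nb w : `|w - x| <= 1 -> `|w| <= `|x| + 1.
  by move=> h; rewrite -(subrK x w) (le_trans (ler_normD _ _))// addrC lerD2l.
have [|y /nb yB|eps eps0 H] := @picard_local _ _ (fun v => dynamics f v a) x
    ((\sum_i `|a ord0 i|) * L) ((\sum_i `|a ord0 i|) * M).
- by move=> w z /nb wB /nb zB; exact: dynamics_lip LM wB zB.
- exact: dynamics_bound LM yB.
- by exists ((\sum_i `|a ord0 i|) * M), eps; split.
Qed.

Lemma local_solution alpha x (a : 'rV[R]_m) (eta : R) : 0 < eta ->
  (forall s, 0 < s < eta -> alpha s = a) ->
  exists (S : \bar R) y, is_solution f alpha x S y.
Proof.
move=> eta0 al.
have [M [eps [eps0 [y y0 [dy ylip]]]]] := local_constant_solution x a.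
exists (Num.min eps eta)%:E, y; split => //.
- by rewrite lte_fin lt_min eps0.
- move=> b b0; rewrite lte_fin lt_min => /andP[be _].
  apply: (@lip_absolutely_continuous _ _ M) => s t s0 st tb.
  by apply: ylip => //; rewrite (le_trans tb)// ltW.
- apply: ae_all => s s0; rewrite lte_fin lt_min => /andP[se sn].
  by rewrite al ?s0//; apply: dy; rewrite s0.
Qed.

Lemma left_limit (y : R -> 'rV[R]_n) (s0 M : R) : 0 < s0 -> 0 <= M ->
  (forall s t, 0 <= s -> s <= t -> t < s0 -> `|y t - y s| <= M * (t - s)) ->
  exists w, forall s, 0 <= s -> s < s0 -> `|w - y s| <= M * (s0 - s).
Proof.
move=> s00 M0 ylip.
pose t k := s0 - s0 / 2 ^+ k.
have tlt k : t k < s0 by rewrite /t gtrBl divr_gt0// exprn_gt0.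
have t_ge0 k : 0 <= t k.
  by rewrite /t subr_ge0 ler_pdivrMr ?exprn_gt0// ler_pMr// exprn_ege1// ler1n.
have tmono k p : t k <= t (k + p)%N.
  rewrite /t lerD2l lerN2 ler_pM2l// lef_pV2 ?posrE ?exprn_gt0//.
  by rewrite ler_weXn2l ?leq_addr// ler1n.
have [||w wP] := @cauchy_rate_limit R n (fun k => y (t k)) (fun k => M * s0 / 2 ^+ k).
- move=> k p; apply: (le_trans (ylip _ _ _ _ _)) => //.
  rewrite -mulrA ler_wpM2l// /t.
  by have := tlt (k + p)%N; rewrite /t; lra.
- by move=> e e0; exact: half_pow_small.
exists w => s sge slt.
have [N NP] := half_pow_small s0 (e := s0 - s) ltac:(by rewrite subr_gt0).
have := NP N (leqnn N) => h.
have st : s <= t N by rewrite /t; lra.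
rewrite -(subrK (y (t N)) w) -addrA (le_trans (ler_normD _ _))//.
have -> : M * (s0 - s) = M * s0 / 2 ^+ N + M * (t N - s) by rewrite /t; ring.
by apply: lerD; [exact: wP|exact: ylip].
Qed.

(** A bounded solution on [[0, s0[] is Lipschitz, hence has a left limit, from which it restarts
    with the control [a]. This is what excludes the breakdown of a bounded maximal solution. *)
Lemma solution_extension alpha x (s0 B eta : R) (a : 'rV[R]_m) y : 0 < eta ->
  (forall s, s0 < s < s0 + eta -> alpha s = a) ->
  is_solution f alpha x s0%:E y ->
  (forall s, 0 <= s -> s < s0 -> control_set (alpha s)) ->
  (forall s, 0 <= s -> s < s0 -> `|y s| <= B) ->
  exists (S : R) z, [/\ s0 < S, is_solution f alpha x S%:E z &
    forall s, 0 <= s -> s < s0 -> z s = y s].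
Proof.
move=> eta0 al soly ctl yB.
have [s00 y0 acy aey] := soly; rewrite lte_fin in s00.
have [L [M [L0 M0 LM]]] := loc_lip B.
have ylip s t : 0 <= s -> s <= t -> t < s0 -> `|y t - y s| <= M * (t - s).
  move=> sge st ts0; apply: (solution_lip soly _ LM) => //.
  by move=> r /andP[sr rt]; apply: yB; [exact: le_trans sr|exact: le_lt_trans ts0].
have [w wP] := left_limit s00 M0 ylip.
have [M' [eps [eps0 [u u0 [du ulip]]]]] := local_constant_solution w a.
pose K := M + `|M'|.
have KM' : M' <= K by rewrite /K (le_trans (ler_norm M'))// lerDr.
have KM : M <= K by rewrite /K lerDl.
pose z s := if s < s0 then y s else u (s - s0).
pose S := s0 + Num.min eps eta.
have e0 : 0 < Num.min eps eta by rewrite lt_min eps0.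
have ee : Num.min eps eta <= eps by rewrite ge_min lexx.
have en : Num.min eps eta <= eta by rewrite ge_min lexx orbT.
have zlip s t : 0 <= s -> s <= t -> t < S -> `|z t - z s| <= K * (t - s).
  move=> sge st tS; rewrite /z.
  have [ts|st0] := ltP t s0.
    rewrite (le_lt_trans st ts) (le_trans (ylip _ _ sge st ts))//.
    by rewrite ler_wpM2r// subr_ge0.
  have [ss|ss] := ltP s s0; last first.
    rewrite (le_trans (ulip _ _ _ _ _))//; [by rewrite subr_ge0|by rewrite lerD2r| |].
      by move: tS; rewrite /S; lra.
    rewrite (_ : t - s0 - (s - s0) = t - s); last by ring.
    by rewrite ler_wpM2r// subr_ge0.
  rewrite -(subrK w (u _)) -addrA (le_trans (ler_normD _ _))//.
  have h1 := wP s sge ss.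
  have := ulip 0 (t - s0) (lexx _) ltac:(by rewrite subr_ge0) ltac:(move: tS; rewrite /S; lra).
  rewrite u0 subr0 => h2.
  have h3 : M * (s0 - s) <= K * (s0 - s) by rewrite ler_wpM2r// subr_ge0 ltW.
  have h4 : M' * (t - s0) <= K * (t - s0) by rewrite ler_wpM2r// subr_ge0.
  lra.
exists S, z; split.
- by rewrite ltrDl.
- split.
  + by rewrite lte_fin addr_gt0.
  + by rewrite /z s00.
  + move=> b b0; rewrite lte_fin => bS.
    apply: (@lip_absolutely_continuous _ _ K) => s t sge st tb.
    by apply: zlip => //; exact: le_lt_trans bS.
  (* Index 0 carries the equation before [s0]; the other indices discard the gluing time [s0]. *)
  + have /(@ae_bigcap (fun k s => if k is 0%N then 0 < s -> (s%:E < s0%:E)%E ->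
        is_derive s (1 : R) y (dynamics f (y s) (alpha s)) else s != s0)) :
      forall k : nat, {ae @lebesgue_measure R, forall s, (if k is 0%N then 0 < s -> (s%:E < s0%:E)%E ->
        is_derive s (1 : R) y (dynamics f (y s) (alpha s)) else s != s0)}.
      move=> [|k] //; by apply: (@ae_countable _ (fun=> s0)) => s /(_ 0%N).
    apply: ae_subset => s H s_gt0; rewrite lte_fin => sS.
    have := H 1%N; have := H 0%N s_gt0; rewrite lte_fin /z.
    have [ss|ss] := ltP s s0 => H0 sns.
      apply: (is_derive_local (g := y) (d := s0 - s)); rewrite ?subr_gt0//; last by apply: H0.
      by move=> r; rewrite ltr_norml => /andP[_ h]; rewrite ifT//; lra.
    have {sns}ss : s0 < s by rewrite lt_def sns.
    rewrite al; last by rewrite ss/=; move: sS; rewrite /S; lra.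
    apply: (is_derive_local (d := s - s0)) (is_derive_translate _); rewrite ?subr_gt0//.
      by move=> r; rewrite ltr_norml => /andP[h _]; rewrite ifF//; apply/negbTE; rewrite -leNgt; lra.
    by apply: du; rewrite subr_gt0 ss/=; move: sS; rewrite /S; lra.
- by move=> s sge ss; rewrite /z ss.
Qed.

(** Zorn's lemma for the extension preorder: members of a chain agree where both are defined, so
    their union is a function. *)
Lemma maximal_solution_exists alpha x S0 y0 : is_solution f alpha x S0 y0 ->
  exists S y, is_maximal_solution f alpha x S y.
Proof.
move=> sol0.
pose X := {Sy : \bar R * (R -> 'rV[R]_n) | is_solution f alpha x Sy.1 Sy.2}.
pose t0 : X := exist _ (S0, y0) sol0.
pose rel (t t' : X) : bool := `[< ((sval t).1 <= (sval t').1)%E /\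
  forall s : R, 0 <= s -> (s%:E < (sval t).1)%E -> (sval t').2 s = (sval t).2 s >].
have [||A totA|t tmax] := ZL_preorder t0 (R := rel).
- by move=> t; apply/asboolP.
- move=> r s t /asboolP[h1 h2] /asboolP[h3 h4]; apply/asboolP; split.
    exact: le_trans h3.
  by move=> q q0 qs; rewrite h4 ?h2//; exact: lt_le_trans h1.
- have [A0|/set0P[a0 Aa0]] := eqVneq A set0; first by exists t0 => s; rewrite A0.
  pose Ss := ereal_sup [set (sval t).1 | t in A].
  have Sle t : A t -> ((sval t).1 <= Ss)%E by move=> At; apply: ereal_sup_ubound; exists t.
  have pick (s : R) : exists t, (s%:E < Ss)%E -> A t /\ (s%:E < (sval t).1)%E.
    have [/ereal_sup_gt[_ [t At <-] st]|] := pselect (s%:E < Ss)%E; last by exists t0.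
    by exists t.
  have [tk tkP] := choice pick.
  pose ys s := (sval (tk s)).2 s.
  have agree t s : A t -> 0 <= s -> (s%:E < (sval t).1)%E -> ys s = (sval t).2 s.
    move=> At sge st; have [Atk sk] := tkP s (lt_le_trans st (Sle _ At)).
    by rewrite /ys; case: (totA _ _ Atk At) => /asboolP[_ h]; [rewrite h|rewrite -h].
  have sols : is_solution f alpha x Ss ys.
    have [S00 y00 _ _] := svalP a0.
    split.
    + exact: lt_le_trans S00 (Sle _ Aa0).
    + by rewrite (agree a0).
    + move=> b b0 bS; have [Atk sk] := tkP b bS.
      have [_ _ acy _] := svalP (tk b).
      apply: absolutely_continuous_congr (acy b b0 sk) => s /andP[sge sb].
      by apply: agree => //; apply: le_lt_trans sk; rewrite lee_fin.
    + (* Only countably many members of the chain may be used: those chosen for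
         rational times already cover every time below the supremum. *)
      have := @ae_bigcap (fun k s => if @unpickle rat k is Some q then
         0 < s -> (s%:E < (sval (tk (ratr q))).1)%E ->
         is_derive s (1 : R) (sval (tk (ratr q))).2 (dynamics f ((sval (tk (ratr q))).2 s) (alpha s))
         else True).
      move=> /(_ _)/ae_subset; apply.
        move=> s H s_gt0 sS.
        have [b sb bS] := ereal_between sS.
        have [q] := rat_in_itvoo sb; rewrite in_itv/= => /andP[sq qb].
        have qS : ((ratr q)%:E < Ss)%E by apply: lt_trans bS; rewrite lte_fin.
        have [Atk sk] := tkP _ qS.
        have ssk : (s%:E < (sval (tk (ratr q))).1)%E by apply: lt_trans sk; rewrite lte_fin.
        have := H (pickle q); rewrite pickleK => /(_ s_gt0 ssk).
        rewrite (agree _ _ Atk (ltW s_gt0) ssk).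
        apply: (is_derive_local (d := Num.min s (ratr q - s))).
          by rewrite lt_min s_gt0 subr_gt0.
        move=> r; rewrite lt_min !ltr_norml => /andP[/andP[r1 _] /andP[_ r2]].
        apply: agree => //; first by lra.
        by apply: lt_trans sk; rewrite lte_fin; lra.
      move=> k; case: unpickle => [q|]; last exact: ae_all.
      by have [_ _ _] := svalP (tk (ratr q)).
  exists (exist _ (Ss, ys) sols) => t At; apply/asboolP => /=; split; first exact: Sle.
  by move=> s sge st; apply: agree.
- exists (sval t).1, (sval t).2; split; first exact: (svalP t).
  move=> S' y' sol' SS' yy'.
  have /tmax/asboolP[/= h _] : rel t (exist _ (S', y') sol') by apply/asboolP.
  by apply/eqP; rewrite eq_le h SS'.
Qed.

End gluing.

(** * Existence of sampling processes *)

Section process.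
Context {R : realType} {n m : nat}.
Variables (f : 'I_m -> 'rV[R]_n -> 'rV[R]_n) (T : set 'rV[R]_n).

Lemma switch_number_gt0 B : (0 < switch_number B)%N.
Proof. by elim: B => //= B1 h1 B2 h2; rewrite muln_gt0/= addn_gt0 h1. Qed.

(** A negative label reads its control backwards from [t], so the germ at the end matters too. For a
    bracket it is the germ at the start of the control of [B2], with the opposite sign. *)
Lemma positive_control_germs (g : seq 'I_m) B (t : R) : 0 < t ->
  (exists eta a, 0 < eta /\ forall s, 0 < s < eta -> positive_control g B t s = a) /\
  (exists eta a, 0 < eta /\ forall s, t - eta < s < t -> positive_control g B t s = a).
Proof.
elim: B t => [j|B1 IH1 B2 IH2] t t0.
  by split; exists 1, (positive_control g (Letter j) t 0); split.
pose q1 : R := (switch_number B1)%:R; pose q2 : R := (switch_number B2)%:R.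
have q1_gt0 : 0 < q1 by rewrite ltr0n switch_number_gt0.
have q2_gt0 : 0 < q2 by rewrite ltr0n switch_number_gt0.
pose t1 := q1 * t / (switch_number (Bracket B1 B2))%:R.
pose t2 := q2 * t / (switch_number (Bracket B1 B2))%:R.
have qq : (switch_number (Bracket B1 B2))%:R = 2 * (q1 + q2) :> R by rewrite /= natrM natrD.
have t10 : 0 < t1 by rewrite /t1 divr_gt0 ?mulr_gt0// qq mulr_gt0// addr_gt0.
have t20 : 0 < t2 by rewrite /t2 divr_gt0 ?mulr_gt0// qq mulr_gt0// addr_gt0.
have tt : t1 + t2 + t1 + t2 = t.
  by rewrite /t1 /t2 qq; field; rewrite gt_eqF// addr_gt0.
have [[e1 [a1 [e10 H1]]] _] := IH1 t1 t10.
have [[e2 [a2 [e20 H2]]] _] := IH2 t2 t20.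
split.
  exists (Num.min e1 t1), a1; split; first by rewrite lt_min e10.
  move=> s /andP[s0]; rewrite lt_min => /andP[se st].
  by rewrite /= -/q1 -/q2 ifT// H1// s0.
exists (Num.min e2 t2), (- a2); split; first by rewrite lt_min e20.
move=> s /andP[s1 s2].
have h1 : t - e2 < s by apply: le_lt_trans s1; rewrite lerD2l lerN2 ge_min lexx.
have h2 : t - t2 < s by apply: le_lt_trans s1; rewrite lerD2l lerN2 ge_min lexx orbT.
rewrite /= -/q1 -/q2 -[q1 * t / _]/t1 -[q2 * t / _]/t2.
rewrite ifF; last by apply/negbTE; rewrite -leNgt; lra.
rewrite ifF; last by apply/negbTE; rewrite -leNgt; lra.
rewrite ifF; last by apply/negbTE; rewrite -leNgt; lra.
by rewrite /reverse_control H2//; lra.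
Qed.

Lemma multiflow_control_germ (V : 'rV[R]_n -> label m) x (t : R) : 0 < t ->
  exists eta a, 0 < eta /\ forall s, 0 < s < eta -> multiflow_control V x t s = a.
Proof.
move=> t0; have [[e1 [a1 [e10 H1]]] [e2 [a2 [e20 H2]]]] :=
  positive_control_germs (label_string (V x)) (label_bracket (V x)) t0.
rewrite /multiflow_control /oriented_control.
case: (label_sign (V x)).
  exists (Num.min e1 t), a1; split; first by rewrite lt_min e10.
  by move=> s /andP[s0]; rewrite lt_min => /andP[se /ltW/min_idPl ->]; rewrite H1// s0.
exists (Num.min e2 t), (- a2); split; first by rewrite lt_min e20.
move=> s /andP[s0]; rewrite lt_min => /andP[se /[dup] st /ltW/min_idPl ->].
by rewrite /reverse_control H2//; lra.
Qed.

Lemma lt_exit_time (r p : R) (S : \bar R) (z : R -> 'rV[R]_n) s :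
  (r%:E < exit_time T p S z)%E -> p <= s -> s <= r ->
  ((s - p)%:E < S)%E /\ ~ T (z (s - p)).
Proof.
move=> /ereal_sup_gt[_ [q [pq H] <-]]; rewrite lte_fin => rq ps sr.
by apply: H => //; exact: le_lt_trans rq.
Qed.

Lemma sampling_process_notin V x pi alpha y J sigma :
  sampling_process f T V x pi alpha y J sigma ->
  forall j, step_of J j -> ~ T (y (pi j.-1)).
Proof.
move=> [nTx [pi0 piS _] y0 _ H] [[]//|[|j]] [_ jJ].
  by rewrite /= pi0 y0.
have [|S [z [_ _]]] := H j.+1.
  by split => //; case: J jJ {H} => // j0 /ltnW.
rewrite ifF; last by apply/negbTE; apply: contraTN isT => /eqP JE; move: jJ; rewrite JE ltnn.
move=> [h yE]; rewrite [j.+2.-1]/= yE.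
by have [_] := lt_exit_time h (ltW (piS j)) (lexx _).
Qed.

Hypothesis loc_lip : forall B : R, exists L M,
  [/\ 0 <= L, 0 <= M & lipschitz_bounded f B L M].

Lemma multiflow_exists V x (t : R) : 0 < t -> exists S z, is_multiflow f V x t S z.
Proof.
move=> /(multiflow_control_germ V x)[eta [a [eta0 H]]].
have [S [z sol]] := local_solution loc_lip x eta0 H.
exact: maximal_solution_exists sol.
Qed.

(** Step lengths depend on the state because a multirank prescribes them through the degree of the
    current label; the uniform lower bound [c] makes the sampling times diverge. *)
Lemma sampling_process_exists V x (step : 'rV[R]_n -> R) (c : R) : 0 < c ->
  (forall w, c <= step w) -> ~ T x ->
  exists pi alpha y J sigma, sampling_process f T V x pi alpha y J sigma /\
    forall j, (1 <= j)%N -> pi j - pi j.-1 = step (y (pi j.-1)).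
Proof.
move=> c0 cstep nTx.
have step0 w : 0 < step w by exact: lt_le_trans (cstep w).
have ex w : exists Sz : \bar R * (R -> 'rV[R]_n), is_multiflow f V w (step w) Sz.1 Sz.2.
  by have [S [z H]] := multiflow_exists V w (step0 w); exists (S, z).
have [Sz SzP] := choice ex.
(* The recursion ignores [T] and never stops; [J] cuts it afterwards at the first step that meets
   the exit condition. *)
pose xs := fix xs k := if k is k'.+1 then (Sz (xs k')).2 (step (xs k')) else x.
pose pi := fix pi k := if k is k'.+1 then pi k' + step (xs k') else 0 : R.
have piS k : pi k < pi k.+1 by rewrite /= ltrDl.
have pige k : k%:R * c <= pi k.
  elim: k => [|k IH]; first by rewrite mul0r.
  by rewrite /= -addn1 natrD mulrDl mul1r lerD.
have pimono j k : (j <= k)%N -> pi j <= pi k.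
  elim: k => [|k IH]; first by rewrite leqn0 => /eqP ->.
  by rewrite leq_eqVlt => /orP[/eqP->//|/IH h]; exact: le_trans h (ltW (piS k)).
have partpi : is_partition pi.
  split=> //; apply/cvgryPge => A; near=> k.
  apply: le_trans (pige k); rewrite -ler_pdivrMr//.
  near: k; exists (Num.bound (`|A| / c)) => // k /= Ak.
  apply: (@le_trans _ _ (`|A| / c)); first by rewrite ler_pM2r ?invr_gt0// ler_norm.
  apply: ltW; apply: (lt_le_trans (archi_boundP _)); last by rewrite ler_nat.
  by rewrite divr_ge0// ltW.
have idx s : exists k, 0 <= s -> pi k <= s < pi k.+1.
  have [s0|] := pselect (0 <= s); last by exists 0%N.
  have [k] : exists k, s < pi k.
    exists (Num.bound (s / c)).
    apply: lt_le_trans (pige _); rewrite -ltr_pdivrMr//.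
    by apply: archi_boundP; rewrite divr_ge0// ltW.
  elim: k => [|k IH]; first by rewrite ltNge s0.
  have [/IH//|ks sk] := ltP s (pi k).
  by exists k => _; rewrite ks.
have [ix ixP] := choice idx.
have ixE k s : pi k <= s -> s < pi k.+1 -> ix s = k.
  move=> h1 h2; have s0 : 0 <= s by apply: le_trans h1; rewrite -[0]/(pi 0%N) pimono.
  have /andP[h3 h4] := ixP s s0.
  apply/eqP; rewrite eqn_leq; apply/andP; split; rewrite leqNgt; apply/negP => h.
    by have := le_lt_trans (le_trans (pimono _ _ h) h3) h2; rewrite ltxx.
  by have := le_lt_trans (le_trans (pimono _ _ h) h1) h4; rewrite ltxx.
pose y s := (Sz (xs (ix s))).2 (s - pi (ix s)).
pose alpha s := multiflow_control V (xs (ix s)) (step (xs (ix s))) (s - pi (ix s)).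
have ypi k : y (pi k) = xs k.
  rewrite /y (ixE k (pi k))// subrr.
  by have [[_ -> _ _] _] := SzP (xs k).
pose sig k := exit_time T (pi k) (Sz (xs k)).1 (Sz (xs k)).2.
pose stop j := (0 < j)%N && `[< (sig j.-1 <= (pi j)%:E)%E >].
have [J JP] : exists J : option nat, if J is Some j0
    then stop j0 /\ (forall j, (j < j0)%N -> ~~ stop j) else forall j, ~~ stop j.
  have [[j sj]|H] := pselect (exists j, stop j); last first.
    by exists None => j; apply/negP => sj; apply: H; exists j.
  case: (ex_minnP (ex_intro (fun j => stop j) j sj)) => j0 sj0 minj; exists (Some j0).
  split=> // j' jj; apply/negP => /minj; by rewrite leqNgt jj.
exists pi, alpha, y, J, (if J is Some j0 then sig j0.-1 else +oo%E); split; last first.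
  by move=> [//|j] _; rewrite ypi /= addrC addKr.
split => //.
- by rewrite -[0]/(pi 0%N) ypi.
- by split; [case: J JP => // -[|?] []|case: J JP].
move=> [|j] [// _ jJ]; exists (Sz (xs j)).1, (Sz (xs j)).2.
cbv zeta; have tE : pi j.+1 - pi j = step (xs j) by rewrite /= addrC addKr.
rewrite [j.+1.-1]/= !ypi tE; split; first exact: SzP.
- by move=> s h1 h2 _; rewrite /y /alpha (ixE j).
- have nstop : J != Some j.+1 -> ((pi j.+1)%:E < sig j)%E.
    move=> Jj; have : ~~ stop j.+1.
      case: J JP jJ Jj => [j0 [_ H] jj0 Jj|//]; apply: H.
      by rewrite ltn_neqAle jj0 andbT; apply: contraNN Jj => /eqP ->.
    by rewrite /stop/=; move/asboolPn/negP; rewrite -ltNge.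
  case: ifPn => [/eqP JE|/nstop h].
    by move: JP; rewrite JE => -[/andP[_ /asboolP h] _].
  by split.
Unshelve. all: by end_near. Qed.

End process.

(** * Open-loop controllability *)

Section steering.
Context {R : realType} {n m : nat}.
Variables (f : 'I_m -> 'rV[R]_n -> 'rV[R]_n) (T : set 'rV[R]_n).

Definition steerable (x : 'rV[R]_n) (C r tmax : R) : Prop :=
  exists (S : \bar R) (alpha : R -> 'rV[R]_m) (y : R -> 'rV[R]_n) (tau : R),
    [/\ is_solution f alpha x S y,
        forall s : R, 0 <= s -> (s%:E < S)%E -> control_set (alpha s),
        [/\ 0 <= tau, tau <= tmax & (tau%:E < S)%E],
        forall s, 0 <= s <= tau -> ~ T (y s) /\ rdist T (y s) <= C &
        rdist T (y tau) <= r].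

Definition asymptotically_controllable (Gamma : R -> R) : Prop :=
  exists S : R -> R -> R, forall rho r : R, 0 < r -> r < rho ->
    forall x, ~ T x -> rdist T x <= rho -> steerable x (Gamma rho) r (S rho r).

Hypothesis T0 : T !=set0.
Hypothesis loc_lip : forall B : R, exists L M,
  [/\ 0 <= L, 0 <= M & lipschitz_bounded f B L M].

Lemma extend_lt (S : \bar R) (y : R -> 'rV[R]_n) s : (s%:E < S)%E -> extend S y s = y s.
Proof. by rewrite /extend => ->. Qed.

(** If the trajectory ends on [T] at a time [S <= t], one stops shortly before: the distance tends
    to 0, so it drops below [r] while the curve is still outside [T]. *)
Lemma admissible_pair_steerable x (S : \bar R) alpha y (C r t : R) :
  admissible_pair f T x S alpha y ->
  (forall s, 0 <= s -> (s%:E < S)%E -> rdist T (y s) <= C) ->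
  0 < r -> 0 <= t -> ((t%:E < S)%E -> rdist T (y t) <= r) ->
  steerable x C r t.
Proof.
move=> [_ ctl nT sol lim0] yC r0 t0 yt; exists S, alpha, y.
have [tS|St] := ltP t%:E S.
  exists t; split => //; last exact: yt.
  move=> s /andP[s0 st]; have sS : (s%:E < S)%E by apply: le_lt_trans tS; rewrite lee_fin.
  by split; [exact: nT|exact: yC].
have [S0 _ _ _] := sol.
case: S S0 St ctl nT sol lim0 yC {yt} => [s0| |]// S0; rewrite ?lee_fin ?leey_eq// => s0t.
move=> ctl nT sol lim0 yC; rewrite lte_fin in S0.
have := lim0 s0 erefl; under eq_cvg do rewrite (distE T0).
move=> /fine_cvg/cvgrPdist_lt/(_ _ r0) H.
have [tau [tau0 taus taur]] : exists tau, [/\ 0 < tau, tau < s0 & rdist T (y tau) < r].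
  near (s0^'-) => tau; exists tau; split; near: tau.
  - exact: nbhs_left_gt.
  - exact: nbhs_left_lt.
  - apply: filterS H => s /=; rewrite sub0r normrN.
    exact: le_lt_trans (ler_norm _).
exists tau; split; [exact: sol|exact: ctl| | |exact: ltW].
  by split; [exact: ltW|exact: le_trans (ltW taus) s0t|rewrite lte_fin].
- move=> s /andP[sge st]; have sS : (s%:E < s0%:E)%E by rewrite lte_fin (le_lt_trans st).
  by split; [exact: nT|exact: yC].
Unshelve. all: by end_near. Qed.

Lemma sample_stabilizable_controllable k : (1 <= k)%N ->
  sample_stabilizable f T k ->
  exists2 Gamma, class_Kinfty Gamma & asymptotically_controllable Gamma.
Proof.
move=> k1 [V [delta [Gamma [SS [fV d0 KG [SS0 _ _] H]]]]].
exists Gamma => //; exists SS => rho r r0 rrho x nTx xrho.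
have rho0 : 0 < rho by exact: lt_trans rrho.
have dl0 := d0 _ _ rho0 r0.
have [pi [alpha [y [J [sigma [proc piE]]]]]] :=
  sampling_process_exists loc_lip V (step := fun=> delta rho r) dl0 (fun=> lexx _) nTx.
have xd : (dist T x <= rho%:E)%E by rewrite (distE T0) lee_fin.
(* Constant steps equal to the rank also satisfy the lower bound, as (k - 1) / (2k) <= 1 and j^(1/k)
   >= 1. *)
have ppi : partition_of_rank k (delta rho r) pi.
  split; first by case: proc.
  move=> j j1; rewrite piE//; split => //.
  have k0 : (0 : R) < k%:R by rewrite ltr0n.
  have kge1 : (1 : R) <= k%:R by rewrite ler1n.
  apply: (@le_trans _ _ (1 * delta rho r)); last by rewrite mul1r.
  apply: ler_pM.
  + by rewrite divr_ge0 ?subr_ge0// mulr_ge0.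
  + by rewrite divr_ge0 ?powR_ge0// ltW.
  + by rewrite ler_pdivrMr ?mulr_gt0// mul1r; lra.
  + rewrite ler_pdivrMr; last by rewrite powR_gt0// ltr0n.
    have j1' : (1 : R) <= j%:R by rewrite ler1n.
    have k_ge0 : (0 : R) <= k%:R^-1 by rewrite invr_ge0.
    by have := ler_powR j1' k_ge0; rewrite powRr0 ler_pMr.
have [adm Ya Yb] := H rho r r0 rrho pi ppi x nTx xd alpha y J sigma proc.
apply: (admissible_pair_steerable adm) => //.
- by move=> s s0 sS; have := Ya s s0; rewrite extend_lt// (distE T0) lee_fin.
- exact/ltW/SS0.
- by move=> sS; have := Yb _ (lexx _); rewrite extend_lt// (distE T0) lee_fin.
Qed.

(** Condition (c) speaks of positive times, whereas the hitting time may be 0. If [U x < phi r],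
    continuity of [U] keeps [U] below [phi r] up to a small positive time. Otherwise
    [U x >= phi r > phi (r / 2)], and the threshold for [r / 2] can only be met at a positive
    time. *)
Lemma U_sample_stabilizable_controllable k (U : 'rV[R]_n -> R) : (1 <= k)%N ->
  {within closure (~` T), continuous U} ->
  U_sample_stabilizable f T k U ->
  exists2 Gamma, class_Kinfty Gamma & asymptotically_controllable Gamma.
Proof.
move=> k1 cU [V [d [Gamma [phi [TT [fV d0 [KG [_ phi_lt phi0 _]] [TT0 _ _] H]]]]]].
(* The term [+ 1] is there because the hitting time is an infimum; it also covers the small time
   used when [U x < phi r]. *)
exists Gamma => //; exists (fun rho r => Num.max (TT rho r) (TT rho (r / 2)) + 1).
move=> rho r r0 rrho x nTx xrho.
have rho0 : 0 < rho by exact: lt_trans rrho.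
have proc r' : 0 < r' -> r' < rho -> exists alpha y (sigma : \bar R),
    [/\ admissible_pair f T x sigma alpha y,
        forall s, 0 <= s -> (s%:E < sigma)%E -> rdist T (y s) <= Gamma rho,
        (hitting_time (U \o extend sigma y) (phi r') <= (TT rho r')%:E)%E &
        forall tau : R, 0 < tau -> U (extend sigma y tau) <= phi r' ->
          (tau%:E < sigma)%E -> rdist T (y tau) <= r'].
  move=> r'0 r'rho.
  (* The default 1 can occur only on [T], where the values of [V] are arbitrary. *)
  pose step w := if (ell V w <= k)%N then nth 0 (d rho r') (ell V w).-1 else 1.
  (* A positive lower bound for every entry of the tuple and for the default 1. *)
  pose c := (1 + \sum_(i < k) (tnth (d rho r') i)^-1)^-1.
  have s0 : 0 <= \sum_(i < k) (tnth (d rho r') i)^-1.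
    by apply: sumr_ge0 => i _; rewrite invr_ge0 ltW// d0.
  have c0 : 0 < c by rewrite invr_gt0 ltr_pwDl.
  have ci (i : 'I_k) : c <= tnth (d rho r') i.
    rewrite -[leRHS]invrK lef_pV2 ?posrE ?invr_gt0 ?d0//; last by rewrite ltr_pwDl.
    rewrite (bigD1 i)//= addrCA lerDl addr_ge0// sumr_ge0// => j _.
    by rewrite invr_ge0 ltW// d0.
  have cstep w : c <= step w.
    rewrite /step; case: ifP => [wk|_]; last first.
      by rewrite /c invf_le1 ?lerDl// ltr_pwDl.
    have ik : ((ell V w).-1 < k)%N by case: (ell V w) wk.
    by have := ci (Ordinal ik); rewrite (tnth_nth 0).
  have [pi [alpha [y [J [sigma [proc piE]]]]]] :=
    sampling_process_exists loc_lip V (step := step) c0 cstep nTx.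
  have scal : scaled V (d rho r') pi y J.
    move=> j jJ; have j1 : (1 <= j)%N by case: jJ.
    have nTj := sampling_process_notin proc jJ.
    have [dk _] := fV _ nTj.
    cbv zeta; rewrite piE// /step ifT//; split => //.
    have nn : 0 <= nth 0 (d rho r') (ell V (y (pi j.-1))).-1.
      have ik : ((ell V (y (pi j.-1))).-1 < k)%N by move: dk; rewrite -/(ell V _); case: (ell V _).
      by have := d0 _ _ rho0 r'0 (Ordinal ik); rewrite (tnth_nth 0) => /ltW.
    rewrite ler_piMl// ler_pdivrMr ?ltr0n// mul1r.
    by rewrite lerBlDr lerDl.
  have xd : (dist T x <= rho%:E)%E by rewrite (distE T0) lee_fin.
  have [adm Ya Yb Yc] := H rho r' r'0 r'rho x pi alpha y J sigma proc scal xd.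
  exists alpha, y, sigma; split => //.
    by move=> s sge sS; have := Ya s sge; rewrite extend_lt// (distE T0) lee_fin.
  move=> tau tau0 Utau tS.
  by have := Yc tau tau0 Utau tau (lexx _); rewrite extend_lt// (distE T0) lee_fin.
have [Ux|Ux] := ltP (U x) (phi r).
  have [alpha [y [sigma [adm yC _ Yc]]]] := proc r r0 rrho.
  have [_ _ nT sol _] := adm; have [S0 y0 _ _] := sol.
  have Tx : closure (~` T) x by exact: subset_closure.
  have /subspace_continuousP/(_ x Tx)/cvgrPdist_lt := cU.
  have e0 : 0 < phi r - U x by rewrite subr_gt0.
  move=> /(_ _ e0)/nbhs_ballP[e /= e_gt0 eP].
  have [q q0 qP] := solution_continuous sol (lexx 0) S0 e_gt0.
  pose tau := Num.min 1 (q / 2).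
  have tau0 : 0 < tau by rewrite lt_min ltr01 divr_gt0.
  have tau1 : tau <= 1 by rewrite ge_min lexx.
  have [|tS ytau] := qP tau (ltW tau0).
    rewrite subr0 gtr0_norm//.
    by have : tau <= q / 2; [rewrite ge_min lexx orbT|lra].
  have /(admissible_pair_steerable adm yC r0 (ltW tau0)) : (tau%:E < sigma)%E -> rdist T (y tau) <= r.
    apply: Yc => //; rewrite extend_lt//.
    have := eP (y tau); rewrite -ball_normE /ball_/= distrC -{1}y0 => /(_ ytau).
    have yT : closure (~` T) (y tau) by apply: subset_closure; apply: nT => //; exact: ltW.
    by move=> /(_ yT); rewrite /from_subspace ltr_norml => /andP[h _]; lra.
  move=> [S [al [z [t [h1 h2 [h3 h4 h5] h6 h7]]]]]; exists S, al, z, t; split => //; split => //.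
  apply: (le_trans h4); apply: (le_trans tau1); rewrite lerDr le_max.
  by rewrite ltW// TT0.
have r20 : 0 < r / 2 by rewrite divr_gt0.
have r2r : r / 2 < rho by lra.
have [alpha [y [sigma [adm yC hit Yc]]]] := proc _ r20 r2r.
have [_ _ nT sol _] := adm; have [S0 y0 _ _] := sol.
have /ereal_inf_lt[_ [s [s0 Us] <-]] :
    (hitting_time (U \o extend sigma y) (phi (r / 2)%R) < (TT rho (r / 2) + 1)%R%:E)%E.
  by apply: (le_lt_trans hit); rewrite lte_fin ltrDl.
rewrite lte_fin => sTT.
have s_gt0 : 0 < s.
  rewrite lt_def s0 andbT; apply/eqP => s00; move: Us; rewrite s00 /= extend_lt// y0.
  by move=> /(le_trans Ux); rewrite leNgt phi_lt ?ltW//; lra.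
have /(admissible_pair_steerable adm yC r0 s0) : (s%:E < sigma)%E -> rdist T (y s) <= r.
  by move=> /(Yc s s_gt0 Us)/le_trans; apply; lra.
move=> [S [al [z [t [h1 h2 [h3 h4 h5] h6 h7]]]]]; exists S, al, z, t; split => //; split => //.
apply: (le_trans h4); apply: (le_trans (ltW sTT)).
by rewrite lerD2r le_max lexx orbT.
Qed.

End steering.

(** * A decreasing feedback on one annulus *)

Section tube_function.
Context {R : realType} {n m : nat}.
Variables (f : 'I_m -> 'rV[R]_n -> 'rV[R]_n) (T : set 'rV[R]_n).

Definition ctrl (c : 'I_m * bool) : 'rV[R]_m :=
  if c.2 then delta_mx ord0 c.1 else - delta_mx ord0 c.1.

Lemma ctrl_control c : control_set (ctrl c).
Proof. by exists c.1; rewrite /ctrl; case: c.2; [left|right]. Qed.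

Lemma control_setP a : control_set a -> exists c, a = ctrl c.
Proof. by move=> [i [->|->]]; [exists (i, true)|exists (i, false)]. Qed.

Lemma exists_min_seq (I : eqType) (L : seq I) (v : I -> R) : L != [::] ->
  exists2 i, i \in L & forall j, j \in L -> v i <= v j.
Proof.
elim: L => [//|a L IH] _; have [->|/IH[i iL H]] := eqVneq L [::].
  by exists a; rewrite ?mem_head// => j; rewrite mem_seq1 => /eqP ->.
have [h|h] := leP (v i) (v a).
  exists i; first by rewrite in_cons iL orbT.
  by move=> j; rewrite in_cons => /orP[/eqP->//|]; exact: H.
exists a; first exact: mem_head.
by move=> j; rewrite in_cons => /orP[/eqP->//|/H]; apply: le_trans; exact: ltW.
Qed.

Lemma lipschitz_continuous (V W : normedModType R) (g : V -> W) (K : R) :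
  (forall s t, `|g s - g t| <= K * `|s - t|) -> continuous g.
Proof.
move=> gK; apply: continuous_epsP => s e e0.
have K0 : 0 < `|K| + 1 by rewrite ltr_wpDl.
exists (e / (`|K| + 1)); first by rewrite divr_gt0.
move=> t; rewrite ltr_pdivlMr// => h; apply: le_lt_trans h.
apply: (le_trans (gK _ _)); rewrite mulrC ler_wpM2l//.
by rewrite (le_trans (ler_norm K))// lerDl.
Qed.

Lemma dotp_sqrB (u v : 'rV[R]_n) : dotp u u - dotp v v = dotp (u - v) (u + v).
Proof. rewrite dotpDl dotpNl !dotpDr (dotpC v u); ring. Qed.

(* Penalized time-to-go along the reference curve [Y], which reaches its goal at
   time [tau]. The weight [expR (l * (tau - s))] decays along [Y] fast enough to
   absorb the growth, at rate at most [l], of the squared distance between [x]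
   and [Y s]; the cost therefore decreases without any continuity of a value
   function. *)
Definition tube_cost (b l tau : R) (Y : R -> 'rV[R]_n) (x : 'rV[R]_n) (s : R) : R :=
  (tau - s) + b * expR (l * (tau - s)) * dotp (x - Y s) (x - Y s).

Lemma tube_cost_min b l tau Y x (M : R) : 0 <= tau ->
  (forall s t, 0 <= s -> s <= t -> t <= tau -> `|Y t - Y s| <= M * (t - s)) ->
  exists2 s, 0 <= s <= tau & forall t, 0 <= t <= tau ->
    tube_cost b l tau Y x s <= tube_cost b l tau Y x t.
Proof.
move=> tau0 YM; pose h s := Y (clip 0 tau s).
have M0 : 0 <= `|M| by [].
have cl s : 0 <= clip 0 tau s <= tau by exact: clip_itv.
have hM s t : `|h s - h t| <= `|M| * `|s - t|.
  have key u v : 0 <= u <= tau -> 0 <= v <= tau -> `|Y u - Y v| <= `|M| * `|u - v|.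
    move=> /andP[u0 u1] /andP[v0 v1].
    have gen a b' : 0 <= a -> a <= b' -> b' <= tau -> `|Y b' - Y a| <= `|M| * `|b' - a|.
      move=> a0 ab bt; rewrite (le_trans (YM _ _ a0 ab bt))//.
      by rewrite [X in _ <= _ * X]ger0_norm ?subr_ge0// ler_wpM2r ?subr_ge0// ler_norm.
    have [uv|vu] := leP u v; last exact: gen (ltW vu) u1.
    by rewrite distrC [`|u - v|]distrC; exact: gen.
  apply: (le_trans (key _ _ (cl s) (cl t))); rewrite ler_wpM2l//; exact: clip_lip.
pose B := `|h 0| + `|M| * tau.
have hB s : `|h s| <= B.
  have -> : h s = h (clip 0 tau s) by rewrite /h (clip_id (cl s)).
  rewrite -(subrK (h 0) (h _)) (le_trans (ler_normD _ _))// [leRHS]addrC lerD2r.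
  apply: (le_trans (hM _ _)); rewrite ler_wpM2l// subr0.
  by have /andP[h1 h2] := cl s; rewrite ger0_norm.
have hc i : continuous (fun s => h s ord0 i).
  apply: (@lipschitz_continuous _ _ _ `|M|) => s t.
  have := le_trans (coord_norm_le (h s - h t) i) (hM s t).
  by rewrite !mxE.
have cdot : continuous (fun s => dotp (x - h s) (x - h s)).
  apply: (@lipschitz_continuous _ _ _ (n%:R * `|M| * (2 * (`|x| + B)))) => s t.
  have -> : dotp (x - h s) (x - h s) - dotp (x - h t) (x - h t) =
      dotp (h t - h s) ((x - h s) + (x - h t)).
    have -> : h t - h s = (x - h s) - (x - h t).
      by apply/rowP => i; rewrite !mxE; ring.
    set u := x - h s; set v := x - h t.
    by rewrite dotp_sqrB.
  rewrite (le_trans (norm_dotp_le _ _))//.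
  rewrite (_ : n%:R * `|M| * (2 * (`|x| + B)) * `|s - t| =
     n%:R * (`|M| * `|t - s|) * (2 * (`|x| + B))); last by rewrite distrC; ring.
  apply: ler_pM => //; first by rewrite ler_wpM2l.
  apply: (le_trans (ler_normD _ _)).
  have := ler_normB x (h s); have := ler_normB x (h t); have := hB s; have := hB t.
  lra.
pose v s := (tau - s) + b * expR (l * (tau - s)) * dotp (x - h s) (x - h s).
have cts : continuous (fun s : R => tau - s).
  apply: (@lipschitz_continuous _ _ _ 1) => s t; rewrite mul1r.
  by rewrite opprD addrACA subrr add0r opprK addrC distrC.
have cv : continuous v.
  move=> s; apply: cvgD; first exact: cts.
  apply: cvgM; last exact: cdot.
  apply: cvgM; first exact: cvg_cst.
  apply: (@continuous_comp _ _ _ (fun s => l * (tau - s)) expR); last exact: continuous_expR.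
  by apply: cvgM; [exact: cvg_cst|exact: cts].
have [c cP H] := EVT_min tau0 (continuous_subspaceT (A := `[0, tau]%classic) cv).
have vE t : 0 <= t <= tau -> v t = tube_cost b l tau Y x t.
  by move=> tt; rewrite /v /tube_cost /h clip_id.
exists c; first by move: cP; rewrite in_itv/=.
move=> t tt; rewrite -!vE//.
by apply: H; rewrite in_itv/=.
Qed.

End tube_function.

Section scale.
Context {R : realType} {n m : nat}.
Variables (f : 'I_m -> 'rV[R]_n -> 'rV[R]_n) (T : set 'rV[R]_n).
Hypothesis T0 : T !=set0.
Hypothesis T_closed : closed T.
Hypothesis T_boundary : compact (boundary T).
Hypothesis loc_lip : forall B : R, exists L M,
  [/\ 0 <= L, 0 <= M & lipschitz_bounded f B L M].

(** The net consists of points of [A] itself, not of its closure, because reference curves are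
    available only from such points. *)
Lemma finite_net (A : set 'rV[R]_n) (B e : R) : 0 < e ->
  (forall x, A x -> `|x| <= B) ->
  exists L : seq 'rV[R]_n, (forall y, y \in L -> A y) /\
    forall x, A x -> exists2 y, y \in L & `|x - y| < e.
Proof.
move=> e0 AB.
have near x d : 0 < d -> closure A x -> exists2 y, A y & `|x - y| < d.
  move=> d0 /(_ _ (nbhsx_ballx x d d0))[y [Ay]].
  by rewrite -ball_normE /ball_/= => xy; exists y.
have cA : compact (closure A).
  apply: bounded_closed_compact; last exact: closed_closure.
  exists (B + 1); split; first exact: num_real.
  move=> K BK x /(near x 1 ltr01)[y /AB yB xy]; apply: le_trans (ltW BK).
  by rewrite -(subrK y x) (le_trans (ler_normD _ _))// addrC lerD// ltW.
rewrite compact_cover in cA.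
have [|x Ax|D' D'A AD'] := cA _ A (fun y => ball y e).
- by move=> y _; exact: ball_open.
- have [y Ay xy] := near x e e0 Ax.
  by exists y => //; rewrite -ball_normE /ball_/= distrC.
exists (finmap.enum_fset D'); split; first by move=> y yD; apply/set_mem/D'A.
move=> x Ax; have [y yD] := AD' x (subset_closure Ax).
by rewrite -ball_normE /ball_/= distrC => xy; exists y.
Qed.

Lemma sub_dotp_expand (p u v : 'rV[R]_n) :
  dotp (p + u - v) (p + u - v) =
  dotp p p + 2 * (dotp p u - dotp p v) + dotp (u - v) (u - v).
Proof.
rewrite -[p + u - v]addrA -dotpBr; move: (u - v) => w.
rewrite dotpDl !dotpDr (dotpC w p); ring.
Qed.

(** The bound [delta <= W x] yields the nonnegativity of [W] that converts decrease into a time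
    bound. The decrease is required of every solution with the held control, up to a time that does
    not depend on [x], so that it applies to arbitrary sampling steps. *)
Definition decreasing_feedback (W : 'rV[R]_n -> R) (kappa : 'rV[R]_n -> 'I_m * bool)
    (c delta r : R) : Prop :=
  forall x, ~ T x -> W x <= c -> 2 * r < rdist T x ->
    delta <= W x /\ forall S alpha z, is_solution f alpha x S z ->
      (forall s : R, 0 <= s -> (s%:E < S)%E -> alpha s = ctrl (kappa x)) ->
      forall t : R, 0 <= t -> t <= delta -> (t%:E < S)%E -> W (z t) <= W x - t / 2.

(* [W] is the least cost over finitely many tubes, issued from a net of starting
   points; the bound [W z <= W x - t / 2] compares [z t] with the same tube at the
   time shifted by [t]. *)
Lemma scale_feedback (i0 : 'I_m) (rho r C tmax : R) : 0 < r -> r < rho ->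
  (forall x, ~ T x -> rdist T x <= rho -> steerable f T x C r tmax) ->
  exists (W : 'rV[R]_n -> R) (kappa : 'rV[R]_n -> 'I_m * bool) (c delta : R),
    [/\ 0 < delta, 0 <= c,
        forall x, ~ T x -> rdist T x <= rho -> W x <= c,
        forall x, W x <= c -> rdist T x <= C + rho &
        decreasing_feedback W kappa c delta r].
Proof.
move=> r0 rrho steer.
pose D := [set x | ~ T x /\ rdist T x <= rho].
have [D0|/set0P[x0 Dx0]] := eqVneq D set0.
  (* Without starting points, the value 1 above the threshold 0 makes the sublevel set empty. *)
  exists (fun=> 1), (fun=> (i0, true)), 0, 1; split=> //.
  - by move=> x nTx xrho; have : D x by []; rewrite D0.
  - by move=> x; rewrite ler10.
  - by move=> x _; rewrite ler10.
have rho0 : 0 < rho := lt_trans r0 rrho.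
have tmax0 : 0 <= tmax.
  have [S [al [y [tau [_ _ [h1 h2 _] _ _]]]]] := steer _ Dx0.1 Dx0.2.
  exact: le_trans h2.
have [B0 B00 B0P] := rdist_bounded T0 T_closed T_boundary C.
have [Bd _ BdP] := rdist_bounded T0 T_closed T_boundary rho.
(* One unit for the distance from [x] to the reference curve, one for the motion during a step. *)
have [L [M0 [L0 M00 LM0]]] := loc_lip (B0 + 1 + 1).
pose M := M0 + 1.
have M_gt0 : 0 < M by rewrite ltr_wpDl.
have LM : lipschitz_bounded f (B0 + 1 + 1) L M.
  by case: LM0 => h1 h2; split => // i x /h2/le_trans; apply; rewrite lerDl.
pose N : R := n%:R.
have N0 : 0 <= N by rewrite ler0n.
(* The factor 2 comes from squaring the distance, [N] from bounding scalar products by max norms. *)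
pose lam := 2 * (N * L).
have lam0 : 0 <= lam by rewrite !mulr_ge0.
(* The time-to-go is at most [tmax]; 1 bounds the penalty of a point with respect to a nearby net
   point. *)
pose c := tmax + 1.
have c0 : 0 < c by rewrite ltr_wpDl.
(* The tube radius: a displacement by [eta] changes the distance to [T] by at most [r / 2]. *)
pose eta := Num.min 1 (r / (2 * (N + 1))).
have N10 : 0 < 2 * (N + 1) by rewrite mulr_gt0// ltr_wpDl.
have eta0 : 0 < eta by rewrite lt_min ltr01 divr_gt0.
have eta1 : eta <= 1 by rewrite ge_min lexx.
have Neta : N * eta <= r / 2.
  have : eta <= r / (2 * (N + 1)) by rewrite ge_min lexx orbT.
  by rewrite ler_pdivlMr//; lra.
(* So heavy a penalty that [W x <= c] keeps [x] within [eta] of the minimizing point of the tube. *)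
pose b := c / eta ^+ 2.
have b0 : 0 < b by rewrite divr_gt0// exprn_gt0.
pose E := expR (lam * tmax).
have E0 : 0 < E by exact: expR_gt0.
(* Second-order errors: the first term from freezing the two velocities, the second from the square
   of the relative displacement. *)
pose K := 4 * N * (L * M) + 4 * N * M ^+ 2.
have K0 : 0 <= K by rewrite addr_ge0// !mulr_ge0// ?exprn_ge0// ltW.
(* Fine enough that the penalty at time 0 with respect to a nearby net point is at most 1, [E]
   bounding the exponential weight. *)
pose eps := Num.min 1 (1 / (b * E * N + 1)).
have bEN : 0 < b * E * N + 1.
  by apply: ltr_wpDl => //; rewrite mulr_ge0// mulr_ge0//; exact: ltW.
have eps0 : 0 < eps by rewrite lt_min ltr01 divr_gt0.
have eps1 : eps <= 1 by rewrite ge_min lexx.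
have epsb : b * E * (N * eps ^+ 2) <= 1.
  have h : eps <= 1 / (b * E * N + 1) by rewrite ge_min lexx orbT.
  have h2 : eps ^+ 2 <= eps by rewrite expr2 ler_piMl// ltW.
  apply: (@le_trans _ _ (b * E * N * eps)).
    rewrite -[leRHS]mulrA; apply: ler_wpM2l; first by apply: mulr_ge0; exact: ltW.
    exact: ler_wpM2l.
  by move: h; rewrite ler_pdivlMr//; have := ltW eps0; lra.
have [|Ls [LsD Lsnet]] := @finite_net D Bd eps eps0.
  by move=> x [h1 h2]; exact: BdP.
have Ls0 : Ls != [::].
  by have [y] := Lsnet _ Dx0; case: (Ls).
pose good (x : 'rV[R]_n) (Yt : (R -> 'rV[R]_n) * R) := exists (S : \bar R) alpha,
  [/\ is_solution f alpha x S Yt.1,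
      forall s : R, 0 <= s -> (s%:E < S)%E -> control_set (alpha s),
      [/\ 0 <= Yt.2, Yt.2 <= tmax & (Yt.2%:E < S)%E],
      forall s, 0 <= s <= Yt.2 -> ~ T (Yt.1 s) /\ rdist T (Yt.1 s) <= C &
      rdist T (Yt.1 Yt.2) <= r].
have [Yt YtP] : {Yt : 'rV[R]_n -> (R -> 'rV[R]_n) * R & forall x, D x -> good x (Yt x)}.
  apply: (@choice _ _ (fun x Yt => D x -> good x Yt)) => x.
  have [[nTx xrho]|] := pselect (D x); last first.
    by exists (fun=> 0, 0).
  have [S [al [y [tau H]]]] := steer x nTx xrho.
  by exists (y, tau) => _; exists S, al.
have YB x s : D x -> 0 <= s <= (Yt x).2 -> `|(Yt x).1 s| <= B0.
  by move=> /YtP[S [al [_ _ _ H _]]] /H[h1 h2]; exact: B0P.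
have B0B : B0 <= B0 + 1 + 1 by rewrite -addrA lerDl.
have Ylip x s t : D x -> 0 <= s -> s <= t -> t <= (Yt x).2 ->
    `|(Yt x).1 t - (Yt x).1 s| <= M * (t - s).
  move=> Dx s0 st tt; have [S [al [sol ctl [h1 h2 h3] H _]]] := YtP x Dx.
  apply: (solution_lip sol ctl LM) => //; first by apply: le_lt_trans h3; rewrite lee_fin.
  move=> q /andP[sq qt]; apply: le_trans B0B; apply: YB => //.
  by rewrite (le_trans s0 sq) (le_trans qt).
pose cost i x s := tube_cost b lam (Yt i).2 (Yt i).1 x s.
have [arg argP] : {arg : 'rV[R]_n -> 'rV[R]_n * R & forall x,
    [/\ (arg x).1 \in Ls, 0 <= (arg x).2 <= (Yt (arg x).1).2 &
      forall i s, i \in Ls -> 0 <= s <= (Yt i).2 ->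
        cost (arg x).1 x (arg x).2 <= cost i x s]}.
  apply: (@choice _ _ (fun x a => [/\ a.1 \in Ls, 0 <= a.2 <= (Yt a.1).2 &
      forall i s, i \in Ls -> 0 <= s <= (Yt i).2 -> cost a.1 x a.2 <= cost i x s])) => x.
  have [sm smP] : {sm : 'rV[R]_n -> R & forall i, i \in Ls ->
      0 <= sm i <= (Yt i).2 /\ forall s, 0 <= s <= (Yt i).2 -> cost i x (sm i) <= cost i x s}.
    apply: (@choice _ _ (fun i t => i \in Ls -> 0 <= t <= (Yt i).2 /\
        forall s, 0 <= s <= (Yt i).2 -> cost i x t <= cost i x s)) => i.
    have [iL|] := boolP (i \in Ls); last by exists 0.
    have Di := LsD i iL.
    have [S [al [_ _ [t0 _ _] _ _]]] := YtP i Di.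
    have [s s1 s2] := tube_cost_min b lam x t0 (fun s t => @Ylip i s t Di).
    by exists s.
  have [i iL iP] := exists_min_seq (fun i => cost i x (sm i)) Ls0.
  exists (i, sm i); split => //; first by have [] := smP i iL.
  by move=> j s jL sj; apply: (le_trans (iP j jL)); apply: (smP j jL).2.
pose W x := cost (arg x).1 x (arg x).2.
pose Y x s := (Yt (arg x).1).1 s.
pose tau x := (Yt (arg x).1).2.
pose sx x := (arg x).2.
have tauT x : tau x <= tmax.
  by have [aL _ _] := argP x; have [S [al [_ _ [_ ? _] _ _]]] := YtP _ (LsD _ aL).
have sxP x : 0 <= sx x <= tau x by have [] := argP x.
have WE x : W x = (tau x - sx x) +
    b * expR (lam * (tau x - sx x)) * dotp (x - Y x (sx x)) (x - Y x (sx x)) by [].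
have Wge x : tau x - sx x <= W x.
  rewrite WE lerDl; apply: mulr_ge0; last exact: dotp_ge0.
  by apply: mulr_ge0; [exact: ltW|exact: expR_ge0].
have Wnear x : W x <= c -> `|x - Y x (sx x)| <= eta.
  move=> Wc; have /andP[s0 st] := sxP x.
  have h0 : 0 <= lam * (tau x - sx x) by rewrite mulr_ge0// subr_ge0.
  rewrite -ler_sqr ?nnegrE//; last exact: ltW.
  apply: (le_trans (norm_sqr_le_dotp _)).
  rewrite -(ler_pM2l b0) {2}/b divfK ?gt_eqF ?exprn_gt0//.
  apply: le_trans Wc; rewrite WE.
  apply: (@le_trans _ _ (b * expR (lam * (tau x - sx x)) *
     dotp (x - Y x (sx x)) (x - Y x (sx x)))); last by rewrite lerDr subr_ge0.
  rewrite ler_wpM2r ?dotp_ge0// ler_pMr// -expR0 ler_expR.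
  exact: h0.
have DY x : D (arg x).1 by have [/LsD] := argP x.
(* Minimizing over all controls brings [x] towards [Y x (sx x)] at least as fast as
   the control of the reference curve would, up to the Lipschitz error. *)
have ctlmin x : exists k : 'I_m * bool, forall k',
    dotp (x - Y x (sx x)) (dynamics f x (ctrl k)) <=
    dotp (x - Y x (sx x)) (dynamics f x (ctrl k')).
  have [|k _ kP] := @exists_min_seq R _ (enum {: 'I_m * bool})
    (fun k => dotp (x - Y x (sx x)) (dynamics f x (ctrl k))).
    by have : (i0, true) \in enum {: 'I_m * bool}; [rewrite mem_enum|case: (enum _)].
  by exists k => k'; apply: kP; rewrite mem_enum.
have [kappa kappaP] := choice ctlmin.
(* If [x] is farther than [2 * r] from [T], its reference point is farther than 3r / 2, while the
   end of the curve is within [r]; at speed [M] this takes longer than [th0]. *)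
pose th0 := r / (2 * (N * M + 1)).
have NM0 : 0 < 2 * (N * M + 1) by rewrite mulr_gt0// ltr_wpDl// mulr_ge0// ltW.
have th00 : 0 < th0 by rewrite divr_gt0.
pose bEK := b * E * K.
have bEK0 : 0 <= bEK by apply: mulr_ge0 => //; apply: mulr_ge0; exact: ltW.
have bEK1 : 0 < 2 * (bEK + 1) by rewrite mulr_gt0// ltr_wpDl.
(* The three bounds keep the shifted time on the reference curve, make the a priori estimate
   applicable, and let the second-order errors consume at most half of the unit decrease. *)
pose delta := Num.min th0 (Num.min (1 / (2 * M)) (1 / (2 * (bEK + 1)))).
have delta0 : 0 < delta by rewrite !lt_min th00 !divr_gt0// mulr_gt0.
have dth : delta <= th0 by rewrite ge_min lexx.
have dM : M * delta < 1.
  have : delta <= 1 / (2 * M) by rewrite /delta !ge_min lexx !orbT.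
  by rewrite ler_pdivlMr ?mulr_gt0// => dM; clear -dM; lra.
have dK : bEK * delta <= 2^-1.
  have : delta <= 1 / (2 * (bEK + 1)) by rewrite /delta !ge_min lexx !orbT.
  by rewrite ler_pdivlMr// => dK; clear -dK delta0; lra.
exists W, kappa, c, delta; split => //; first exact: ltW.
- move=> x nTx xrho; have [//|i iL xi] := Lsnet x; have Di := LsD i iL.
  have [S [al [sol _ [t0 tt _] _ _]]] := YtP i Di.
  have [_ Yi0 _ _] := sol.
  have [_ _ H] := argP x.
  apply: (le_trans (H i 0 iL _)); first by rewrite lexx.
  rewrite /cost /tube_cost subr0 Yi0 lerD//.
  apply: le_trans epsb; apply: ler_pM; rewrite ?dotp_ge0//.
  + by rewrite mulr_ge0 ?expR_ge0// ltW.
  + by rewrite ler_pM2l// ler_expR ler_wpM2l.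
  + apply: (le_trans (dotp_le _)); rewrite ler_wpM2l// ler_sqr ?nnegrE//; exact: ltW.
- move=> x Wc; have h := Wnear x Wc.
  have [S [al [_ _ _ H _]]] := YtP _ (DY x).
  have [_ h2] := H _ (sxP x).
  apply: (le_trans (rdist_lip T0 x (Y x (sx x)))); apply: lerD => //.
  apply: (@le_trans _ _ (N * eta)); first by rewrite ler_wpM2l.
  by clear -Neta r0 rrho; lra.
- move=> x nTx Wc xr; have h := Wnear x Wc.
  have [S [al [sol ctl [t0 tt tS] H Hend]]] := YtP _ (DY x).
  have /andP[s0 st] := sxP x.
  have th : th0 < tau x - sx x.
    have h1 := rdist_lip T0 x (Y x (sx x)).
    have h2 := rdist_lip T0 (Y x (sx x)) (Y x (tau x)).
    have h3 := Ylip _ _ _ (DY x) s0 st (lexx _).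
    have h4 : N * `|x - Y x (sx x)| <= N * eta by rewrite ler_wpM2l.
    have h5 : N * `|Y x (sx x) - Y x (tau x)| <= N * (M * (tau x - sx x)).
      by rewrite ler_wpM2l// distrC.
    have h6 : rdist T (Y x (tau x)) <= r := Hend.
    have h7 : r / 2 < N * (M * (tau x - sx x)).
      by rewrite -/N in h1 h2; clear -h1 h2 h4 h5 h6 xr Neta r0; lra.
    rewrite /th0 ltr_pdivrMr//; clear -h7 st; rewrite -/(tau x) -/(sx x) in st; lra.
  split; first by apply: (le_trans dth); apply: (le_trans (ltW th)); exact: Wge.
  move=> S' alpha z solz az t tge0 td tS'.
  have z0 : z 0 = x by case: solz.
  have ctlz s : 0 <= s -> (s%:E < S')%E -> control_set (alpha s).
    by move=> sge sS; rewrite az//; exact: ctrl_control.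
  have Mt : M * t < 1 by apply: le_lt_trans dM; rewrite ler_pM2l.
  set p := x - Y x (sx x) in h *.
  have p1 : `|p| <= 1 := le_trans h eta1.
  have yB0 : `|Y x (sx x)| <= B0 by apply: YB; [exact: DY|exact: sxP].
  have xB : `|x| <= B0 + 1.
    by rewrite -(subrK (Y x (sx x)) x) (le_trans (ler_normD _ _))// addrC lerD.
  have zap := solution_apriori solz ctlz LM xB tge0 tS' Mt.
  have stt : sx x + t <= tau x.
    by have h1 := le_trans td dth; clear -th h1; lra.
  have stS : ((sx x + t)%:E < S)%E by apply: le_lt_trans tS; rewrite lee_fin.
  have sle : sx x <= sx x + t by rewrite lerDl.
  pose v1 := z t - x; pose v2 := Y x (sx x + t) - Y x (sx x).
  have v1M : `|v1| <= M * t by have [] := zap t; rewrite ?tge0 ?lexx.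
  have v2M : `|v2| <= M * t.
    have := Ylip _ _ _ (DY x) s0 sle stt; rewrite (_ : sx x + t - sx x = t)//; ring.
  pose g := dotp p (dynamics f x (ctrl (kappa x))).
  pose P := dotp p p.
  have P0 : 0 <= P := dotp_ge0 p.
  have M_ge0 := ltW M_gt0.
  have NpLM : N * `|p| * (L * M) * t ^+ 2 <= N * (L * M) * t ^+ 2.
    apply: ler_wpM2r; first exact: sqr_ge0.
    apply: ler_wpM2r; first exact: mulr_ge0.
    exact: ler_piMr.
  have d1 : dotp p v1 <= g * t + N * (L * M) * t ^+ 2.
    have := @solution_direction _ _ _ _ _ _ _ _ solz ctlz _ _ _ 0 t
      (- g) (- p) LM L0 M_ge0 (lexx _) tge0 tS'.
    rewrite z0 subr0 normrN dotpNl -/N -/v1 => /(_ _ _) H1.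
    have {}H1 : - g * t - N * `|p| * (L * M) * t ^+ 2 <= - dotp p v1.
      apply: H1 => [s /zap[]//|s sgt slt].
      rewrite dotpNl lerN2 az//; first exact: ltW.
      by apply: lt_trans tS'; rewrite lte_fin.
    by clear -H1 NpLM; lra.
  (* Replacing the reference control at [Y x (sx x)] by the minimizing control at [x] costs
     [N * L * P], the error that [lam] absorbs. *)
  have d2 : (g - N * L * P) * t - N * (L * M) * t ^+ 2 <= dotp p v2.
    have := @solution_direction _ _ _ _ _ _ _ _ sol ctl _ _ _ (sx x) (sx x + t)
      (g - N * L * P) p LM L0 M_ge0 s0 sle stS.
    rewrite (_ : sx x + t - sx x = t); last by rewrite addrC addKr.
    move=> H2; apply: (le_trans _ (H2 _ _)).
    - by rewrite lerD2l lerN2.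
    - move=> s /andP[sa sb]; apply: le_trans B0B; apply: YB; first exact: DY.
      by rewrite (le_trans s0 sa) (le_trans sb).
    - move=> s sa sb; have sS : (s%:E < S)%E by apply: lt_trans stS; rewrite lte_fin.
      have cs := ctl s (le_trans s0 (ltW sa)) sS.
      have [k ak] := control_setP cs.
      have h1 := kappaP x k; rewrite -/p -/g -ak in h1.
      have xB2 : `|x| <= B0 + 1 + 1 by rewrite (le_trans xB)// lerDl.
      have h2 := control_dynamics_lip LM cs xB2 (le_trans yB0 B0B).
      have h3 := norm_dotp_le p (dynamics f x (al s) - dynamics f (Y x (sx x)) (al s)).
      have h4 : N * `|p| * `|dynamics f x (al s) - dynamics f (Y x (sx x)) (al s)| <= N * L * P.
        apply: (@le_trans _ _ (N * `|p| * (L * `|p|))).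
          by apply: ler_wpM2l => //; exact: mulr_ge0.
        rewrite (_ : N * `|p| * (L * `|p|) = N * L * `|p| ^+ 2); last by ring.
        by apply: ler_wpM2l; [exact: mulr_ge0|exact: norm_sqr_le_dotp].
      have h5 := le_trans (ler_norm _) h3; rewrite dotpBr -/N in h5.
      by clear -h1 h4 h5; lra.
  have Wz : W (z t) <= tube_cost b lam (tau x) (Y x) (z t) (sx x + t).
    have [aL _ _] := argP x; have [_ _ H3] := argP (z t).
    by apply: H3 => //; rewrite (le_trans s0 sle).
  apply: (le_trans Wz); rewrite /tube_cost.
  have qE : z t - Y x (sx x + t) = p + v1 - v2.
    by rewrite /p /v1 /v2; apply/rowP => i; rewrite !mxE; ring.
  rewrite qE sub_dotp_expand -/P.
  have vv : dotp (v1 - v2) (v1 - v2) <= 4 * N * M ^+ 2 * t ^+ 2.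
    apply: (le_trans (dotp_le _)).
    have : `|v1 - v2| <= 2 * (M * t) by rewrite (le_trans (ler_normB _ _))//; clear -v1M v2M; lra.
    move=> hv; rewrite -/N (_ : 4 * N * M ^+ 2 * t ^+ 2 = N * (2 * (M * t)) ^+ 2); last by ring.
    by rewrite ler_wpM2l// ler_sqr ?nnegrE ?mulr_ge0.
  (* The rate [g], about whose sign nothing is known, cancels between [d1] and [d2]. *)
  have Q : P + 2 * (dotp p v1 - dotp p v2) + dotp (v1 - v2) (v1 - v2) <=
      (1 + lam * t) * P + K * t ^+ 2.
    have -> : (1 + lam * t) * P + K * t ^+ 2 =
      P + 2 * ((g * t + N * (L * M) * t ^+ 2) - ((g - N * L * P) * t - N * (L * M) * t ^+ 2))
        + 4 * N * M ^+ 2 * t ^+ 2 by rewrite /lam /K; ring.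
    by clear -d1 d2 vv; lra.
  set q := P + _ + _ in Q *.
  have thS : lam * (tau x - (sx x + t)) = lam * (tau x - sx x) + - (lam * t) by ring.
  rewrite thS expRD.
  set e1 := expR (lam * (tau x - sx x)).
  have e1E : e1 <= E.
    by rewrite ler_expR ler_wpM2l// (le_trans _ (tauT x))// gerBl.
  have e10 : 0 < e1 by exact: expR_gt0.
  have lt0 : 0 <= lam * t by rewrite mulr_ge0.
  have em1 : expR (- (lam * t)) <= 1 by rewrite -expR0 ler_expR oppr_le0.
  have em0 : 0 < expR (- (lam * t)) by exact: expR_gt0.
  (* The decay of the weight compensates the growth factor, by e^x >= 1 + x. *)
  have eml : expR (- (lam * t)) * (1 + lam * t) <= 1.
    rewrite expRN mulrC ler_pdivrMr ?expR_gt0// mul1r; exact: expR_ge1Dx.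
  have key : expR (- (lam * t)) * q <= P + K * t ^+ 2.
    apply: (@le_trans _ _ (expR (- (lam * t)) * ((1 + lam * t) * P + K * t ^+ 2))).
      by rewrite ler_pM2l.
    rewrite mulrDr lerD//; first by rewrite mulrA ler_piMl.
    by rewrite ler_piMl// mulr_ge0// sqr_ge0.
  have key2 : b * e1 * (expR (- (lam * t)) * q) <= b * e1 * P + bEK * t ^+ 2.
    apply: (@le_trans _ _ (b * e1 * (P + K * t ^+ 2))).
      by rewrite ler_pM2l// mulr_gt0.
    rewrite mulrDr lerD2l /bEK mulrA ler_wpM2r ?sqr_ge0//.
    by rewrite ler_wpM2r// ler_pM2l.
  have key3 : bEK * t ^+ 2 <= t / 2.
    rewrite expr2 mulrA [leRHS]mulrC ler_wpM2r//.
    by apply: le_trans dK; rewrite ler_wpM2l.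
  have WxE : W x = tau x - sx x + b * e1 * P := WE x.
  by rewrite WxE -mulrA; clear -key2 key3; lra.
Qed.
End scale.

(** * Gluing the feedbacks over all scales *)

Section comparison_functions.
Context {R : realType}.

Lemma Kinfty_continuousP (g : R -> R) : {within `[0, +oo[, continuous g} <->
  forall s, 0 <= s -> forall e, 0 < e -> exists2 d, 0 < d &
    forall t, 0 <= t -> `|t - s| < d -> `|g t - g s| < e.
Proof.
split.
- move=> /subspace_continuousP H s s0 e e0.
  have := H s; rewrite /= in_itv/= s0 => /(_ isT)/cvgrPdist_lt/(_ _ e0).
  move=> /nbhs_ballP[d /= d0 dP]; exists d => // t t0 ts.
  have := dP t; rewrite /ball/= distrC => /(_ ts); rewrite in_itv/= t0 => /(_ isT).
  by rewrite distrC.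
- move=> H; apply/subspace_continuousP => s; rewrite /= in_itv/= andbT => s0.
  apply/cvgrPdist_lt => e e0; have [d d0 dP] := H s s0 e e0.
  apply/nbhs_ballP; exists d => //= t; rewrite /ball/= distrC => ts.
  by rewrite in_itv/= andbT distrC => t0; exact: dP.
Qed.

Lemma Kinfty_ge0 (g : R -> R) : class_Kinfty g -> forall s, 0 <= s -> 0 <= g s.
Proof.
move=> [_ gm g0 _] s; rewrite le_eqVlt => /orP[/eqP<-|s0]; first by rewrite g0.
by rewrite -g0 ltW// gm.
Qed.

Lemma Kinfty_le (g : R -> R) : class_Kinfty g -> forall s t, 0 <= s -> s <= t -> g s <= g t.
Proof.
move=> [_ gm _ _] s t s0; rewrite le_eqVlt => /orP[/eqP->//|st]; exact/ltW/gm.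
Qed.

Lemma Kinfty_comp (g h : R -> R) : class_Kinfty g -> class_Kinfty h -> class_Kinfty (g \o h).
Proof.
move=> Kg Kh; have h_ge0 := Kinfty_ge0 Kh.
case: Kg Kh => [/Kinfty_continuousP gc gm g0 gu] [/Kinfty_continuousP hc hm h0 hu]; split.
- apply/Kinfty_continuousP => s s0 e e0.
  have [d d0 dP] := gc (h s) (h_ge0 s s0) e e0.
  have [d' d'0 d'P] := hc s s0 d d0.
  by exists d' => // t t0 ts; apply: dP; [exact: h_ge0|exact: d'P].
- by move=> s t s0 st; apply: gm; [exact: h_ge0|exact: hm].
- by rewrite /= h0.
- move=> M; have [a a0 Ma] := gu M; have [b b0 ab] := hu a.
  by exists b => //; apply: (lt_trans Ma); exact: gm.
Qed.

Lemma Kinfty_double (g : R -> R) : class_Kinfty g -> class_Kinfty (fun s => 2 * g s + 2 * s).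
Proof.
move=> Kg; have g_ge0 := Kinfty_ge0 Kg.
case: Kg => [/Kinfty_continuousP gc gm g0 gu]; split.
- apply/Kinfty_continuousP => s s0 e e0.
  have e4 : 0 < e / 4 by rewrite divr_gt0.
  have [d d0 dP] := gc s s0 _ e4.
  exists (Num.min d (e / 4)); first by rewrite lt_min d0.
  move=> t t0; rewrite lt_min => /andP[/(dP t t0) h1 h2].
  have := ler_normD (2 * (g t - g s)) (2 * (t - s)).
  rewrite !normrM ger0_norm// (_ : 2 * (g t - g s) + 2 * (t - s) = 2 * g t + 2 * t - (2 * g s + 2 * s)); last by ring.
  by lra.
- by move=> s t s0 st; have := gm s t s0 st; lra.
- by rewrite g0; lra.
- move=> M; have [a a0 Ma] := gu M; exists a => //.
  by have := g_ge0 a a0; lra.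
Qed.

Lemma Kinfty_onto (g : R -> R) : class_Kinfty g -> forall v, 0 < v -> exists2 s, 0 < s & g s = v.
Proof.
move=> [gc gm g0 gu] v v0; have [b b0 vb] := gu v.
have gcb : {within `[0, b], continuous g}.
  by apply: continuous_subspaceW gc => x /=; rewrite !in_itv/= andbT; case/andP.
have vmm : Num.min (g 0) (g b) <= v <= Num.max (g 0) (g b).
  by rewrite g0 ge_min le_max (ltW v0) (ltW vb) orbT.
have [c] := IVT b0 gcb vmm.
rewrite in_itv/= => /andP[c0 _] gcv; exists c => //.
rewrite lt_def c0 andbT; apply/eqP => c00; move: gcv; rewrite c00 g0 => v00.
by move: v0; rewrite -v00 ltxx.
Qed.

(** A two-sided orbit of [h]: negative indices use preimages, which exist by the intermediate value
    theorem. The value 1 at index 0 allows comparison with powers of 2. *)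
Lemma scales_exist (h : R -> R) : class_Kinfty h ->
  exists r_ : int -> R, r_ 0 = 1 /\ forall l, 0 < r_ l /\ r_ (l + 1) = h (r_ l).
Proof.
move=> Kh; have onto v : exists s, 0 < v -> 0 < s /\ h s = v.
  have [v0|] := pselect (0 < v); last by exists 0.
  by have [s s0 sv] := Kinfty_onto Kh v0; exists s.
have [g gP] := choice onto.
have hpos v : 0 < v -> 0 < h v by case: Kh => _ hm h0 _ v0; rewrite -h0 hm.
pose up k := iter k h 1; pose down k := iter k g 1.
have up0 k : 0 < up k by elim: k => [|k IH] /=; [exact: ltr01|exact: hpos].
have down0 k : 0 < down k by elim: k => [|k IH] /=; [exact: ltr01|exact: (gP _ IH).1].
exists (fun l => match l with Posz k => up k | Negz k => down k.+1 end); split=> // l.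
split; first by case: l => k.
case: l => [k|[|k]].
- by rewrite -PoszD addn1.
- by rewrite (_ : Negz 0 + 1 = 0%:Z)//= (gP 1 ltr01).2.
- rewrite (_ : Negz k.+1 + 1 = Negz k)/=; first by rewrite (gP _ (down0 k.+1)).2.
  by rewrite !NegzE; lia.
Qed.

End comparison_functions.

(** * Holding one control during a sampling step *)

Section constant_control.
Context {R : realType} {n m : nat}.
Variable f : 'I_m -> 'rV[R]_n -> 'rV[R]_n.
Hypothesis loc_lip : forall B : R, exists L M,
  [/\ 0 <= L, 0 <= M & lipschitz_bounded f B L M].

(** Up to time [t] the solution is bounded, so if it ended there it could be extended, against
    maximality. As the control is constant, the equation holds at every interior time, so a glued
    trajectory can violate it only at sampling times. *)
Lemma maximal_solution_step (q : 'rV[R]_n) (a : 'rV[R]_m) alpha S z (B L M t : R) :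
  control_set a -> (forall s, alpha s = a) -> is_maximal_solution f alpha q S z ->
  `|q| <= B -> lipschitz_bounded f (B + 1) L M -> 0 <= L -> 0 <= M ->
  0 <= t -> M * t < 1 ->
  [/\ (t%:E < S)%E,
      forall s s', 0 <= s -> s <= s' -> s' <= t -> `|z s' - z s| <= M * (s' - s) &
      forall s, 0 < s -> s < t -> is_derive s (1 : R) z (dynamics f (z s) a)].
Proof.
move=> ca al [sol maxS] qB LM L0 M0 t0 Mt.
have ctl s : 0 <= s -> (s%:E < S)%E -> control_set (alpha s) by rewrite al.
have tS : (t%:E < S)%E.
  rewrite ltNge; apply/negP => St; have [S0 _ _ _] := sol.
  case: S St S0 sol maxS ctl => [s0| |]//.
  rewrite lee_fin lte_fin => st s00 sol maxS ctl.
  have zB s : 0 <= s -> s < s0 -> `|z s| <= B + 1.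
    move=> sge ss; have ssS : (s%:E < s0%:E)%E by rewrite lte_fin.
    have Ms : M * s < 1.
      by apply: le_lt_trans Mt; rewrite ler_wpM2l// (le_trans _ st)// ltW.
    by apply: (solution_apriori sol ctl LM qB sge ssS Ms (s := s) _).1; rewrite sge lexx.
  have al1 s : s0 < s < s0 + 1 -> alpha s = a by move=> _; exact: al.
  have ctl' s : 0 <= s -> s < s0 -> control_set (alpha s) by move=> _ _; rewrite al.
  have [S' [z' [s0S' sol' zz']]] := solution_extension loc_lip ltr01 al1 sol ctl' zB.
  have := maxS S'%:E z' sol'; rewrite lee_fin => /(_ (ltW s0S')) H.
  have : S'%:E = s0%:E by apply: H => s s_ge; rewrite lte_fin; exact: zz'.
  by move=> [S'E]; move: s0S'; rewrite S'E ltxx.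
have zap := solution_apriori sol ctl LM qB t0 tS Mt.
have zlip s s' : 0 <= s -> s <= s' -> s' <= t -> `|z s' - z s| <= M * (s' - s).
  move=> s0 ss st; apply: (solution_lip sol ctl LM) => //.
    by apply: le_lt_trans tS; rewrite lee_fin.
  by move=> r /andP[sr rs]; apply: (zap r _).1; rewrite (le_trans s0)// (le_trans rs).
split => // s s0 st; apply/is_derive_epsP => e e0.
have C0 : 0 < n%:R * (L * M) + 1 by rewrite ltr_wpDl// !mulr_ge0.
exists (Num.min (Num.min s (t - s)) (e / (n%:R * (L * M) + 1))).
  by rewrite !lt_min s0 subr_gt0 st divr_gt0.
move=> k; rewrite !lt_min => /andP[/andP[k1 k2] k3].
have key u v p : 0 <= u -> u <= s <= v -> v <= t -> `|p| <= 1 ->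
    dotp p (dynamics f (z s) a) * (v - u) - n%:R * (L * M) * (v - u) ^+ 2 <= dotp p (z v - z u).
  move=> u0 /andP[us sv] vt p1.
  have -> : dotp p (dynamics f (z s) a) * (v - u) - n%:R * (L * M) * (v - u) ^+ 2 =
    (dotp p (dynamics f (z s) a) - n%:R * (L * M) * (v - u)) * (v - u) by ring.
  apply: (solution_dotp_increment sol) => //; first exact: le_trans sv.
    by apply: le_lt_trans tS; rewrite lee_fin.
  move=> r ur rv; rewrite al.
  have Br : `|z r| <= B + 1 by apply: (zap r _).1; rewrite (le_trans u0 (ltW ur)) (le_trans (ltW rv)).
  have Bs : `|z s| <= B + 1 by apply: (zap s _).1; rewrite !ltW.
  have h1 := control_dynamics_lip LM ca Bs Br.
  have h2 : `|z s - z r| <= M * (v - u).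
    have [rs|sr] := leP r s.
      apply: (le_trans (zlip r s _ rs _)); [by rewrite (le_trans u0)// ltW|exact: ltW|].
      by apply: ler_wpM2l => //; lra.
    rewrite distrC; apply: (le_trans (zlip s r _ (ltW sr) _)); [exact: ltW|exact: le_trans (ltW rv) vt|].
    by apply: ler_wpM2l => //; lra.
  have h3 := le_trans (ler_norm _) (norm_dotp_le p (dynamics f (z s) a - dynamics f (z r) a)).
  rewrite dotpBr in h3.
  suff : n%:R * `|p| * `|dynamics f (z s) a - dynamics f (z r) a| <= n%:R * (L * M) * (v - u) by lra.
  apply: (@le_trans _ _ (n%:R * 1 * (L * (M * (v - u))))).
    apply: ler_pM => //; first by rewrite ler_wpM2l.
    by apply: (le_trans h1); rewrite ler_wpM2l.
  by rewrite le_eqVlt; apply/orP; left; apply/eqP; ring.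
have bnd u v : 0 <= u -> u <= s <= v -> v <= t ->
    `|z v - z u - (v - u) *: dynamics f (z s) a| <= n%:R * (L * M) * (v - u) ^+ 2.
  move=> u0 usv vt; apply: norm_le_coord; first by rewrite mulr_ge0 ?sqr_ge0// !mulr_ge0.
  move=> i; have d1 : `|delta_mx ord0 i : 'rV[R]_n| <= 1.
    by apply: norm_le_coord => // j; rewrite mxE; case: (_ && _); rewrite ?normr1 ?normr0.
  have h1 := key u v _ u0 usv vt d1.
  have := key u v (- delta_mx ord0 i) u0 usv vt; rewrite normrN => /(_ d1).
  rewrite !dotpNl !dotp_deltal => h2; rewrite !dotp_deltal in h1.
  by move: h1 h2; rewrite !mxE ler_norml => h1 h2; apply/andP; split; lra.
have fin : n%:R * (L * M) * `|k| ^+ 2 <= e * `|k|.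
  rewrite expr2 [leLHS]mulrA ler_wpM2r//; move: k3; rewrite ltr_pdivlMr//.
  by have := normr_ge0 k; lra.
apply: le_trans fin.
have [k0|k0] := leP 0 k.
  rewrite ger0_norm// in k1 k2 *.
  have := bnd s (s + k); rewrite (_ : s + k - s = k); last by ring.
  by apply; [exact: ltW|rewrite lexx lerDl|lra].
rewrite ltr0_norm// in k1 k2 *.
have := bnd (s + k) s; rewrite (_ : s - (s + k) = - k); last by ring.
rewrite -normrN (_ : - (z s - z (s + k) - - k *: dynamics f (z s) a) =
  z (s + k) - z s - k *: dynamics f (z s) a); last by apply/rowP => i; rewrite !mxE; ring.
by apply; [lra|rewrite lexx andbT; lra|exact: ltW].
Qed.

Lemma simple_multiflow_control (V : 'rV[R]_n -> label m) (k : 'I_m * bool) x (t s : R) :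
  V x = Label (Letter 1) [:: k.1] k.2 -> multiflow_control V x t s = ctrl k.
Proof.
by rewrite /multiflow_control /oriented_control => ->; rewrite /ctrl; case: k => i [].
Qed.

End constant_control.

(** * Growth of the radii *)

Section scales.
Context {R : realType}.
Variables (r_ : int -> R).
Hypothesis r_gt0 : forall l, 0 < r_ l.
Hypothesis r_double : forall l, 2 * r_ l <= r_ (l + 1).

Lemma scale_lt (l l' : int) : (l < l')%R -> r_ l < r_ l'.
Proof.
move=> ll; have -> : l' = l + (absz (l' - l - 1)%R)%:Z + 1 by lia.
elim: (absz _) => [|k IH]; first by rewrite addr0; have := r_double l; have := r_gt0 l; lra.
apply: (lt_trans IH); rewrite (_ : l + k.+1%:Z + 1 = l + k%:Z + 1 + 1); last by lia.
by have := r_double (l + k%:Z + 1); have := r_gt0 (l + k%:Z + 1); lra.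
Qed.

Lemma scale_le (l l' : int) : (l <= l')%R -> r_ l <= r_ l'.
Proof. by rewrite le_eqVlt => /orP[/eqP->//|/scale_lt/ltW]. Qed.

Hypothesis r_0 : r_ 0 = 1.

Lemma scale_nat_ge k : 2 ^+ k <= r_ k%:Z.
Proof.
elim: k => [|k IH]; first by rewrite r_0 expr0.
have := r_double k%:Z; rewrite (_ : k%:Z + 1 = k.+1%:Z); last by lia.
by rewrite exprS; lra.
Qed.

Lemma scale_neg_le k : r_ (- k%:Z) <= 2 ^- k.
Proof.
elim: k => [|k IH]; first by rewrite oppr0 r_0 expr0 invr1.
have := r_double (- k.+1%:Z); rewrite (_ : - k.+1%:Z + 1 = - k%:Z); last by lia.
by rewrite exprS invfM; lra.
Qed.

Lemma scale_above (v : R) : exists k : nat, v <= r_ k%:Z.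
Proof.
exists (Num.bound `|v|); apply: le_trans (scale_nat_ge _).
apply: (le_trans (ler_norm v)); apply: ltW.
apply: (lt_le_trans (archi_boundP (normr_ge0 v))).
by rewrite -natrX ler_nat; exact: ltnW (ltn_expl _ (ltnSn 1)).
Qed.

Lemma scale_below (v : R) : 0 < v -> exists k : nat, r_ (- k%:Z) < v.
Proof.
move=> v0; have [N NP] := half_pow_small (1 : R) v0.
exists N; apply: le_lt_trans (scale_neg_le N) _.
by have := NP N (leqnn N); rewrite div1r.
Qed.

End scales.

Section integers.
Variables l l' a b : int.

Lemma int_pred_lt : (l - 1 < l)%R. Proof. by rewrite gtrBl. Qed.

Lemma int_lt_succ_le : (l < l')%R -> (l + 1 <= l')%R.
Proof. by rewrite lezD1. Qed.

Lemma int_lt_le_pred : (l < l')%R -> (l <= l' - 1)%R.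
Proof. by rewrite lerBrDr; exact: int_lt_succ_le. Qed.

Lemma int_countdown (k : nat) : (a + k.+1%:Z < b)%R ->
  [/\ (b - k.+1%:Z = b - k%:Z - 1)%R, (a + k%:Z < b)%R, (a < b - k%:Z)%R,
      (b - k%:Z <= b)%R & (a < b - k%:Z - 1)%R].
Proof. by move=> h; split; lia. Qed.

End integers.

Section exit.
Context {R : realType} {n m : nat}.
Variables (f : 'I_m -> 'rV[R]_n -> 'rV[R]_n) (T : set 'rV[R]_n).
Hypothesis T_closed : closed T.

(** An exit could also be due to the end of the lifetime of [z]; [t < S] excludes this. As [T] is
    closed, it is met at the exit time itself. *)
Lemma exit_time_attained alpha q (S : \bar R) z (p t : R) :
  is_solution f alpha q S z -> ~ T q -> (t%:E < S)%E ->
  (exit_time T p S z <= (p + t)%:E)%E ->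
  exists s0 : R, [/\ exit_time T p S z = s0%:E, p < s0, s0 <= p + t & T (z (s0 - p))].
Proof.
move=> sol nTq tS et; have [S0 z0 _ _] := sol.
have oT := closed_openC T_closed.
have ge_exit (s : R) : p <= s ->
    (forall r : R, p <= r -> r < s -> ((r - p)%:E < S)%E /\ ~ T (z (r - p))) ->
    (s%:E <= exit_time T p S z)%E.
  by move=> ps H; apply: ereal_sup_ubound; exists s.
have around (s : R) : 0 <= s -> (s%:E < S)%E -> ~ T (z s) -> exists2 d : R, 0 < d &
    forall r, 0 <= r -> `|r - s| < d -> (r%:E < S)%E /\ ~ T (z r).
  move=> s_ge0 sS nTs; have [e e0 eP] := open_normP oT nTs.
  have [d d0 dP] := solution_continuous sol s_ge0 sS e0.
  by exists d => // r r0 /(dP r r0)[rS /eP].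
have [d d0 dP] := around 0 (lexx _) S0 ltac:(by rewrite z0).
have pd : ((p + d)%:E <= exit_time T p S z)%E.
  apply: ge_exit; first by rewrite lerDl ltW.
  move=> r pr rd; apply: dP; first by rewrite subr_ge0.
  by rewrite subr0 ger0_norm ?subr_ge0// ltrBlDl.
case E : (exit_time T p S z) et pd => [s0| |]//; rewrite !lee_fin => st ps.
have ps0 : p < s0 by apply: lt_le_trans ps; rewrite ltrDl.
exists s0; split => //; apply: contrapT => nTs0.
have sS : ((s0 - p)%:E < S)%E by apply: le_lt_trans tS; rewrite lee_fin lerBlDl.
have [d' d'0 d'P] := around (s0 - p) ltac:(by rewrite subr_ge0 ltW) sS nTs0.
have : ((s0 + d')%:E <= exit_time T p S z)%E.
  apply: ge_exit; first by rewrite (le_trans (ltW ps0))// lerDl ltW.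
  move=> r pr rd; have [rs|sr] := ltP r s0.
    have re : (r%:E < exit_time T p S z)%E by rewrite E lte_fin.
    exact: lt_exit_time re pr (lexx _).
  apply: d'P; first by rewrite subr_ge0.
  by rewrite opprB addrA subrK ger0_norm ?subr_ge0// ltrBlDl.
by rewrite E lee_fin gerDl leNgt d'0.
Qed.

End exit.

(** * Sampling trajectories of the global feedback *)

Section process_analysis.
Context {R : realType} {n m : nat}.
Variables (f : 'I_m -> 'rV[R]_n -> 'rV[R]_n) (T : set 'rV[R]_n).
Hypothesis T0 : T !=set0.
Hypothesis T_closed : closed T.
Hypothesis loc_lip : forall B : R, exists L M,
  [/\ 0 <= L, 0 <= M & lipschitz_bounded f B L M].

Variables (r_ : int -> R) (W : int -> 'rV[R]_n -> R).
Variables (kappa : int -> 'rV[R]_n -> 'I_m * bool) (c dl : int -> R).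
Variables (Lx : 'rV[R]_n -> int) (V : 'rV[R]_n -> label m).
Hypothesis r_gt0 : forall l, 0 < r_ l.
Hypothesis r_double : forall l, 2 * r_ l <= r_ (l + 1).
Hypothesis dl_gt0 : forall l, 0 < dl l.
Hypothesis W_le : forall l x, ~ T x -> rdist T x <= r_ l -> W l x <= c l.
Hypothesis W_dist : forall l x, W l x <= c l -> 2 * rdist T x <= r_ (l + 1).
Hypothesis W_dec : forall l,
  decreasing_feedback f T (W l) (kappa l) (c l) (dl l) (r_ (l - 1) / 2).
Hypothesis LxP : forall x, ~ T x ->
  W (Lx x) x <= c (Lx x) /\ forall l, (l < Lx x)%R -> c l < W l x.
Hypothesis VE : forall x,
  V x = Label (Letter 1) [:: (kappa (Lx x) x).1] (kappa (Lx x) x).2.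

(* [Lx x] is the least level containing [x]; by [W_le] and [W_dist] the levels
   are nested, [W l] being decreased by its feedback outside the ball of radius
   [r_ (l - 1)], i.e. on all of level [l] that is not in level [l - 1]. *)
Let level l x := W l x <= c l.

Lemma level_mono (l l' : int) x : (l <= l')%R -> ~ T x -> level l x -> level l' x.
Proof.
rewrite le_eqVlt => /orP[/eqP->//|ll] nTx /W_dist lx; apply: W_le => //.
have : r_ (l + 1) <= r_ l' by apply: scale_le => //; exact: int_lt_succ_le.
by have := rdist_ge0 T0 x; lra.
Qed.

Lemma not_level (l : int) x : ~ T x -> c l < W l x -> r_ l < rdist T x.
Proof. by move=> nTx lx; rewrite ltNge; apply/negP => /(W_le nTx); rewrite leNgt lx. Qed.

(** * One process, with steps adapted to the scales between [jlow] and [N] *)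

Variables (jlow N : int) (B Lc M dlt : R).
Hypothesis ball_bound : forall x, ~ T x -> rdist T x <= r_ (N + 1) -> `|x| <= B.
Hypothesis LM : lipschitz_bounded f (B + 1) Lc M.
Hypothesis Lc0 : 0 <= Lc.
Hypothesis M0 : 0 <= M.
Hypothesis dlt1 : dlt <= 1.
Hypothesis dlt_dl : forall l : int, (jlow < l)%R -> (l <= N)%R -> dlt <= dl l.
Hypothesis Mdlt : M * dlt < 1.
Hypothesis nMdlt : 2 * (n%:R * (M * dlt)) <= r_ jlow.
Hypothesis jlowN : (jlow < N)%R.

Variables (x : 'rV[R]_n) (pi : nat -> R) (alpha : R -> 'rV[R]_m).
Variables (y : R -> 'rV[R]_n) (J : option nat) (sigma : \bar R).
Hypothesis proc : sampling_process f T V x pi alpha y J sigma.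
Hypothesis pi_step : forall j, step_of J j -> pi j - pi j.-1 <= dlt.
Hypothesis x_dist : rdist T x <= r_ N.

(** All that is used later about one sampling step. Starting in level [N] bounds the state, and
    [M * dlt < 1] makes the multiflow outlive the step, so the process can end only by meeting
    [T]. *)
Lemma window j : step_of J j -> level N (y (pi j.-1)) ->
  exists (z : R -> 'rV[R]_n) (k : 'I_m * bool),
  [/\ [/\ z 0 = y (pi j.-1),
      forall s s', 0 <= s -> s <= s' -> s' <= pi j - pi j.-1 ->
        `|z s' - z s| <= M * (s' - s) &
      forall s, 0 < s -> s < pi j - pi j.-1 ->
        is_derive s (1 : R) z (dynamics f (z s) (ctrl k))],
      forall s, pi j.-1 <= s -> s < pi j -> (s%:E < sigma)%E \/ J <> Some j ->
        [/\ y s = z (s - pi j.-1), alpha s = ctrl k & ~ T (y s)],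
      J = Some j -> exists s0 : R,
        [/\ sigma = s0%:E, pi j.-1 < s0, s0 <= pi j & T (z (s0 - pi j.-1))],
      J <> Some j -> y (pi j) = z (pi j - pi j.-1) /\ ~ T (y (pi j)) &
      forall l : int, (jlow < l)%R -> (l <= N)%R -> Lx (y (pi j.-1)) = l ->
        0 <= W l (y (pi j.-1)) /\ forall s, 0 <= s -> s <= pi j - pi j.-1 ->
          W l (z s) <= W l (y (pi j.-1)) - s / 2].
Proof.
move=> jJ lN; have nTq := sampling_process_notin proc jJ.
have tdlt := pi_step jJ.
have [_ [pi0 piS _] _ _ /(_ j jJ)[S [z [mf yz fin]]]] := proc.
have j1 : j = j.-1.+1 by case: j jJ {lN nTq tdlt mf yz fin} => [[]|].
have t0 : 0 < pi j - pi j.-1 by rewrite subr_gt0 {2}j1.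
set p := pi j.-1 in lN nTq tdlt mf yz fin t0 *.
set q := y p in lN nTq mf *.
set t := pi j - p in tdlt t0 mf fin *.
pose k := kappa (Lx q) q.
have mfE s : multiflow_control V q t s = ctrl k by exact: simple_multiflow_control.
have qB : `|q| <= B.
  by apply: ball_bound => //; have := W_dist lN; have := rdist_ge0 T0 q; lra.
have Mt : M * t < 1 by apply: le_lt_trans Mdlt; rewrite ler_wpM2l.
have [tS zlip dz] := maximal_solution_step loc_lip (ctrl_control _) mfE mf qB LM Lc0 M0 (ltW t0) Mt.
have [sol _] := mf; have [S0 z0 _ _] := sol.
have pt : p + t = pi j by rewrite /t addrC subrK.
exists z, k; split.
- by split.
- move=> s ps sj sJ.
  have se : (s%:E < exit_time T p S z)%E.
    case: sJ fin; [move=> ss|move=> Jj]; case: ifPn => [/eqP Jj'|Jj'] [h1 h2] //.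
    + by rewrite -h2.
    + by apply: lt_trans h1; rewrite lte_fin.
    + by apply: lt_trans h1; rewrite lte_fin.
  have [yE aE] := yz s ps sj se; rewrite aE mfE yE; split => //.
  by have [] := lt_exit_time se ps (lexx _).
- move=> JE; move: fin; rewrite JE eqxx => -[h1 h2]; rewrite h2.
  have h3 : (exit_time T p S z <= (p + t)%:E)%E by rewrite pt.
  have [s0 [sE ps st Ts]] := exit_time_attained T_closed sol nTq tS h3.
  by exists s0; split; rewrite // -pt.
- move=> JE; move: fin; rewrite ifF; last by apply/negbTE/eqP.
  move=> [h1 ->]; split => //.
  have pj : p <= pi j by rewrite -subr_ge0 ltW.
  by have [_] := lt_exit_time h1 pj (lexx _).
- move=> l jl lN' LE; have [] := LxP nTq; rewrite LE => lq lq'.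
  (* Minimality of the level puts the state outside level [l - 1], hence in the region where [W l]
     decreases. *)
  have lq1 : r_ (l - 1) < rdist T q by apply: not_level => //; apply: lq'; exact: int_pred_lt.
  have h : 2 * (r_ (l - 1) / 2) < rdist T q by lra.
  have [Wge Wdec] := W_dec nTq lq h; split.
    by apply: le_trans Wge; exact: ltW.
  move=> s s0 st; apply: (Wdec S (multiflow_control V q t)) => //.
  + by move=> r _ _; rewrite mfE /k LE.
  + by apply: le_trans st (le_trans tdlt (dlt_dl jl lN')).
  + by apply: le_lt_trans tS; rewrite lee_fin.
Qed.

Lemma window_dist j z s : step_of J j -> z 0 = y (pi j.-1) ->
  (forall s s', 0 <= s -> s <= s' -> s' <= pi j - pi j.-1 -> `|z s' - z s| <= M * (s' - s)) ->
  forall s', 0 <= s -> s <= s' -> s' <= pi j - pi j.-1 ->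
  2 * rdist T (z s') <= 2 * rdist T (z s) + r_ jlow.
Proof.
move=> jJ z0 zlip s' s_ge0 ss st.
have h1 := rdist_lip T0 (z s') (z s).
have h2 := zlip s s' s_ge0 ss st.
have h3 : n%:R * `|z s' - z s| <= n%:R * (M * dlt).
  rewrite ler_wpM2l// (le_trans h2)// ler_wpM2l//.
  by have := pi_step jJ; lra.
by have := nMdlt; lra.
Qed.

(** If [l] is the least level of the state, [W l] decreases. Otherwise the state is in level
    [l - 1], hence within [r_ l / 2] of [T]; a short step does not leave the ball of radius [r_ l],
    which lies in level [l]. *)
Lemma window_level j : step_of J j -> J <> Some j -> level N (y (pi j.-1)) ->
  forall l : int, (jlow < l)%R -> (l <= N)%R -> level l (y (pi j.-1)) -> level l (y (pi j)).
Proof.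
move=> jJ nJ lN l jl lN' lq; have nTq := sampling_process_notin proc jJ.
have [_ [_ piS _] _ _ _] := proc.
have j1 : j = j.-1.+1 by case: j jJ {lN lq nTq nJ} => [[]|].
have t0 : 0 <= pi j - pi j.-1 by rewrite subr_ge0 {2}j1 ltW.
have [z [k [[z0 zlip _] _ _ /(_ nJ)[yj nTj] Wdec]]] := window jJ lN.
have [LE|LE] := eqVneq (Lx (y (pi j.-1))) l.
  have [_ /(_ _ t0 (lexx _))] := Wdec l jl lN' LE; rewrite yj /level => h.
  by apply: (le_trans h); apply: (le_trans _ lq); rewrite lerBlDr lerDl divr_ge0.
have [lLx lLx'] := LxP nTq.
have LlT : (Lx (y (pi j.-1)) < l)%R.
  rewrite lt_neqAle LE leNgt; apply/negP => /lLx'.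
  by rewrite ltNge; move: lq; rewrite /level => ->.
have : level (l - 1) (y (pi j.-1)) by apply: level_mono lLx => //; exact: int_lt_le_pred.
move=> /W_dist; rewrite subrK => h.
apply: W_le => //; have := window_dist jJ z0 zlip (lexx 0) t0 (lexx _).
rewrite z0 -yj => h2.
have : r_ jlow <= r_ l by apply: scale_le => //; exact: ltW.
lra.
Qed.

Lemma step_of_pred j : step_of J j.+2 -> step_of J j.+1 /\ J <> Some j.+1.
Proof.
move=> [_]; rewrite /step_of; case: J => [j0|] jj; last by [].
by split; [split => //; exact: ltnW|move=> [je]; move: jj; rewrite je ltnn].
Qed.

Lemma level_top j : step_of J j -> level N (y (pi j.-1)).
Proof.
have [nTx [pi0 _ _] y0 _ _] := proc.
case: j => [[]//|j]; elim: j => [_|j IH jJ].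
  by rewrite /= pi0 y0; exact: W_le.
have [jJ' nJ] := step_of_pred jJ.
by apply: (window_level jJ' nJ); rewrite ?lexx//; exact: IH.
Qed.

Lemma level_invariant (l : int) j j' : (jlow < l)%R -> (l <= N)%R ->
  (0 < j)%N -> (j <= j')%N -> step_of J j' ->
  level l (y (pi j.-1)) -> level l (y (pi j'.-1)).
Proof.
move=> jl lN; case: j => // j _; case: j' => [//|j'].
elim: j' => [|j' IH]; first by rewrite ltnS leqn0 => /eqP ->.
rewrite leq_eqVlt => /orP[/eqP[->]//|jj] jJ lj.
have [jJ' nJ] := step_of_pred jJ.
by apply: (window_level jJ' nJ) => //; [exact: level_top|exact: IH].
Qed.

Lemma process_end : (J = None /\ sigma = +oo%E) \/
  exists j s0, [/\ J = Some j, step_of J j & sigma = s0%:E].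
Proof.
case: proc => _ _ _ [J0 JN] _; case JE : J => [j|]; last by left; split => //; exact: JN.
right; have jJ : step_of J j by split; [case: (j) JE J0 => // -> []|rewrite JE].
have [_ [_ [_ _ /(_ JE)[s0 [sE _ _ _]] _ _]]] := window jJ (level_top jJ).
by exists j, s0; split => //; rewrite -JE.
Qed.

Lemma locate s : 0 <= s -> (s%:E < sigma)%E -> exists j,
  [/\ step_of J j, pi j.-1 <= s & s < pi j].
Proof.
move=> s0 ss; have [_ [pi0 piS /cvgryPgt/(_ s)[k _ kP]] _ _ _] := proc.
have [j sj jmin] := ex_minnP (ex_intro (fun j => s < pi j) k (kP k (leqnn k))).
have j0 : (0 < j)%N by case: j sj {jmin} => //; rewrite pi0 ltNge s0.
have pj : pi j.-1 <= s.
  rewrite leNgt; apply/negP => /jmin; case: (j) j0 => // j' _.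
  by rewrite ltnn.
exists j; split => //; split => //.
case JE : J => [j1|//]; apply: jmin.
have [[JN _]|[j2 [s2 [JE2 jJ2 sE]]]] := process_end; first by rewrite JN in JE.
have [_ [_ [_ _ /(_ JE2)[s0' [sE' _ h _]] _ _]]] := window jJ2 (level_top jJ2).
rewrite JE in JE2; case: JE2 => ->.
by move: ss; rewrite sE' lte_fin => /lt_le_trans; apply.
Qed.

Lemma point_value s : 0 <= s -> (s%:E < sigma)%E -> exists j (z : R -> 'rV[R]_n) k,
  [/\ [/\ step_of J j, pi j.-1 <= s & s < pi j],
      [/\ z 0 = y (pi j.-1),
      forall s s', 0 <= s -> s <= s' -> s' <= pi j - pi j.-1 ->
        `|z s' - z s| <= M * (s' - s) &
      forall s, 0 < s -> s < pi j - pi j.-1 ->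
        is_derive s (1 : R) z (dynamics f (z s) (ctrl k))],
      forall r, pi j.-1 <= r -> r < pi j -> (r%:E < sigma)%E ->
        [/\ y r = z (r - pi j.-1), alpha r = ctrl k & ~ T (y r)] &
      J <> Some j -> y (pi j) = z (pi j - pi j.-1) /\ ~ T (y (pi j))].
Proof.
move=> s0 ss; have [j [jJ pj sj]] := locate s0 ss.
have [z [k [h1 h2 _ h4 _]]] := window jJ (level_top jJ).
by exists j, z, k; split => // r r1 r2 rs; apply: h2 => //; left.
Qed.

Lemma point_notin s : 0 <= s -> (s%:E < sigma)%E -> ~ T (y s).
Proof.
move=> s0 ss; have [j [z [k [[_ pj sj] _ H _]]]] := point_value s0 ss.
by have [] := H s pj sj ss.
Qed.

Lemma point_control s : 0 <= s -> (s%:E < sigma)%E -> control_set (alpha s).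
Proof.
move=> s0 ss; have [j [z [k [[_ pj sj] _ H _]]]] := point_value s0 ss.
by have [_ -> _] := H s pj sj ss; exact: ctrl_control.
Qed.

Lemma point_drift j r s : step_of J j -> pi j.-1 <= r -> r <= s -> s < pi j ->
  (s%:E < sigma)%E -> 2 * rdist T (y s) <= 2 * rdist T (y r) + r_ jlow.
Proof.
move=> jJ pr rs sj ss.
have [z [k [[z0 zlip _] H _ _ _]]] := window jJ (level_top jJ).
have rsig : (r%:E < sigma)%E by apply: le_lt_trans ss; rewrite lee_fin.
have [-> _ _] := H s (le_trans pr rs) sj (or_introl ss).
have [-> _ _] := H r pr (le_lt_trans rs sj) (or_introl rsig).
by apply: (window_dist jJ z0 zlip); [rewrite subr_ge0|rewrite lerD2r|rewrite lerD2r ltW].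
Qed.

Lemma point_level (l : int) j s : (jlow <= l)%R -> step_of J j -> pi j.-1 <= s ->
  s < pi j -> (s%:E < sigma)%E -> level l (y (pi j.-1)) -> rdist T (y s) <= r_ (l + 1).
Proof.
move=> jl jJ pj sj ss /W_dist h.
have := point_drift jJ (lexx _) pj sj ss.
have : r_ jlow <= r_ (l + 1).
  by apply: scale_le => //; apply: le_trans jl _; rewrite lerDl.
lra.
Qed.

Lemma grid_lip j s : step_of J j -> 0 <= s -> s <= pi j.-1 ->
  `|y (pi j.-1) - y s| <= M * (pi j.-1 - s).
Proof.
have [_ [pi0 piS _] _ _ _] := proc.
case: j => [[]//|j]; elim: j s => [|j IH] s jJ s0 sj.
  have -> : s = 0 by apply/le_anti; rewrite s0 -pi0 sj.
  by rewrite /= pi0 !subrr normr0 mulr0.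
have [jJ' nJ] := step_of_pred jJ.
have [z [k [[z0 zlip _] H _ /(_ nJ)[yj _] _]]] := window jJ' (level_top jJ').
rewrite [j.+1.-1]/= in z0 zlip H yj; rewrite [j.+2.-1]/=.
have [sp|ps] := leP s (pi j).
  have h1 := IH s jJ' s0 sp; rewrite [j.+1.-1]/= in h1.
  have := zlip 0 (pi j.+1 - pi j) (lexx _); rewrite subr_ge0 (ltW (piS j)) => /(_ isT (lexx _)).
  rewrite z0 -yj subr0 => h2.
  rewrite -(subrK (y (pi j)) (y (pi j.+1))) -addrA (le_trans (ler_normD _ _))//; lra.
move: sj; rewrite [j.+2.-1]/= le_eqVlt => /orP[/eqP ->|sj].
  by rewrite !subrr normr0 mulr0.
have [-> _ _] := H s (ltW ps) sj (or_intror nJ).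
rewrite yj (_ : pi j.+1 - s = (pi j.+1 - pi j) - (s - pi j)); last by ring.
by apply: zlip; rewrite ?subr_ge0 ?lerD2r// ltW.
Qed.

Lemma trajectory_lip s s' : 0 <= s -> s <= s' -> (s'%:E < sigma)%E ->
  `|y s' - y s| <= M * (s' - s).
Proof.
move=> s0 ss s'S; have [j [z [k [[jJ pj sj] [z0 zlip _] H _]]]] := point_value (le_trans s0 ss) s'S.
have [yE _ _] := H s' pj sj s'S.
have [sp|ps] := leP s (pi j.-1).
  have h1 := grid_lip jJ s0 sp.
  have := zlip 0 (s' - pi j.-1) (lexx _); rewrite subr_ge0 lerD2r (ltW sj) => /(_ pj isT).
  rewrite z0 -yE subr0 => h2.
  rewrite -(subrK (y (pi j.-1)) (y s')) -addrA (le_trans (ler_normD _ _))//; lra.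
have sS : (s%:E < sigma)%E by apply: le_lt_trans s'S; rewrite lee_fin.
have [yE' _ _] := H s (ltW ps) (le_lt_trans ss sj) sS.
rewrite yE yE' (_ : s' - s = (s' - pi j.-1) - (s - pi j.-1)); last by ring.
by apply: zlip; rewrite ?subr_ge0 ?lerD2r// ltW.
Qed.

Lemma grid_ge0 i : 0 <= pi i.
Proof.
have [_ [pi0 piS _] _ _ _] := proc.
by elim: i => [|i IH]; [rewrite pi0|exact: le_trans IH (ltW (piS i))].
Qed.

Lemma final_point : sigma = +oo%E \/ exists (s0 : R) (w : 'rV[R]_n),
  [/\ sigma = s0%:E, 0 < s0, T w & forall s, 0 <= s -> s < s0 -> `|y s - w| <= M * (s0 - s)].
Proof.
have [[_ ->]|[j [s1 [JE jJ _]]]] := process_end; [by left|right].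
have [z [k [[z0 zlip _] H /(_ JE)[s0 [sE ps sj Tw]] _ _]]] := window jJ (level_top jJ).
exists s0, (z (s0 - pi j.-1)); split => //; first exact: le_lt_trans (grid_ge0 _) ps.
have key s : pi j.-1 <= s -> s < s0 -> `|y s - z (s0 - pi j.-1)| <= M * (s0 - s).
  move=> p_s ss; have sS : (s%:E < sigma)%E by rewrite sE lte_fin.
  have [-> _ _] := H s p_s (lt_le_trans ss sj) (or_introl sS).
  rewrite distrC (_ : s0 - s = (s0 - pi j.-1) - (s - pi j.-1)); last by ring.
  by apply: zlip; rewrite ?subr_ge0 ?lerD2r// ltW.
move=> s s_ge0 ss; have [p_s|sp] := leP (pi j.-1) s; first exact: key.
have h1 := grid_lip jJ s_ge0 (ltW sp); rewrite distrC in h1.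
have := key _ (lexx _) ps => h2.
rewrite -(subrK (y (pi j.-1)) (y s)) -addrA (le_trans (ler_normD _ _))//; lra.
Qed.

Lemma trajectory_solution : is_solution f alpha x sigma y.
Proof.
have [nTx [pi0 piS _] y0 _ _] := proc.
split => //.
- by have [->|[s0 [w [-> s00 _ _]]]] := final_point; rewrite ?lte_fin// ltry.
- move=> b b0 bS; apply: (@lip_absolutely_continuous _ _ M) => s t s0 st tb.
  by apply: trajectory_lip => //; apply: le_lt_trans bS; rewrite lee_fin.
- apply: (@ae_countable _ _ pi) => s snpi s0 sS.
  have [j [z [k [[jJ pj sj] [z0 zlip dz] H _]]]] := point_value (ltW s0) sS.
  have ps : pi j.-1 < s by rewrite lt_def pj andbT.
  have [b sb bS] := ereal_between sS.
  have [yE -> _] := H s pj sj sS.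
  apply: (is_derive_local (g := fun r => z (r - pi j.-1))
    (d := Num.min (Num.min (s - pi j.-1) (pi j - s)) (b - s))).
  + by rewrite !lt_min !subr_gt0 ps sj.
  + move=> r; rewrite !lt_min !ltr_norml => /andP[/andP[/andP[r1 _] /andP[_ r2]] /andP[_ r3]].
    have rS : (r%:E < sigma)%E by apply: lt_trans bS; rewrite lte_fin; lra.
    by have [] := H r ltac:(lra) ltac:(lra) rS.
  + by rewrite yE; apply: is_derive_translate; apply: dz; rewrite ?subr_gt0// ltrD2r.
Qed.

Lemma trajectory_left_limit s0 : sigma = s0%:E -> exists w,
  [/\ T w, y s @[s --> s0^'-] --> w & forall s, 0 <= s -> s < s0 -> `|y s - w| <= M * (s0 - s)].
Proof.
move=> sE; have [|[s1 [w [sE' s10 Tw yw]]]] := final_point; first by rewrite sE.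
move: sE'; rewrite sE => -[s01]; rewrite -s01 in s10 yw => {s01 s1}.
exists w; split => //; apply/cvgrPdist_le => e e0.
have M10 : 0 < M + 1 by rewrite ltr_wpDl.
near=> s.
have s_ge0 : 0 < s by near: s; exact: nbhs_left_gt.
have ss : s < s0 by near: s; exact: nbhs_left_lt.
have h : s0 - s < e / (M + 1) by near: s; apply: nbhs_left_ltBl; rewrite divr_gt0.
rewrite distrC (le_trans (yw s (ltW s_ge0) ss))//.
move: h; rewrite ltr_pdivlMr//; lra.
Unshelve. all: by end_near. Qed.

Lemma trajectory_extended s : (sigma <= s%:E)%E -> rdist T (extend sigma y s) = 0.
Proof.
move=> ss; have [sE|[s0 [_ [sE _ _ _]]]] := final_point; first by move: ss; rewrite sE leye_eq.
have [w [Tw yw _]] := trajectory_left_limit sE.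
rewrite /extend ltNge ss /= sE /= (cvg_lim _ yw)//; exact: rdist_in.
Qed.

Lemma trajectory_measurable :
  lebesgue_measurable_on [set s | 0 <= s /\ (s%:E < sigma)%E] alpha.
Proof.
move=> i; pose D j := [set s | step_of J j /\ pi j.-1 <= s /\ s < pi j /\ (s%:E < sigma)%E].
have mitv (I : interval R) : measurable ([set` I] : set (g_sigma_algebraType
    (completed_algebra_gen (@lebesgue_measure R)))).
  apply: sub_sigma_algebra; exists [set` I]; first exact: measurable_itv.
  by exists set0; [exact: negligible_set0|rewrite setU0].
have DE : [set s | 0 <= s /\ (s%:E < sigma)%E] = \bigcup_j D j.
  apply/seteqP; split => s /=.
    move=> [s0 ss]; have [j [jJ pj sj]] := locate s0 ss; by exists j.
  by move=> [j _ [_ [pj [_ ss]]]]; split => //; exact: le_trans (grid_ge0 _) pj.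
have mD j : measurable (D j : set (g_sigma_algebraType
    (completed_algebra_gen (@lebesgue_measure R)))).
  have [jJ|njJ] := pselect (step_of J j); last first.
    by rewrite (_ : D j = set0)// -subset0 => s [].
  have [sE|[s0 [_ [sE _ _ _]]]] := final_point.
    rewrite (_ : D j = `[pi j.-1, pi j[%classic)//.
    apply/seteqP; split => s /=; rewrite in_itv/=.
      by move=> [_ [-> [-> _]]].
    by move=> /andP[h1 h2]; rewrite /D /= sE ltry.
  rewrite (_ : D j = `[pi j.-1, Num.min (pi j) s0[%classic)//.
  apply/seteqP; split => s /=; rewrite in_itv/= lt_min.
    by move=> [_ [-> [->]]]; rewrite sE lte_fin.
  by move=> /andP[h1 /andP[h2 h3]]; rewrite /D /= sE lte_fin.
rewrite DE; apply/measurable_fun_bigcup => // j.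
have [jJ|njJ] := pselect (step_of J j); last first.
  rewrite (_ : D j = set0)//; first exact: measurable_fun_set0.
  by rewrite -subset0 => s [].
have [z [k [_ H _ _ _]]] := window jJ (level_top jJ).
apply: (@eq_measurable_fun _ _ _ _ _ (cst (ctrl k ord0 i))); last exact: measurable_cst.
by move=> s /set_mem[_ [pj [sj ss]]] /=; have [_ -> _] := H s pj sj (or_introl ss).
Qed.

Lemma trajectory_admissible : admissible_pair f T x sigma alpha y.
Proof.
split.
- exact: trajectory_measurable.
- exact: point_control.
- exact: point_notin.
- exact: trajectory_solution.
- move=> s0 sE; have [w [Tw _ yw]] := trajectory_left_limit sE.
  have [sy|[s1 [_ [sE' s10 _ _]]]] := final_point; first by rewrite sy in sE.
  move: sE'; rewrite sE => -[s01]; rewrite -s01 in s10 => {s01}.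
  under eq_cvg do rewrite (distE T0).
  apply: cvg_EFin; first by near=> s.
  apply/cvgrPdist_le => e e0.
  have K0 : 0 < n%:R * M + 1 by rewrite ltr_wpDl// mulr_ge0.
  near=> s.
  have s_ge0 : 0 < s by near: s; exact: nbhs_left_gt.
  have ss : s < s0 by near: s; exact: nbhs_left_lt.
  have h : s0 - s < e / (n%:R * M + 1) by near: s; apply: nbhs_left_ltBl; rewrite divr_gt0.
  rewrite /= sub0r normrN ger0_norm; last exact: rdist_ge0.
  apply: (le_trans (rdist_lip T0 (y s) w)); rewrite rdist_in// add0r.
  apply: (@le_trans _ _ (n%:R * (M * (s0 - s)))).
    by rewrite ler_wpM2l// yw// ltW.
  move: h; rewrite ltr_pdivlMr//; lra.
Unshelve. all: by end_near. Qed.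

Variable E : R.
Hypothesis E_ge : forall l : int, (jlow < l)%R -> (l <= N)%R -> 2 * c l + 2 <= E.
Hypothesis E_ge0 : 0 <= E.

(* Each level costs at most the time [E] of descending from [c l] to [0] at rate
   [1 / 2]. *)
Lemma level_entry (k : nat) j : (jlow + k%:Z < N)%R -> step_of J j ->
  k%:R * E <= pi j.-1 -> level (N - k%:Z) (y (pi j.-1)).
Proof.
elim: k j => [|k IH] j kN jJ Ej; first by rewrite subr0; exact: level_top.
have [_ [pi0 piS _] y0 _ _] := proc.
have [l1E kN' jl lN jl1] := int_countdown kN.
rewrite l1E; move: (N - k%:Z)%R IH jl lN jl1 => l IH jl lN jl1 {l1E}.
have l1N : (l - 1 <= N)%R := le_trans (ltW (int_pred_lt l)) lN.
rewrite /level leNgt; apply/negP => nl.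
have j0 : (0 < j)%N by case: jJ.
(* As long as level [l - 1] is not entered, [W l] decreases at rate 1 / 2 from the first sampling
   time after [k%:R * E], whose delay accounts for the [- 1]. At step [j] the bound is negative,
   against [W l >= 0]. *)
suff H i : (0 < i)%N -> (i <= j)%N -> k%:R * E <= pi i.-1 ->
    W l (y (pi i.-1)) <= c l - (pi i.-1 - k%:R * E - 1) / 2.
  have kE : k.+1%:R * E = k%:R * E + E by rewrite -natr1 mulrDl mul1r.
  have Ej' : k%:R * E <= pi j.-1 by apply: le_trans Ej; rewrite kE lerDl.
  have := H j j0 (leqnn _) Ej'.
  have [z [k' [_ _ _ _ Wd]]] := window jJ (level_top jJ).
  have nTq := sampling_process_notin proc jJ.
  have LE : Lx (y (pi j.-1)) = l.
    have [h1 h2] := LxP nTq; apply/eqP; rewrite eq_le.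
    apply/andP; split; rewrite leNgt; apply/negP => h.
      by have := h2 _ h; rewrite ltNge; have := IH j kN' jJ Ej'; rewrite /level => ->.
    have : level (l - 1) (y (pi j.-1)) by apply: level_mono h1 => //; exact: int_lt_le_pred.
    by rewrite /level leNgt nl.
  have [Wge _] := Wd l jl lN LE.
  have := E_ge jl lN; lra.
case: i => // i _; elim: i => [_|i IHi ij].
  rewrite /= pi0 => kE; have kE0 : 0 <= k%:R * E by exact: mulr_ge0.
  have h : level l (y (pi 0%N)).
    have step1 : step_of J 1 by split => //; case: (J) jJ => // j1 [_]; exact: leq_trans.
    by have := IH 1%N kN' step1; rewrite /= pi0; exact.
  by rewrite -pi0 in h *; move: h; rewrite /level pi0; lra.
rewrite [i.+2.-1]/= => kE.
have ij' : (i.+1 <= j)%N by exact: ltnW.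
have step2 : step_of J i.+2 by split => //; case: (J) jJ => // j1 [_]; exact: leq_trans.
have [step1 nJ] := step_of_pred step2.
have lNi := level_top step1.
have [z [k' [_ _ _ /(_ nJ)[yi _] Wd]]] := window step1 lNi.
have t0 : 0 <= pi i.+1 - pi i by rewrite subr_ge0 ltW.
have td := pi_step step1; rewrite [i.+1.-1]/= in yi Wd lNi td.
(* If the previous sampling time precedes [k%:R * E], at most 1 has elapsed since, and membership in
   level [l] is enough. *)
have [kEi|iEk] := leP (k%:R * E) (pi i); last first.
  have := IH i.+2 kN' step2 kE; rewrite /level [i.+2.-1]/=.
  have := dlt1; lra.
have nTq := sampling_process_notin proc step1.
have LE : Lx (y (pi i)) = l.
  have [h1 h2] := LxP nTq; apply/eqP; rewrite eq_le.
    apply/andP; split; rewrite leNgt; apply/negP => h.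
    by have := h2 _ h; rewrite ltNge; have := IH i.+1 kN' step1 kEi; rewrite /level => ->.
  have h3 : level (l - 1) (y (pi i)) by apply: level_mono h1 => //; exact: int_lt_le_pred.
  (* An earlier visit to level [l - 1] would persist up to step [j]. *)
  have := @level_invariant (l - 1) i.+1 j jl1 l1N isT ij' jJ h3.
  by rewrite /level leNgt nl.
have [_ /(_ _ t0 (lexx _))] := Wd l jl lN LE.
rewrite -yi => h; have := IHi ij' kEi; rewrite [i.+1.-1]/=; lra.
Qed.

Lemma grid_mono i j : (i <= j)%N -> pi i <= pi j.
Proof.
have [_ [_ piS _] _ _ _] := proc.
elim: j => [|j IH]; first by rewrite leqn0 => /eqP ->.
by rewrite leq_eqVlt => /orP[/eqP->//|/IH h]; exact: le_trans h (ltW (piS j)).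
Qed.

Lemma step_of_le i j : (0 < i)%N -> (i <= j)%N -> step_of J j -> step_of J i.
Proof.
move=> i0 ij [_ jJ]; split => //; case: (J) jJ => // j0; exact: leq_trans.
Qed.

Lemma trajectory_bounded (i : int) s : (jlow < i)%R -> (i <= N)%R -> rdist T x <= r_ i ->
  0 <= s -> rdist T (extend sigma y s) <= r_ (i + 1).
Proof.
move=> ji iN xi s0; have [ss|ss] := ltP s%:E sigma; last first.
  by rewrite trajectory_extended//; exact/ltW/r_gt0.
have [nTx [pi0 _ _] y0 _ _] := proc.
rewrite /extend ss; have [j [jJ pj sj]] := locate s0 ss.
apply: (point_level (ltW ji) jJ pj sj ss).
have j0 : (0 < j)%N by case: jJ.
by apply: (level_invariant ji iN (ltn0Sn 0) j0 jJ); rewrite /= pi0 y0; exact: W_le.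
Qed.

(** The extra 1 covers the delay between [s] and the last sampling time before it. *)
Lemma trajectory_settles (k : nat) s : (N - k%:Z)%R = (jlow + 1)%R ->
  k%:R * E + 1 <= s -> rdist T (extend sigma y s) <= r_ (jlow + 1 + 1).
Proof.
move=> kE sE; have s0 : 0 <= s by have : 0 <= k%:R * E := mulr_ge0 (ler0n _ _) E_ge0; lra.
have [ss|ss] := ltP s%:E sigma; last first.
  by rewrite trajectory_extended//; exact/ltW/r_gt0.
rewrite /extend ss; have [j [jJ pj sj]] := locate s0 ss.
have jl : (jlow <= jlow + 1)%R by rewrite lerDl.
apply: (point_level jl jJ pj sj ss).
rewrite -kE; apply: level_entry => //.
  by rewrite -ltrBrDr kE ltrDl.
have := pi_step jJ; have := dlt1; lra.
Qed.

(** Levels are invariant at sampling times only, and [tau] may fall inside a step. Drifting to the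
    next sampling time costs one scale, returning from level [l + 1] to a distance costs another. *)
Lemma trajectory_stays (l : int) tau s : (jlow <= l)%R -> (l + 1 <= N)%R -> 0 <= tau ->
  rdist T (extend sigma y tau) <= r_ l -> tau <= s ->
  rdist T (extend sigma y s) <= r_ (l + 1 + 1).
Proof.
move=> jl lN tau0 ytau taus; have [ss|ss] := ltP s%:E sigma; last first.
  by rewrite trajectory_extended//; exact/ltW/r_gt0.
have tauS : (tau%:E < sigma)%E by apply: le_lt_trans ss; rewrite lee_fin.
move: ytau; rewrite /extend ss tauS => ytau.
have jlr : r_ jlow <= r_ l by exact: scale_le.
have rl := r_double l; have rl1 := r_double (l + 1); have rp := r_gt0 l; have rp1 := r_gt0 (l + 1).
have [i [iJ pi_ taui]] := locate tau0 tauS.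
have [si|is_] := ltP s (pi i).
  have := point_drift iJ pi_ taus si ss; lra.
have [j [jJ pj sj]] := locate (le_trans tau0 taus) ss.
have ij : (i < j)%N.
  by rewrite ltnNge; apply/negP => /grid_mono h; have := lt_le_trans sj (le_trans h is_); rewrite ltxx.
have i1J : step_of J i.+1 by exact: step_of_le jJ.
have [i0 _] := iJ.
have [_ nJ] : step_of J i /\ J <> Some i by case: (i) i0 i1J => // i' _; exact: step_of_pred.
have [z [k [[z0 zlip _] H _ /(_ nJ)[yi nTi] _]]] := window iJ (level_top iJ).
have [yt _ _] := H tau pi_ taui (or_introl tauS).
have jl1 : (jlow < l + 1)%R by apply: le_lt_trans jl _; rewrite ltrDl.
have li : level (l + 1) (y (pi i)).
  apply: W_le => //.
  have := window_dist iJ z0 zlip (s := tau - pi i.-1) (s' := pi i - pi i.-1).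
  rewrite subr_ge0 lerD2r (ltW taui) lexx -yi -yt => /(_ pi_ isT isT); lra.
have jl1' : (jlow <= l + 1)%R by exact: ltW.
apply: (point_level jl1' jJ pj sj ss).
exact: (level_invariant jl1 lN (ltn0Sn i) ij jJ li).
Qed.

End process_analysis.

Lemma int_least (P : int -> Prop) (l0 l1 : int) :
  P l1 -> (forall l, (l <= l0)%R -> ~ P l) ->
  exists l, P l /\ forall l', (l' < l)%R -> ~ P l'.
Proof.
move=> Pl1 nP.
have l01 : (l0 < l1)%R by rewrite ltNge; apply/negP => /nP.
have [k] : exists k : nat, `[< P (l0 + k%:Z) >].
  exists (absz (l1 - l0)%R); apply/asboolP; rewrite (_ : (l0 + _)%R = l1)//; lia.
move=> Pk; have [j /asboolP Pj jmin] :=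
  ex_minnP (ex_intro (fun k : nat => `[< P (l0 + k%:Z) >]) k Pk).
exists (l0 + j%:Z)%R; split => // l' l'j Pl'.
have [/nP//|l0l'] := leP l' l0.
have l'E : (l' = l0 + (absz (l' - l0)%R)%:Z)%R by lia.
have : (j <= absz (l' - l0)%R)%N by apply: jmin; apply/asboolP; rewrite -l'E.
lia.
Qed.

Lemma int_positive_min (R : realType) (v : int -> R) (a : int) (k : nat) :
  (forall l, 0 < v l) ->
  exists2 d, 0 < d & forall l, (a < l)%R -> (l <= a + k%:Z)%R -> d <= v l.
Proof.
move=> v0; elim: k => [|k [d d0 dP]].
  by exists 1 => // l; rewrite addr0 => al la; have := lt_le_trans al la; rewrite ltxx.
exists (Num.min d (v (a + k.+1%:Z))); first by rewrite lt_min d0 v0.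
move=> l al lk; have [h|h] := leP l (a + k%:Z)%R.
  by rewrite ge_min dP.
have -> : l = (a + k.+1%:Z)%R by lia.
by rewrite ge_min lexx orbT.
Qed.

Section index_arithmetic.
Variables N M : nat.
(* Six scales below [- M]: trajectories settle in level [jl + 1], which lies within
   distance [r_ (jl + 2)], and [H] shifts the scale by four. *)
Let jl : int := - (M + 6)%N%:Z.

Lemma bottom_lt : (jl < N%:Z)%R.
Proof. by rewrite /jl; lia. Qed.

Lemma bottom_six : (jl + 1 + 1 + 1 + 1 + 1 + 1)%R = (- M%:Z)%R.
Proof. by rewrite /jl; lia. Qed.

Lemma bottom_count : (N%:Z - (N + (M + 5))%N%:Z)%R = (jl + 1)%R.
Proof. by rewrite /jl; lia. Qed.

Lemma bottom_range l : (l <= N%:Z)%R -> (l <= jl + (N + M + 6)%N%:Z)%R.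
Proof. by rewrite /jl; lia. Qed.

Lemma bottom_Negz k : (jl < Negz k)%R -> (k.+1 <= M + 6)%N.
Proof. by rewrite /jl; lia. Qed.

End index_arithmetic.

(** * The global feedback and its parameters *)

Section assembly.
Context {R : realType} {n m : nat}.
Variables (f : 'I_m -> 'rV[R]_n -> 'rV[R]_n) (T : set 'rV[R]_n).
Hypothesis loc_lip : forall B : R, exists L M,
  [/\ 0 <= L, 0 <= M & lipschitz_bounded f B L M].

(** This is the source of an index in ['I_m]: a bracket has at least one letter. *)
Lemma label_string_cons k (v : label m) : control_label f k v ->
  exists i g, label_string v = i :: g.
Proof.
move=> [_ [[c [_ cB]] _ _]].
have : (0 < degree (label_bracket v))%N.
  rewrite /degree; elim: (label_bracket v) => //= B1 h1 B2 _.
  by rewrite size_cat ltn_addr.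
case: (label_string v) cB => [|i g]; last by exists i, g.
by rewrite leqn0 addn_eq0 => /andP[_ /eqP ->].
Qed.

Lemma letter_feedback (V : 'rV[R]_n -> label m) :
  (forall x, ~ T x -> exists i b, V x = Label (Letter 1) [:: i] b) ->
  feedback_generator f T 1 V.
Proof.
move=> H x /H[i [b ->]]; split => //; split => /=.
- by exists 0%N.
- by move=> j _; exact: lipschitz_bounded_continuous.
- by move=> z _; exact: lipschitz_bounded_continuous.
Qed.

Hypothesis T0 : T !=set0.
Hypothesis T_closed : closed T.
Hypothesis T_boundary : compact (boundary T).

(** The feedback and [H] are fixed before [rho] and [r]. Bounding [H] of the distance, instead of
    the distance, makes the same conclusion usable for both notions of stabilizability. *)
Lemma controllable_feedback (i0 : 'I_m) Gamma : class_Kinfty Gamma ->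
  asymptotically_controllable f T Gamma ->
  exists (V : 'rV[R]_n -> label m) (delta : R -> R -> R) (H : R -> R) (S : R -> R -> R),
  [/\ forall x, exists i b, V x = Label (Letter 1) [:: i] b,
      forall a b, 0 < delta a b,
      class_Kinfty H /\ (forall s, 0 <= s -> s <= H s),
      settling_bound S &
      forall rho r : R, 0 < r -> r < rho ->
      forall x pi alpha y J sigma, sampling_process f T V x pi alpha y J sigma ->
        (forall j, step_of J j -> pi j - pi j.-1 <= delta rho r) ->
        rdist T x <= rho ->
        let Y := extend sigma y in
        [/\ admissible_pair f T x sigma alpha y,
            forall s, 0 <= s -> rdist T (Y s) <= H rho,
            forall s, S rho r <= s -> H (rdist T (Y s)) <= r &
            forall tau, 0 <= tau -> H (rdist T (Y tau)) <= r ->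
              forall s, tau <= s -> rdist T (Y s) <= r]].
Proof.
move=> KG [Sb steer].
have G_ge0 := Kinfty_ge0 KG.
pose h s := 2 * Gamma s + 2 * s.
have Kh : class_Kinfty h := Kinfty_double KG.
have [r_ [r_0 r_P]] := scales_exist Kh.
have r_gt0 l : 0 < r_ l by have [] := r_P l.
have r_S l : r_ (l + 1) = h (r_ l) by have [] := r_P l.
have r_double l : 2 * r_ l <= r_ (l + 1).
  by rewrite r_S /h; have := G_ge0 _ (ltW (r_gt0 l)); lra.
have hge s : 0 <= s -> s <= h s by move=> s0; have := G_ge0 s s0; rewrite /h; lra.
(* Rounding a distance up to a scale costs one application of [h], [trajectory_stays] costs two, and
   one is kept in reserve. *)
pose H := h \o (h \o (h \o h)).
have KH : class_Kinfty H by do 3! apply: (Kinfty_comp Kh).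
have h_ge0 := Kinfty_ge0 Kh.
have Hge s : 0 <= s -> h (h s) <= H s.
  move=> s0; have h1 := h_ge0 s s0; have h2 := h_ge0 _ h1; have h3 := h_ge0 _ h2.
  exact: le_trans (hge _ h2) (hge _ h3).
have HE l : H (r_ l) = r_ (l + 1 + 1 + 1 + 1) by rewrite /H /= !r_S.
have data (l : int) : exists D : ('rV[R]_n -> R) * ('rV[R]_n -> 'I_m * bool) * R * R,
    [/\ 0 < D.2, 0 <= D.1.2,
      forall x, ~ T x -> rdist T x <= r_ l -> D.1.1.1 x <= D.1.2,
      forall x, D.1.1.1 x <= D.1.2 -> rdist T x <= Gamma (r_ l) + r_ l &
      decreasing_feedback f T D.1.1.1 D.1.1.2 D.1.2 D.2 (r_ (l - 1) / 2)].
  (* Half of [r_ (l - 1)], because the feedback decreases [W] only beyond twice the goal radius. *)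
  have h1 : 0 < r_ (l - 1) / 2 by rewrite divr_gt0.
  have h2 : r_ (l - 1) / 2 < r_ l.
    by have := r_double (l - 1); rewrite subrK; have := r_gt0 (l - 1); lra.
  have [W [ka [c [d Hd]]]] :=
    scale_feedback T0 T_closed T_boundary loc_lip i0 h1 h2 (steer _ _ h1 h2).
  by exists (W, ka, c, d).
have [D DP] := choice data.
pose W l := (D l).1.1.1; pose kappa l := (D l).1.1.2.
pose c l := (D l).1.2; pose dl l := (D l).2.
have dl_gt0 l : 0 < dl l by have [] := DP l.
have c_ge0 l : 0 <= c l by have [] := DP l.
have W_le l x : ~ T x -> rdist T x <= r_ l -> W l x <= c l by have [_ _ + _ _] := DP l; apply.
have W_dist l x : W l x <= c l -> 2 * rdist T x <= r_ (l + 1).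
  by have [_ _ _ + _] := DP l => /[apply]; rewrite r_S /h; lra.
have W_dec l : decreasing_feedback f T (W l) (kappa l) (c l) (dl l) (r_ (l - 1) / 2).
  by have [] := DP l.
(* A least level exists because a point off [T] has positive distance, while the levels shrink
   towards [T]. *)
have least x : exists l, ~ T x -> W l x <= c l /\ forall l', (l' < l)%R -> c l' < W l' x.
  have [Tx|nTx] := pselect (T x); first by exists 0.
  have d0 := rdist_gt0 T0 T_closed nTx.
  have [k1 k1P] := scale_above r_double r_0 (rdist T x).
  have [k0 k0P] := scale_below r_double r_0 d0.
  have [|l ll|l [lP lmin]] := @int_least (fun l => W l x <= c l) (- k0%:Z - 1) k1%:Z.
  - exact: W_le.
  - move/W_dist; apply/negP; rewrite -ltNge.
    have : r_ (l + 1) <= r_ (- k0%:Z) by apply: scale_le => //; rewrite -lerBrDr.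
    lra.
  - by exists l => _; split => // l' /lmin/negP; rewrite -ltNge.
have [Lx LxP] := choice least.
pose V x := Label (Letter 1) [:: (kappa (Lx x) x).1] (kappa (Lx x) x).2.
have VE x : V x = Label (Letter 1) [:: (kappa (Lx x) x).1] (kappa (Lx x) x).2 by [].
(* Least indices make [N] increasing in [rho] and [Mm] decreasing in [r], as the monotonicity of the
   settling bound demands. *)
have exN (rho : R) : exists N : nat, rho <= r_ N%:Z /\ forall k : nat, rho <= r_ k%:Z -> (N <= k)%N.
  have [k kP] := scale_above r_double r_0 rho.
  have [N NP Nmin] := ex_minnP (ex_intro (fun k : nat => rho <= r_ k%:Z) k kP).
  by exists N.
have [N NP] := choice exN.
have exM (r : R) : exists N : nat, 0 < r -> r_ (- N%:Z) <= r /\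
    forall k : nat, r_ (- k%:Z) <= r -> (N <= k)%N.
  have [r0|] := pselect (0 < r); last by exists 0%N.
  have [k /ltW kP] := scale_below r_double r_0 r0.
  have [M MP Mmin] := ex_minnP (ex_intro (fun k : nat => r_ (- k%:Z) <= r) k kP).
  by exists M.
have [Mm MP] := choice exM.
pose jl r : int := - (Mm r + 6)%N%:Z.
(* Summing over all |l| <= K dominates each [2 * c l + 2] in the range and is monotone in [K]. *)
pose e (K : nat) := \sum_(k < K.+1) ((2 * c k%:Z + 2) + (2 * c (- k%:Z) + 2)).
have e_term k : 0 <= (2 * c k%:Z + 2) + (2 * c (- k%:Z) + 2).
  by have := c_ge0 k%:Z; have := c_ge0 (- k%:Z); lra.
have e_ge0 K : 0 <= e K by apply: sumr_ge0 => k _; exact: e_term.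
have e_ge (K k : nat) : (k <= K)%N -> (2 * c k%:Z + 2) + (2 * c (- k%:Z) + 2) <= e K.
  move=> kK; rewrite /e (bigD1 (Ordinal (kK : (k < K.+1)%N)))//= lerDl.
  by apply: sumr_ge0 => i _; exact: e_term.
have e_mono K K' : (K <= K')%N -> e K <= e K'.
  elim: K' => [|K' IH]; first by rewrite leqn0 => /eqP ->.
  rewrite leq_eqVlt => /orP[/eqP->//|/IH h']; apply: (le_trans h').
  by rewrite /e [leRHS]big_ord_recr/= lerDl; exact: e_term.
pose E rho r := e (N rho) + e (Mm r + 6)%N.
have E_ge0 rho r : 0 <= E rho r by rewrite addr_ge0.
pose K rho r := (N rho + (Mm r + 5))%N.
pose S rho r := (K rho r)%:R * E rho r + 1.
have E_geP rho r (l : int) : (jl r < l)%R -> (l <= (N rho)%:Z)%R -> 2 * c l + 2 <= E rho r.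
  move=> jll lN; rewrite /E; case: l jll lN => k jll lN.
    have := @e_ge (N rho) k lN; have := e_ge0 (Mm r + 6)%N; have := c_ge0 (- k%:Z); lra.
  have kE : Negz k = (- k.+1%:Z)%R by rewrite NegzE.
  have := @e_ge (Mm r + 6)%N k.+1 (bottom_Negz jll).
  rewrite -kE; have := e_ge0 (N rho); have := c_ge0 k.+1%:Z; lra.
have pars (rr : R * R) : exists P : R * R * R * R,
    let: (B, Lc, M, dlt) := P in
    [/\ forall x, ~ T x -> rdist T x <= r_ ((N rr.1)%:Z + 1) -> `|x| <= B,
        [/\ 0 <= Lc, 0 <= M & lipschitz_bounded f (B + 1) Lc M],
        0 < dlt /\ dlt <= 1,
        forall l : int, (jl rr.2 < l)%R -> (l <= (N rr.1)%:Z)%R -> dlt <= dl l &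
        M * dlt < 1 /\ 2 * (n%:R * (M * dlt)) <= r_ (jl rr.2)].
  have [B _ BP] := rdist_bounded T0 T_closed T_boundary (r_ ((N rr.1)%:Z + 1)).
  have [Lc [M [Lc0 M0 LM]]] := loc_lip (B + 1).
  have [d d0 dP] := int_positive_min (jl rr.2) (N rr.1 + Mm rr.2 + 6)%N dl_gt0.
  (* One denominator for three requirements: [dlt <= 1], [M * dlt < 1], and a drift small against
     the lowest scale. *)
  pose w := 1 + M + 2 * (n%:R * M) / r_ (jl rr.2).
  have nM : 0 <= n%:R * M by rewrite mulr_ge0.
  have nMr : 0 <= 2 * (n%:R * M) / r_ (jl rr.2) by rewrite divr_ge0 ?mulr_ge0// ltW.
  have w0 : 0 < w by rewrite /w; lra.
  pose dlt := Num.min d (1 / (w + 1)).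
  have w10 : 0 < w + 1 by rewrite addr_gt0.
  have dw : dlt * (w + 1) <= 1.
    have : dlt <= 1 / (w + 1) by rewrite ge_min lexx orbT.
    by rewrite ler_pdivlMr.
  have dlt0 : 0 < dlt by rewrite lt_min d0 divr_gt0// addr_gt0.
  exists (B, Lc, M, dlt); split => //.
  - split => //; have : 0 <= dlt * w by rewrite mulr_ge0// ltW.
    lra.
  - move=> l l1 l2; apply: (@le_trans _ _ d); first by rewrite ge_min lexx.
    by apply: dP => //; exact: bottom_range.
  - have a1 : 0 <= dlt * M by rewrite mulr_ge0// ltW.
    have a2 : 0 <= dlt * (2 * (n%:R * M) / r_ (jl rr.2)) by rewrite mulr_ge0// ltW.
    have dwE : dlt * (w + 1) = 2 * dlt + dlt * M + dlt * (2 * (n%:R * M) / r_ (jl rr.2)).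
      by rewrite /w; ring.
    split; first by rewrite mulrC; lra.
    have : dlt * (2 * (n%:R * M) / r_ (jl rr.2)) <= 1 by lra.
    rewrite mulrA ler_pdivrMr// mul1r; lra.
have [P PP] := choice pars.
exists V, (fun rho r => (P (rho, r)).2), H, S; split.
- by move=> x; exists (kappa (Lx x) x).1, (kappa (Lx x) x).2.
- move=> a b; have := PP (a, b); by case: (P (a, b)) => [[[B Lc] M] dlt] [_ _ [? _] _ _].
- split => // s s0; apply: le_trans (Hge s s0).
  exact: le_trans (hge s s0) (hge _ (h_ge0 s s0)).
- have Nmono a a' : a <= a' -> (N a <= N a')%N.
    by move=> aa; apply: (NP a).2; exact: le_trans (NP a').1.
  have Manti b b' : 0 < b -> b <= b' -> (Mm b' <= Mm b)%N.
    by move=> b0 bb; apply: (MP b' (lt_le_trans b0 bb)).2; exact: le_trans (MP b b0).1 bb.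
  split.
  + by move=> a b a0 b0; rewrite /S ltr_wpDl// mulr_ge0.
  + move=> a a' b a0 aa b0; rewrite /S lerD2r; apply: ler_pM => //.
      by rewrite ler_nat leq_add2r Nmono.
    by rewrite /E lerD2r e_mono// Nmono.
  + move=> a b b' a0 b0 bb; rewrite /S lerD2r; apply: ler_pM => //.
      by rewrite ler_nat leq_add2l leq_add2r Manti.
    by rewrite /E lerD2l e_mono// leq_add2r Manti.
move=> rho r r0 rrho x pi alpha y J sigma proc psteps xrho Y.
have rho0 : 0 < rho by exact: lt_trans rrho.
have := PP (rho, r); case: (P (rho, r)) psteps => [[[B Lc] M] dlt] /= psteps.
move=> [BP [Lc0 M0 LM] [dlt0 dlt1] dlt_dl [Mdlt nMdlt]].
have jN : (jl r < (N rho)%:Z)%R by exact: bottom_lt.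
have xN : rdist T x <= r_ (N rho)%:Z := le_trans xrho (NP rho).1.
have rr : r_ (jl r + 1 + 1 + 1 + 1 + 1 + 1) <= r.
  rewrite (_ : (jl r + 1 + 1 + 1 + 1 + 1 + 1)%R = (- (Mm r)%:Z)%R); first exact: (MP r r0).1.
  exact: bottom_six.
have leS l : r_ l <= r_ (l + 1) by apply: (scale_le r_gt0 r_double); rewrite lerDl.
have between v : 0 < v -> exists l, v <= r_ l /\ r_ (l - 1) < v.
  move=> v0; have [k1 k1P] := scale_above r_double r_0 v.
  have [k0 k0P] := scale_below r_double r_0 v0.
  have [|l ll|l [lP lmin]] := @int_least (fun l => v <= r_ l) (- k0%:Z) k1%:Z => //.
    apply/negP; rewrite -ltNge; apply: le_lt_trans k0P; exact: scale_le.
  by exists l; split => //; rewrite ltNge; apply/negP/lmin; exact: int_pred_lt.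
have adm := trajectory_admissible T0 T_closed loc_lip r_gt0 r_double dl_gt0 W_le W_dist
  W_dec LxP VE BP LM Lc0 M0 dlt_dl Mdlt nMdlt jN proc psteps xN.
split => //.
- move=> s s0; have [i [rhoi irho]] := between rho rho0.
  have iN : (i <= (N rho)%:Z)%R.
    rewrite leNgt; apply/negP => /int_lt_le_pred/(scale_le r_gt0 r_double) h1.
    by have h2 := (NP rho).1; clear -h1 h2 irho; lra.
  have ji : (jl r < i)%R.
    rewrite ltNge; apply/negP => /(scale_le r_gt0 r_double) h1.
    have h2 : r_ (jl r) <= r_ (jl r + 1 + 1 + 1 + 1 + 1 + 1).
      by do 5! apply: le_trans (leS _); exact: leS.
    by clear -h1 h2 rr rhoi rrho; lra.
  have := trajectory_bounded T0 T_closed loc_lip r_gt0 r_double dl_gt0 W_le W_dist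
    W_dec LxP VE BP LM Lc0 M0 dlt_dl Mdlt nMdlt jN proc psteps xN ji iN (le_trans xrho rhoi) s0.
  move=> /le_trans; apply; apply: le_trans (Hge rho (ltW rho0)).
  (* As [r_ (i - 1) < rho], the radius [r_ (i + 1)] is at most [h (h rho)]. *)
  rewrite r_S -(subrK 1 i) r_S; apply: (Kinfty_le Kh); first by apply: h_ge0; exact: ltW.
  by apply: (Kinfty_le Kh); exact: ltW.
- move=> s sS.
  have kE : ((N rho)%:Z - (K rho r)%:Z)%R = (jl r + 1)%R by exact: bottom_count.
  have := trajectory_settles T0 T_closed loc_lip r_gt0 r_double dl_gt0 W_le W_dist
    W_dec LxP VE BP LM Lc0 M0 dlt1 dlt_dl Mdlt nMdlt jN proc psteps xN
    (@E_geP rho r) (E_ge0 rho r) kE sS.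
  move=> h1; apply: le_trans rr; rewrite -HE.
  apply: (Kinfty_le KH) => //; exact: rdist_ge0.
- move=> tau tau0 ytau s taus.
  (* Distances below the lowest scale, possibly 0, are treated as that scale. *)
  have [vj|jv] := leP (rdist T (Y tau)) (r_ (jl r)).
    have j1N : (jl r + 1 <= (N rho)%:Z)%R by exact: int_lt_succ_le.
    apply: (le_trans (trajectory_stays T0 T_closed loc_lip r_gt0 r_double dl_gt0 W_le W_dist
      W_dec LxP VE BP LM Lc0 M0 dlt_dl Mdlt nMdlt jN proc psteps xN (lexx _) j1N tau0 vj taus)).
    apply: le_trans rr.
    by do 3! apply: le_trans (leS _).
  have v0 : 0 < rdist T (Y tau) by apply: lt_trans jv.
  have [l [vl lv]] := between _ v0.
  have rl : r_ (l + 1 + 1 + 1) <= r.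
    apply: le_trans ytau; rewrite (_ : (l + 1 + 1 + 1 = l - 1 + 1 + 1 + 1 + 1)%R); last first.
      by rewrite subrK.
    by rewrite -HE; apply: (Kinfty_le KH); exact: ltW.
  have jll : (jl r <= l)%R.
    rewrite leNgt; apply/negP => /ltW/(scale_le r_gt0 r_double) h1.
    by clear -h1 vl jv; lra.
  have lN : (l + 1 <= (N rho)%:Z)%R.
    rewrite leNgt; apply/negP => Nl.
    have h1 : r_ (N rho)%:Z <= r_ (l + 1) by apply: (scale_le r_gt0 r_double); exact: ltW.
    have h2 := (NP rho).1; have h3 := leS (l + 1); have h4 := leS (l + 1 + 1).
    by clear -h1 h2 h3 h4 rl rrho; lra.
  apply: (le_trans (trajectory_stays T0 T_closed loc_lip r_gt0 r_double dl_gt0 W_le W_dist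
      W_dec LxP VE BP LM Lc0 M0 dlt_dl Mdlt nMdlt jN proc psteps xN jll lN tau0 vl taus)).
  exact: le_trans (leS _) rl.
Qed.

End assembly.

(** * Equivalence of the three conditions *)

Section conclusion.
Context {R : realType} {n m : nat}.
Variables (f : 'I_m -> 'rV[R]_n -> 'rV[R]_n) (T : set 'rV[R]_n).
Hypothesis loc_lip : forall B : R, exists L M,
  [/\ 0 <= L, 0 <= M & lipschitz_bounded f B L M].

Definition degree_one_stabilizable : Prop :=
  (exists U, admissible_U T U /\ U_sample_stabilizable f T 1 U) /\ sample_stabilizable f T 1.

Lemma bounded_setI_compact (A : set 'rV[R]_n) (g : 'rV[R]_n -> R) (K : set R) (B : R) :
  closed A -> continuous g -> compact K ->
  (forall x, A x -> K (g x) -> `|x| <= B) -> compact (A `&` g @^-1` K).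
Proof.
move=> cA cg cK AB; apply: bounded_closed_compact.
  exists B; split; first exact: num_real.
  by move=> b Bb x [Ax Kx]; apply: le_trans (ltW Bb); exact: AB.
apply: closedI => //; apply: closed_comp; first by move=> x _; exact: cg.
by apply: compact_closed.
Qed.

(** For properness, [s <= H s] turns a bound on [U] into a bound on the distance, and a point of the
    closure is within 1 of a point off [T], where [rdist_bounded] applies. *)
Lemma admissible_U_dist (H : R -> R) : T !=set0 -> closed T -> compact (boundary T) ->
  class_Kinfty H -> (forall s, 0 <= s -> s <= H s) ->
  admissible_U T (fun x => H (rdist T x)).
Proof.
move=> T0 cT bT KH Hge; have H_ge0 := Kinfty_ge0 KH.
have d_ge0 := rdist_ge0 T0.
have [/Kinfty_continuousP Hc Hm H0 _] := KH.
have cU : continuous (fun x => H (rdist T x)).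
  apply: continuous_epsP => x e e0.
  have [d d0 dP] := Hc _ (d_ge0 x) e e0.
  have n0 : 0 < n%:R + 1 :> R by rewrite ltr_wpDl.
  exists (d / (n%:R + 1)); first by rewrite divr_gt0.
  move=> z; rewrite ltr_pdivlMr// => xz; apply: dP => //.
  have h1 := rdist_lip T0 z x; have h2 := rdist_lip T0 x z.
  have h3 := normr_ge0 (z - x); rewrite [`|x - z|]distrC in h2.
  by rewrite ltr_distl; apply/andP; split; lra.
split.
- exact: continuous_subspaceT.
- by move=> x _; exact: H_ge0.
- move=> K _ cK; have [k [_ kP]] := compact_bounded cK.
  have [B _ BP] := rdist_bounded T0 cT bT (k + 1 + n%:R).
  apply: (@bounded_setI_compact _ _ _ (B + 1)) => //; first exact: closed_closure.
  move=> x /(_ _ (nbhsx_ballx x 1 ltr01))[z [nTz]].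
  rewrite -ball_normE /ball_/= => xz Kx.
  have hk : H (rdist T x) <= k + 1.
    by apply: le_trans (ler_norm _) _; apply: (kP (k + 1)) => //; rewrite ltrDl.
  have zB : `|z| <= B.
    apply: BP => //; have h1 := rdist_lip T0 z x; rewrite distrC in h1.
    have h2 := Hge _ (d_ge0 x).
    have h3 : n%:R * `|x - z| <= n%:R by rewrite ler_piMr// ltW.
    lra.
  rewrite -(subrK z x) (le_trans (ler_normD _ _))// addrC lerD// ltW//.
- split.
    move=> x nTx; have d0 := rdist_gt0 T0 cT nTx.
    by apply: lt_le_trans (Hge _ (ltW d0)).
  move=> x [_ nI]; rewrite rdist_in//; apply: contrapT => nTx; apply: nI.
  by rewrite /interior; apply: open_nbhs_nbhs; split => //; exact: closed_openC.
Qed.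

(** In degree 1 the lower bounds on the steps vanish, so both notions restrict steps only from
    above. With [U] equal to [H] of the distance, [phi = id] fits the last two items of
    [controllable_feedback]. *)
Lemma controllable_degree_one (i0 : 'I_m) Gamma : T !=set0 -> closed T ->
  compact (boundary T) -> class_Kinfty Gamma -> asymptotically_controllable f T Gamma ->
  degree_one_stabilizable.
Proof.
move=> T0 cT bT KG steer.
have [V [delta [H [S [VE delta0 [KH Hge] setS stab]]]]] :=
  controllable_feedback loc_lip T0 cT bT i0 KG steer.
have fV : feedback_generator f T 1 V by apply: letter_feedback => // x _; exact: VE.
have [S0 _ _] := setS.
have ellV x : ell V x = 1%N by have [i [b E]] := VE x; rewrite /ell E.
split.
- exists (fun x => H (rdist T x)); split; first exact: admissible_U_dist.
  exists V, (fun rho r => [tuple delta rho r]), H, id, S; split => //.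
  + by move=> a b _ _ i; rewrite (ord1 i) tnth0.
  + split => //; split => //; first by apply: continuous_subspaceT => x; exact: cvg_id.
    by move=> M; exists (`|M| + 1); [rewrite addr_ge0|rewrite (le_lt_trans (ler_norm M))// ltrDl].
  + move=> rho r r0 rrho x pi alpha y J sigma proc sc; rewrite (distE T0) lee_fin => xrho Y.
    have rho0 : 0 < rho by exact: lt_trans rrho.
    have steps j : step_of J j -> pi j - pi j.-1 <= delta rho r.
      by move=> jJ; have [_] := sc j jJ; rewrite ellV.
    have [adm Ya Yb Yc] := stab rho r r0 rrho x pi alpha y J sigma proc steps xrho.
    split => //.
    * by move=> s s0; rewrite (distE T0) lee_fin; exact: Ya.
    * apply: ereal_inf_lbound; exists (S rho r) => //; split; first exact/ltW/S0.
      exact: Yb.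
    * move=> tau tau0 Utau s taus; rewrite (distE T0) lee_fin.
      by apply: (Yc tau) => //; exact: ltW.
- exists V, delta, H, S; split => //.
  move=> rho r r0 rrho pi [_ piP] x nTx; rewrite (distE T0) lee_fin => xrho.
  move=> alpha y J sigma proc Y.
  have steps j : step_of J j -> pi j - pi j.-1 <= delta rho r by move=> [/piP[]].
  have [adm Ya Yb Yc] := stab rho r r0 rrho x pi alpha y J sigma proc steps xrho.
  split => //.
  + by move=> s s0; rewrite (distE T0) lee_fin; exact: Ya.
  + move=> s sS; rewrite (distE T0) lee_fin.
    by apply: le_trans (Yb s sS); apply: Hge; exact: rdist_ge0.
Qed.

(* For [T = set0] the distance is [+oo] and for [T = setT] there is no initial
   point. A feedback generator must nonetheless exist, which could fail if [m = 0];
   its letters are extracted from the given one. *)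
Lemma vacuous_degree_one k (V : 'rV[R]_n -> label m) :
  feedback_generator f T k V -> (T = set0 \/ T = setT) -> degree_one_stabilizable.
Proof.
move=> fV T0.
have none x (rho : R) : ~ T x -> ~ (dist T x <= rho%:E)%E.
  case: T0 => ->; last by move=> /(_ I).
  by rewrite /dist image_set0 ereal_inf0 leye_eq.
pose V1 x := Label (Letter 1) (take 1 (label_string (V x))) true.
have fV1 : feedback_generator f T 1 V1.
  apply: letter_feedback => // x /fV/label_string_cons[i [g E]].
  by exists i, true; rewrite /V1 E /= take0.
have Kid : class_Kinfty (@id R).
  split => //; first by apply: continuous_subspaceT => x; exact: cvg_id.
  by move=> M; exists (`|M| + 1); [rewrite addr_ge0|rewrite (le_lt_trans (ler_norm M))// ltrDl].
have set1 : settling_bound (fun _ _ : R => 1) by split.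
split.
(* The complement of [T] has empty boundary here, so a proper function that never vanishes is
   positive definite. *)
- exists (fun x => 1 + `|x|); split.
    have cU : continuous (fun x : 'rV[R]_n => 1 + `|x|).
      apply: (@lipschitz_continuous _ _ _ _ 1) => x z.
      by rewrite mul1r opprD addrACA subrr add0r ler_dist_dist.
    split.
    + exact: continuous_subspaceT.
    + by move=> x _; rewrite addr_ge0.
    + move=> K _ cK; have [b [_ bP]] := compact_bounded cK.
      apply: (@bounded_setI_compact _ _ _ (b + 1)) => //; first exact: closed_closure.
      move=> x _ /(bP (b + 1) _); rewrite ltrDl => /(_ ltr01)/(le_trans (ler_norm _)).
      lra.
    + split; first by move=> x _; rewrite ltr_pwDl.
      move=> x [cx nI]; exfalso; apply: nI; move: cx.
      case: T0 => ->; first by rewrite setC0 interiorT.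
      by rewrite setCT closure0.
  exists V1, (fun _ _ => [tuple 1]), id, id, (fun _ _ => 1); split => //.
    by move=> a b _ _ i; rewrite (ord1 i) tnth0.
  by move=> rho r _ _ x pi alpha y J sigma [nTx _ _ _ _] _ /(none _ _ nTx).
- exists V1, (fun _ _ => 1), id, (fun _ _ => 1); split => //.
  by move=> rho r _ _ pi _ x nTx /(none _ _ nTx).
Qed.

End conclusion.

(** The two degenerate targets are separated because [rdist] needs a point of [T], and a control
    index is obtained only at a point off [T]. *)
Lemma stabilizable_degree_one (R : realType) (n m : nat)
    (f : 'I_m -> 'rV[R]_n -> 'rV[R]_n) (T : set 'rV[R]_n) k :
  (forall B : R, exists L M, [/\ 0 <= L, 0 <= M & lipschitz_bounded f B L M]) ->
  closed T -> compact (boundary T) -> (1 <= k)%N ->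
  (exists2 U, admissible_U T U & U_sample_stabilizable f T k U) \/
  sample_stabilizable f T k -> degree_one_stabilizable f T.
Proof.
move=> loc_lip cT bT k1 stab.
have [V fV] : exists V, feedback_generator f T k V.
  by case: stab => [[U _ [V [d [G [p [t [fV _ _ _ _]]]]]]]|[V [d [G [s [fV _ _ _ _]]]]]]; exists V.
have [TE|TN0] := eqVneq T set0; first exact: (vacuous_degree_one loc_lip fV (or_introl TE)).
have [TE|TNT] := eqVneq T setT; first exact: (vacuous_degree_one loc_lip fV (or_intror TE)).
have T0 : T !=set0 by apply/set0P.
have [x nTx] : exists x, ~ T x.
  apply: contrapT => H; move/eqP: TNT; apply; apply/seteqP; split => // x _.
  by apply: contrapT => nTx; apply: H; exists x.
have [i0 _] := label_string_cons (fV x nTx).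
have [Gamma KG steer] : exists2 Gamma, class_Kinfty Gamma & asymptotically_controllable f T Gamma.
  case: stab => [[U [cU _ _ _] US]|SS].
    exact: (U_sample_stabilizable_controllable T0 loc_lip k1 cU US).
  exact: (sample_stabilizable_controllable T0 loc_lip k1 SS).
exact: (controllable_degree_one loc_lip i0 T0 cT bT KG steer).
Qed.

Theorem theorem4p2 (R : realType) (n m kbar : nat) (hk : (1 <= kbar)%N)
    (f : 'I_m -> 'rV[R]_n -> 'rV[R]_n) (T : set 'rV[R]_n)
    (l : 'rV[R]_n -> 'rV[R]_m -> R)
    (l_ge0 : forall x a, control_set a -> 0 <= l x a)
    (T_closed : closed T)
    (T_boundary : compact (boundary T))
    (l_lipschitz : forall a, control_set a -> locally_lipschitz (fun x => l x a))
    (f_regular : forall Omega : set 'rV[R]_n,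
       open Omega -> bounded_set Omega -> Omega !=set0 ->
       forall i, of_class_Ck1b kbar.-1 Omega (f i)) :
  ((exists k, (1 <= k)%N /\
      exists U, admissible_U T U /\ U_sample_stabilizable f T k U) <->
   (exists k, (1 <= k)%N /\ sample_stabilizable f T k)) /\
  ((exists k, (1 <= k)%N /\ sample_stabilizable f T k) <->
   sample_stabilizable f T 1).
Proof.
have loc_lip := regular_lipschitz_bounded f_regular.
have key k := @stabilizable_degree_one R n m f T k loc_lip T_closed T_boundary.
have key2 : (exists k, (1 <= k)%N /\ sample_stabilizable f T k) -> degree_one_stabilizable f T.
  by move=> [k [k1 H]]; apply: (key k k1); right.
split; split.
- move=> [k [k1 [U [aU US]]]]; exists 1%N; split => //.
  have [|//] := key k k1; first by left; exists U.
- by move=> /key2[[U [aU US]] _]; exists 1%N; split => //; exists U.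
- by move=> /key2[].
- by move=> H; exists 1%N.
Qed.
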